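(* In the setting of the context, for all $0\le i,j\le n$ we have $\mathrm{ord}\,\tilde A(\tilde\epsilon_j,\tilde\epsilon_i)\ge j$. For $i=j$ we have $\mathrm{ord}\,\tilde A(\tilde\epsilon_j,\tilde\epsilon_j)=j$, and in fact $\tilde A(\tilde\epsilon_j,\tilde\epsilon_j)/p^j\equiv1\pmod{\gamma}$. Finally, for $j<i$ we have $\mathrm{ord}\,\tilde A(\tilde\epsilon_j,\tilde\epsilon_i)>j$.
   Context: Let $p$ be a prime (arbitrary), $q=p^a$, $n\ge1$, $\bar\lambda\in\mathbb{F}_q^*$. For $u\in\mathbb{Z}^n$, $m(u)=\max\{0,-u_1,\dots,-u_n\}$ and $w(u)=\sum_iu_i+(n+1)m(u)$. Let $\mathbb{Q}_q$ be the unramified extension of $\mathbb{Q}_p$ of degree $a$, $\zeta_p$ a primitive $p$-th root of unity, $\Omega_0=\mathbb{Q}_q(\zeta_p)$, $\mathcal{O}_0=\mathbb{Z}_q[\zeta_p]$, $\mathrm{ord}\,p=1$, congruences mod $\gamma$ taken in $\mathcal{O}_0$. Let $\sigma$ be the Frobenius generator of $\mathrm{Gal}(\mathbb{Q}_q/\mathbb{Q}_p)$ extended by $\sigma(\zeta_p)=\zeta_p$. Fix $\gamma$ a zero of $\sum_{j\ge0}t^{p^j}/p^j$ with $\mathrm{ord}\,\gamma=1/(p-1)$; put $\gamma_m=\sum_{j=0}^m\gamma^{p^j}/p^j$. Let $\lambda$ be the Teichmüller lift of $\bar\lambda$. $\mathcal{C}_0=\{\sum_u\xi(u)\gamma^{w(u)}x^u:\xi(u)\in\mathcal{O}_0,\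 \xi(u)\to0\}$, $\tilde u=\gamma^{w(u)}x^u$. Let $\theta_\infty(t)=\mathrm{AH}(\gamma t)$ with $\mathrm{AH}(t)=\exp(\sum_{j\ge0}t^{p^j}/p^j)$, $F_\lambda(x)=\theta_\infty(\lambda/(x_1\cdots x_n))\prod_{j}\theta_\infty(x_j)$, $\psi(x^u)=x^{u/p}$ if $p\mid u$ (all coordinates) and $0$ otherwise, and $\alpha_1=\sigma^{-1}\circ\psi\circ F_\lambda(x)$ on $\mathcal{C}_0$. For $1\le l\le n$ let $D_l=x_l\frac{\partial}{\partial x_l}+\sum_{m\ge0}p^m\gamma_m\big(x_l^{p^m}-\lambda^{p^m}(x_1\cdots x_n)^{-p^m}\big)$ acting on $\mathcal{C}_0$; these satisfy $pD_l\circ\alpha_1=\alpha_1\circ D_l$, so $\alpha_1$ induces a $\sigma^{-1}$-semilinear endomorphism of $W:=\mathcal{C}_0/\sum_{l=1}^nD_l\mathcal{C}_0$ (the top cohomology $H^n$ of the complex $(\Omega^\bullet_{\mathcal{C}_0},\nabla(D))$). Let $\tilde\epsilon_i=\gamma^ix_1\cdots x_i$ for $0\le i\le n$; $W$ is a free $\mathcal{O}_0$-module with basis $\{\tilde\epsilon_i\}_{i=0}^n$. $\tilde A(\tilde\epsilon_j,\tilde\epsilon_i)$ denotes the coefficient of $\tilde\epsilon_j$ when the class of $\alpha_1(\tilde\epsilon_i)$ in $W$ is expressed in this basis. *)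

(* Defs.v *)
From HB Require Import structures.
From mathcomp Require Import all_boot all_order all_fingroup all_algebra all_field.
From mathcomp Require Import finmap.
From mathcomp Require Import boolp classical_sets cardinality constructive_ereal.

Set Implicit Arguments.
Unset Strict Implicit.
Unset Printing Implicit Defensive.

Import Order.TTheory GRing.Theory Num.Theory.

Local Open Scope ring_scope.

(* The k-th coefficient of AH(t) = exp(\sum_(j >= 0) t^(p^j) / p^j).  For p > 1
   the terms with j > k, and the powers with m > k, only involve t^i with
   i > k, so truncating both sums at k is exact. *)
Definition AH_coef (p k : nat) : rat :=
  (\sum_(m < k.+1) (m`!%:R)^-1 *:
     (\sum_(j < k.+1) ((p ^ j)%N%:R)^-1 *: 'X^(p ^ j)) ^+ m : {poly rat})`_k.

(* Exponents u in Z^n are row vectors. *)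
Definition mpart (n : nat) (u : 'rV[int]_n) : int :=
  \big[Order.max/0]_(l < n) - u ord0 l.

Definition weight (n : nat) (u : 'rV[int]_n) : int :=
  \sum_(l < n) u ord0 l + n.+1%:Z * mpart u.

Section Valuation.
Variables (p : nat) (Qp : fieldType) (L : splittingFieldType Qp).
Variable ord : L -> \bar rat.

Record is_ord : Prop := IsOrd {
  ord_eqy : forall x, ord x = +oo%E <-> x = 0;
  ord_neNy : forall x, ord x <> -oo%E;
  ordM : forall x y, ord (x * y) = (ord x + ord y)%E;
  ordD : forall x y, (Order.min (ord x) (ord y) <= ord (x + y)%R)%E;
  ord_p : ord p%:R = 1%E }.

Definition has_vlim (s : nat -> L) (l : L) : Prop :=
  forall N : nat, exists M : nat, forall i : nat, (M <= i)%N ->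
    (N%:R%:E <= ord (s i - l)%R)%E.

Definition vcauchy (s : nat -> L) : Prop :=
  forall N : nat, exists M : nat, forall i j : nat, (M <= i)%N -> (M <= j)%N ->
    (N%:R%:E <= ord (s i - s j)%R)%E.

(* The base field is the completion of the rationals for ord; as ord p = 1,
   ord is p-adic there (Ostrowski), so the base field is the p-adic field. *)
Record is_Qp : Prop := IsQp {
  Qp_dense : forall (x : Qp) (N : nat),
    exists r : rat, (N%:R%:E <= ord ((x - ratr r)%:A : L)%R)%E;
  Qp_complete : forall s : nat -> Qp, vcauchy (fun i => (s i)%:A) ->
    exists l : Qp, has_vlim (fun i => (s i)%:A) l%:A }.

(* Ramification index 1; residue fields being perfect, there is no
   separability condition. *)
Definition unramified (Qq : {subfield L}) : Prop :=
  forall x, x \in Qq -> x != 0 -> exists y : Qp, ord x = ord (y%:A : L).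

Definition in_Zq (Qq : {subfield L}) (x : L) : Prop :=
  x \in Qq /\ (0 <= ord x)%E.

(* The ring Zq[zeta]. *)
Definition in_O0 (Qq : {subfield L}) (zeta x : L) : Prop :=
  exists P : {poly L}, (forall k, in_Zq Qq P`_k) /\ x = P.[zeta].

Record is_reduction (O : L -> Prop) (k : fieldType) (red : L -> k) : Prop :=
  IsReduction {
    red1 : red 1 = 1;
    redD : forall x y, O x -> O y -> red (x + y) = red x + red y;
    redM : forall x y, O x -> O y -> red (x * y) = red x * red y;
    red_ker : forall x, O x -> (red x = 0 <-> (0 < ord x)%E);
    red_surj : forall c, exists2 x, O x & red x = c }.

Definition congr_mod (O : L -> Prop) (g x y : L) : Prop :=
  exists2 c, O c & x - y = g * c.

(* Unordered convergence of a family; the value 0 is junk when it diverges. *)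
Definition has_vsum (I : choiceType) (f : I -> L) (s : L) : Prop :=
  forall N : nat, exists A : {fset I}, forall B : {fset I}, (A `<=` B)%fset ->
    (N%:R%:E <= ord (s - \sum_(i <- B) f i)%R)%E.

Definition vsum (I : choiceType) (f : I -> L) : L := xget 0 (has_vsum f).

End Valuation.

Section Dwork.
Variables (p n : nat) (Qp : fieldType) (L : splittingFieldType Qp).
Variable ord : L -> \bar rat.
Variable O : L -> Prop.
Variables (gamma lambda : L) (sigma : gal_of {:L}).

(* A formal Laurent series \sum_u f(u) x^u is its coefficient function. *)
Definition series := 'rV[int]_n -> L.

Definition mono (c : L) (u : 'rV[int]_n) : series :=
  fun v => if v == u then c else 0.

Definition lmul (f g : series) : series :=
  fun v => vsum ord (fun u : 'rV[int]_n => f (v - u) * g u).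

(* The exponents of x_l, of x_1 ... x_n and of x_1 ... x_i. *)
Definition ex (l : 'I_n) : 'rV[int]_n := delta_mx ord0 l.
Definition exall : 'rV[int]_n := const_mx 1.
Definition exfirst (i : nat) : 'rV[int]_n := \row_(l < n) (l < i)%N%:R.

Definition theta_coef (k : nat) : L := ratr (AH_coef p k) * gamma ^+ k.

(* theta_oo(c x^u) *)
Definition theta_at (c : L) (u : 'rV[int]_n) : series :=
  fun v => vsum ord (fun k : nat =>
    if v == u *+ k then theta_coef k * c ^+ k else 0).

Definition F_lambda : series :=
  lmul (theta_at lambda (- exall))
       (\big[lmul/mono 1 0]_(l < n) theta_at 1 (ex l)).

(* psi keeps the terms x^u with p | u and turns them into x^(u/p), so the
   coefficient of x^v in psi f is that of x^(pv) in f. *)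
Definition psi (f : series) : series := fun v => f (v *+ p).

Definition alpha1 (f : series) : series :=
  fun v => (sigma^-1)%g (psi (lmul F_lambda f) v).

Definition gamma_ (m : nat) : L :=
  \sum_(j < m.+1) gamma ^+ (p ^ j) / (p ^ j)%N%:R.

(* \sum_m p^m gamma_m (x_l^(p^m) - lambda^(p^m) (x_1 ... x_n)^(-p^m)) *)
Definition Hser (l : 'I_n) : series :=
  fun v => vsum ord (fun m : nat =>
    p%:R ^+ m * gamma_ m *
      (mono 1 (ex l *+ (p ^ m)) v
       - mono (lambda ^+ (p ^ m)) (- (exall *+ (p ^ m))) v)).

Definition Dop (l : 'I_n) (f : series) : series :=
  fun v => (v ord0 l)%:~R * f v + lmul (Hser l) f v.

Definition tends_to0 (xi : series) : Prop :=
  forall N : nat, finite_set [set u | (ord (xi u) < N%:R%:E)%E].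

Definition in_C0 (f : series) : Prop :=
  exists xi : series, [/\ forall u, O (xi u), tends_to0 xi &
    forall u, f u = xi u * gamma ^ weight u].

(* f and g have the same class in W = C_0 / \sum_l D_l C_0. *)
Definition eqW (f g : series) : Prop :=
  exists h : 'I_n -> series, (forall l, in_C0 (h l)) /\
    forall v, f v - g v = \sum_(l < n) Dop l (h l) v.

Definition eps (i : nat) : series := mono (gamma ^+ i) (exfirst i).

(* A j i is the coefficient of eps j in the class of alpha1 (eps i). *)
Definition frobenius_matrix (A : 'M[L]_n.+1) : Prop :=
  (forall j i, O (A j i)) /\
  forall i : 'I_n.+1,
    eqW (alpha1 (eps i)) (fun v => \sum_(j < n.+1) A j i * eps j v).

End Dwork.

(* Main.v *)
Require Import Defs.
From HB Require Import structures.
From mathcomp Require Import all_boot all_order all_fingroup all_algebra all_field.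
From mathcomp Require Import finmap.
From mathcomp Require Import boolp classical_sets cardinality constructive_ereal.
From mathcomp Require Import zify ring lra.

Set Implicit Arguments.
Unset Strict Implicit.
Unset Printing Implicit Defensive.

Import Order.TTheory GRing.Theory Num.Theory.

Local Open Scope ring_scope.

(* With X_l = gamma x_l and Y = gamma / (x_1 ... x_n), the module C_0 consists of the
   series in X_1, ..., X_n, Y subject to X_1 ... X_n Y = gamma^(n+1), and D_l is the
   difference of two operators of the form X d/dX + H(X), one in X_l and one in lambda Y.
   In one variable the polynomials T^k 1 in T = X d/dX + H(X) are an orthonormal basis of
   the series in X, and in this basis multiplication by X is f(T) |-> x(T) f(T - 1), where
   x(T) = T mod gamma solves T = \sum_m c_m x(T) x(T - 1) ... x(T - p^m + 1) with
   H(X) = \sum_m c_m X^(p^m).  Equating the n + 1 operators T kills the images of the D_l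
   and identifies W with the series f(T) modulo the image of
   J f = x(T)^(n+1) f(T - 1) - lambda gamma^(n+1) f(T), with eps_j going to x^j.
   As ord c_m >= p^m - 1, the series p x has integral coefficients in p T, and starts with
   p T modulo gamma.  The coefficient of the normalized monomial of exponent u in
   alpha1 (eps_i) is divisible by p^(w(u)), so its image in W is an integral series in p T;
   dividing it by (p x)^(n+1) modulo J leaves a remainder \sum_j b_j (p x)^j, that is
   A j i = p^j b_j.  Modulo gamma, the monomials with w(u) = j <= i contributing to b_j
   satisfy w(p u - u_i) + i = p w(u) for the exponent u_i of eps_i, which forces u = u_i.
   The remainder is unique because J f = x^(n+1) f(T - 1) has degree > n modulo gamma.
   All this is done modulo p^N, where the series are polynomials. *)

(** The rule for multiplication by X comes from T X = X (T + 1): it gives X f(T) 1 = f(T - 1) X 1,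
    hence X^k 1 = x(T) x(T - 1) ... x(T - k + 1). As X d/dX kills 1, T 1 = H(X) 1, which is the
    equation for x(T). The operator J expresses the relation X_1 ... X_n Y = gamma^(n+1):
    multiplying once by each of X_1, ..., X_n, lambda Y sends f(T) to x(T)^(n+1) f(T - 1), and this
    has to agree with multiplication by lambda gamma^(n+1). Two lattices are in play. The
    divisibility of the Frobenius is visible among series integral in p T, where moreover T and T -
    1 agree modulo p; existence of the division is proved there. A relation in W only supplies
    series integral in the X_l and Y, hence only integral in T; uniqueness of the remainder is
    proved in that larger lattice, where the two computations meet. The residue 1 on the diagonal is
    a product of two signs: the Artin-Hasse coefficient 1/(p-1)! is -1 modulo p by Wilson, and
    gamma^(p-1)/p is -1 modulo gamma. The inverse of sigma does not disturb this because it moves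
    gamma by a factor that is 1 modulo gamma. *)

Record valuation (p : nat) (Qp : fieldType) (L : splittingFieldType Qp) :=
  Valuation { val_ord :> L -> \bar rat; val_ordP : is_ord p val_ord }.

(** * Ultrametric calculus for a valuation with values in the rationals *)

Section Valuation.
Variables (p : nat) (Qp : fieldType) (L : splittingFieldType Qp).
Variable v : valuation p L.
Implicit Types (c d : rat) (x y : L).

Definition ordge c x : bool := (c%:E <= v x)%E.

Lemma vord0 : v 0 = +oo%E. Proof. exact/(ord_eqy (val_ordP v)). Qed.

Lemma ord_fin x : x != 0 -> exists c, v x = c%:E.
Proof.
move=> x0; case E: (v x) => [c| |]; first by exists c.
- by move/(ord_eqy (val_ordP v)): E x0 => ->; rewrite eqxx.
- by have := ord_neNy (val_ordP v) E.
Qed.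

Lemma vord1 : v 1 = 0%E.
Proof.
have [c cE] := ord_fin (oner_neq0 L).
have := ordM (val_ordP v) 1 1; rewrite mulr1 cE -EFinD => -[] h.
by congr (_%:E); lra.
Qed.

Lemma ord_Mfin x y c d : v x = c%:E -> v y = d%:E -> v (x * y) = (c + d)%:E.
Proof. by move=> xE yE; rewrite (ordM (val_ordP v)) xE yE EFinD. Qed.

Lemma ord_neq0 x c : v x = c%:E -> x != 0.
Proof. by move=> E; apply/eqP => x0; move: E; rewrite x0 vord0. Qed.

Lemma ordN1 : v (-1) = 0%E.
Proof.
have [c cE] : exists c, v (-1) = c%:E by apply: ord_fin; rewrite oppr_eq0 oner_eq0.
have := ord_Mfin cE cE; rewrite mulrNN mulr1 vord1 => -[] h.
by rewrite cE; congr (_%:E); lra.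
Qed.

Lemma ordN x : v (- x) = v x.
Proof. by rewrite -mulN1r (ordM (val_ordP v)) ordN1 add0e. Qed.

Lemma ord_Vfin x c : v x = c%:E -> v x^-1 = (- c)%:E.
Proof.
move=> xE; have x0 := ord_neq0 xE.
have [d dE] : exists d, v x^-1 = d%:E by apply: ord_fin; rewrite invr_eq0.
have := ord_Mfin xE dE; rewrite divff // vord1 => -[] h.
by rewrite dE; congr (_%:E); lra.
Qed.

Lemma ord_Xfin x c k : v x = c%:E -> v (x ^+ k) = (k%:R * c)%:E.
Proof.
move=> xE; elim: k => [|k IH]; first by rewrite expr0 vord1 mul0r.
by rewrite exprS (ord_Mfin xE IH); congr (_%:E); rewrite -natr1; lra.
Qed.

Lemma ordge0 c : ordge c 0. Proof. by rewrite /ordge vord0 leey. Qed.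

Lemma ordge_fin c d x : v x = d%:E -> ordge c x = (c <= d).
Proof. by move=> xE; rewrite /ordge xE lee_fin. Qed.

Lemma ordge1 : ordge 0 1. Proof. by rewrite /ordge vord1. Qed.

Lemma ordgeN c x : ordge c (- x) = ordge c x.
Proof. by rewrite /ordge ordN. Qed.

Lemma ordgeD c x y : ordge c x -> ordge c y -> ordge c (x + y).
Proof.
move=> hx hy; apply: le_trans (ordD (val_ordP v) x y).
by rewrite le_min; apply/andP.
Qed.

Lemma ordgeB c x y : ordge c x -> ordge c y -> ordge c (x - y).
Proof. by move=> hx hy; apply: ordgeD => //; rewrite ordgeN. Qed.

Lemma ordgeBC c x y : ordge c (x - y) = ordge c (y - x).
Proof. by rewrite -opprB ordgeN. Qed.

Lemma ordge_trans c x y z : ordge c (x - y) -> ordge c (y - z) -> ordge c (x - z).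
Proof. by move=> h1 h2; have := ordgeD h1 h2; rewrite addrA subrK. Qed.

Lemma ordgeM c d x y : ordge c x -> ordge d y -> ordge (c + d) (x * y).
Proof.
by move=> hx hy; rewrite /ordge (ordM (val_ordP v)) EFinD; apply: leeD.
Qed.

Lemma ordgeW c d x : d <= c -> ordge c x -> ordge d x.
Proof. by move=> dc; apply: le_trans; rewrite lee_fin. Qed.

Lemma ordgeM0 c x y : ordge 0 x -> ordge c y -> ordge c (x * y).
Proof. by move=> hx hy; have := ordgeM hx hy; rewrite add0r. Qed.

Lemma ordgeX c x k : ordge c x -> ordge (k%:R * c) (x ^+ k).
Proof.
move=> hx; elim: k => [|k IH]; first by rewrite expr0 mul0r ordge1.
by rewrite exprS -natr1 mulrDl mul1r addrC; apply: ordgeM.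
Qed.

Lemma ordgeX0 x k : ordge 0 x -> ordge 0 (x ^+ k).
Proof. by move/(ordgeX k); rewrite mulr0. Qed.

Lemma ordge_sum (I : Type) (r : seq I) (P : pred I) (F : I -> L) c :
  (forall i, P i -> ordge c (F i)) -> ordge c (\sum_(i <- r | P i) F i).
Proof.
move=> h; elim/big_ind: _ => //; [exact: ordge0|exact: ordgeD].
Qed.

Lemma ordge_prod (I : Type) (r : seq I) (P : pred I) (F : I -> L) (c : I -> rat) :
  (forall i, P i -> ordge (c i) (F i)) ->
  ordge (\sum_(i <- r | P i) c i) (\prod_(i <- r | P i) F i).
Proof.
move=> h; elim/big_rec2: _ => [|i y1 y2 Pi IH]; first exact: ordge1.
by apply: ordgeM => //; apply: h.
Qed.

Lemma ordge_nat k : ordge 0 k%:R.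
Proof.
elim: k => [|k IH]; first exact: ordge0.
by rewrite -natr1 ordgeD // ordge1.
Qed.

Lemma ordge_int (z : int) : ordge 0 z%:~R.
Proof. by case: z => k; rewrite ?NegzE ?mulrNz ?ordgeN; apply: ordge_nat. Qed.

Lemma ordge_eq0 x : (forall c, ordge c x) -> x = 0.
Proof.
move=> h; apply/eqP; apply/negPn/negP => /ord_fin [c cE].
by have := h (c + 1); rewrite (ordge_fin _ cE); lra.
Qed.

Lemma ordge_natP x : (forall k : nat, ordge k%:R x) -> forall c, ordge c x.
Proof.
move=> h c; apply: ordgeW (h (Num.bound `|c|)).
apply: le_trans (ler_norm c) _; apply: ltW.
exact: archi_boundP.
Qed.

Lemma ord_eqP x y c d : v x = c%:E -> c < d -> ordge d (y - x) -> v y = c%:E.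
Proof.
move=> xE cd h.
have hy : ordge c y.
  rewrite -(subrK x y); apply: ordgeD; first by apply: ordgeW h; lra.
  by rewrite (ordge_fin _ xE).
have y0 : y != 0.
  apply/eqP => y0; move: h; rewrite y0 sub0r ordgeN (ordge_fin _ xE); lra.
have [b bE] := ord_fin y0; move: hy; rewrite (ordge_fin _ bE) => cb.
rewrite bE; congr (_%:E); apply/eqP; rewrite eq_le cb andbT leNgt; apply/negP => lt.
have : ordge (Num.min b d) x.
  rewrite -(subKr y x); apply: ordgeB; last by apply: ordgeW h; rewrite ge_min lexx orbT.
  by rewrite (ordge_fin _ bE) ge_min lexx.
by rewrite (ordge_fin _ xE) ge_min; lra.
Qed.

Lemma ordge_divfin c d x y : v y = d%:E -> ordge (c + d) x -> ordge c (x / y).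
Proof.
move=> /ord_Vfin yE h; have := ordgeM h (_ : ordge (- d) y^-1).
by rewrite addrK; apply; rewrite (ordge_fin _ yE).
Qed.

Lemma ordge_mulfin c d x y : v y = d%:E -> ordge (c + d) (x * y) = ordge c x.
Proof.
move=> yE; apply/idP/idP => [h|h].
  by have := ordge_divfin yE h; rewrite mulfK // (ord_neq0 yE).
by apply: ordgeM => //; rewrite (ordge_fin _ yE).
Qed.

Lemma ordge_congM c x x' y y' : ordge 0 x -> ordge 0 y' ->
  ordge c (x - x') -> ordge c (y - y') -> ordge c (x * y - x' * y').
Proof.
move=> hx hy' h1 h2.
rewrite (_ : _ - _ = x * (y - y') + y' * (x - x')); last by ring.
by apply: ordgeD; apply: ordgeM0.
Qed.

Lemma ordge_congX c x y k : ordge 0 x -> ordge 0 y -> ordge c (x - y) ->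
  ordge c (x ^+ k - y ^+ k).
Proof.
move=> hx hy h; elim: k => [|k IH]; first by rewrite subrr ordge0.
by rewrite !exprS; apply: ordge_congM => //; apply: ordgeX0.
Qed.

Lemma ordge_cong0 c x y : 0 <= c -> ordge c (x - y) -> ordge 0 y -> ordge 0 x.
Proof.
by move=> c0 h hy; rewrite -(subrK y x) ordgeD //; apply: ordgeW h.
Qed.

Lemma ord_p_gt1 : (1 < p)%N.
Proof.
have ep := ord_p (val_ordP v).
rewrite ltnNge leq_eqVlt ltnS leqn0; apply/negP => /orP[] /eqP pE.
  have p1 : p%:R = 1 :> L by rewrite pE.
  by move: ep; rewrite p1 vord1 => -[].
have p0 : p%:R = 0 :> L by rewrite pE.
by move: ep; rewrite p0 vord0.
Qed.

Lemma ord_nat_coprime k : coprime p k -> v k%:R = 0%E.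
Proof.
move=> cpk; have [k0 | k0] := posnP k.
  by move: cpk; rewrite k0 /coprime gcdn0 => /eqP p1; exfalso; have := ord_p_gt1; lia.
have [a [b E]] : exists a b, (b * k = a * p + 1)%N.
  case: (egcdnP p k0) => km kn E _; exists kn, km.
  by rewrite E; move: cpk; rewrite coprime_sym => /eqP ->.
have hk := ordge_nat k.
have E' : b%:R * k%:R - 1 = a%:R * p%:R :> L by rewrite -!natrM E natrD addrK.
have hb : v (b%:R * k%:R) = 0%:E.
  apply: (@ord_eqP 1 _ _ 1); [exact: vord1|by []|].
  rewrite E'; apply: ordgeM0; first exact: ordge_nat.
  by rewrite /ordge (ord_p (val_ordP v)).
have k0' : k%:R != 0 :> L by apply/eqP => e; move: hb; rewrite e mulr0 vord0.
have b0' : b%:R != 0 :> L by apply/eqP => e; move: hb; rewrite e mul0r vord0.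
have [c cE] := ord_fin k0'; have [d dE] := ord_fin b0'.
have := ordge_nat b; rewrite (ordge_fin _ dE) => d0.
move: hk; rewrite (ordge_fin _ cE) => c0.
have := ord_Mfin dE cE; rewrite hb => -[] h.
by rewrite cE; congr (_%:E); lra.
Qed.

Lemma ord_natp k : v (p ^ k)%N%:R = k%:R%:E.
Proof. by rewrite natrX (ord_Xfin k (ord_p (val_ordP v))) mulr1. Qed.

End Valuation.

(** * Integrality of the Artin-Hasse series *)

Section TruncatedSeries.
Implicit Types (K k : nat) (f g s : {poly rat}).

(** Congruence modulo X^(K+1): power series are handled through polynomial truncations. *)
Definition eqm K f g := forall k, (k <= K)%N -> f`_k = g`_k.

Lemma eqmD K f f' g g' : eqm K f f' -> eqm K g g' -> eqm K (f + g) (f' + g').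
Proof. by move=> h1 h2 k kK; rewrite !coefD h1 // h2. Qed.

Lemma eqmM K f f' g g' : eqm K f f' -> eqm K g g' -> eqm K (f * g) (f' * g').
Proof.
move=> h1 h2 k kK; rewrite !coefM; apply: eq_bigr => i _.
by rewrite h1 ?h2 // ?(leq_trans (leq_subr _ _) kK) // (leq_trans _ kK) // -ltnS.
Qed.

Lemma eqmX K f f' m : eqm K f f' -> eqm K (f ^+ m) (f' ^+ m).
Proof.
move=> h; elim: m => [|m IH]; first by rewrite !expr0.
by rewrite !exprS; apply: eqmM.
Qed.

(** X d/dX rather than d/dX: it preserves degrees, so congruences modulo X^(K+1) lose no
    precision. *)
Definition euler f := 'X * f^`().

Lemma coef_euler f k : (euler f)`_k = k%:R * f`_k.
Proof.
rewrite /euler coefXM coef_deriv; case: k => [|k] /=; first by rewrite mul0r.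
by rewrite mulr_natl.
Qed.

Lemma eulerM f g : euler (f * g) = euler f * g + f * euler g.
Proof. by rewrite /euler derivM; ring. Qed.

Lemma eulerX f m : euler (f ^+ m) = m%:R * (f ^+ m.-1 * euler f).
Proof. by rewrite /euler deriv_exp -mulr_natl; ring. Qed.

Lemma eulerZ c f : euler (c *: f) = c *: euler f.
Proof. by rewrite /euler derivZ scalerAr. Qed.

Lemma euler_sum (I : Type) (r : seq I) (F : I -> {poly rat}) :
  euler (\sum_(i <- r) F i) = \sum_(i <- r) euler (F i).
Proof. by rewrite /euler (raddf_sum (@deriv _)) mulr_sumr. Qed.

Lemma euler_Xn m : euler 'X^m = m%:R * 'X^m.
Proof.
rewrite /euler derivXn -mulr_natl; case: m => [|m]; first by rewrite !mul0r mulr0.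
by rewrite exprS /=; ring.
Qed.

Lemma euler_comp_Xn m f : euler (f \Po 'X^m) = m%:R * (euler f \Po 'X^m).
Proof.
apply/polyP => k; rewrite coef_euler.
have [->|m0] := posnP m.
  rewrite mul0r coef0 expr0 -polyC1 comp_polyCr coefC.
  by case: k => [|k]; rewrite ?mul0r ?mulr0.
rewrite [m%:R * (_ \Po _)]mulr_natl coefMn coef_comp_poly_Xn // coef_comp_poly_Xn // coef_euler.
case: ifP => [/dvdnP[q ->]|_]; last by rewrite mulr0 mul0rn.
by rewrite mulnK // -mulr_natl natrM; ring.
Qed.

Lemma eqm_comp_Xn K m f g : (0 < m)%N -> eqm K f g -> eqm K (f \Po 'X^m) (g \Po 'X^m).
Proof.
move=> m0 h k kK; rewrite !coef_comp_poly_Xn //; case: ifP => // _.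
by apply: h; apply: leq_trans (leq_div _ _) kK.
Qed.

(** As s has no constant term, the equation expresses k f_k through the coefficients of f below k,
    and k is invertible in the rationals. *)
Lemma ode_uniq K f g s : s`_0 = 0 -> f`_0 = g`_0 ->
  eqm K (euler f) (f * s) -> eqm K (euler g) (g * s) -> eqm K f g.
Proof.
move=> s0 fg0 hf hg k; elim/ltn_ind: k => -[|k] IH kK; first exact: fg0.
have k0 : k.+1%:R != 0 :> rat by rewrite pnatr_eq0.
apply: (mulfI k0); rewrite -!coef_euler hf // hg // !coefM [LHS]big_ord_recr [RHS]big_ord_recr /= subnn s0.
rewrite !mulr0; congr (_ + _); apply: eq_bigr => i _.
by rewrite IH // (leq_trans _ kK) // ltnW.
Qed.

Lemma coef_lowX f m k : f`_0 = 0 -> (k < m)%N -> (f ^+ m)`_k = 0.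
Proof.
move=> f0; elim: m k => // m IH k km; rewrite exprS coefM big1 // => i _.
case: i => [[|i] /= iP]; first by rewrite f0 mul0r.
by rewrite IH ?mulr0 //; lia.
Qed.

End TruncatedSeries.

Section ArtinHasse.
Variables (p : nat).
Hypothesis p_prime : prime p.
Implicit Types (K k : nat).

Let p1 : (1 < p)%N. Proof. exact: prime_gt1. Qed.

Let pR0 j : (p ^ j)%N%:R != 0 :> rat.
Proof. by rewrite pnatr_eq0 expn_eq0 negb_and -lt0n prime_gt0. Qed.

Definition AHlog K : {poly rat} := \sum_(j < K.+1) ((p ^ j)%N%:R)^-1 *: 'X^(p ^ j).
Definition AHser K : {poly rat} := \sum_(m < K.+1) (m`!%:R)^-1 *: AHlog K ^+ m.
(** The logarithmic derivative of the Artin-Hasse series: the Euler operator cancels the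
    denominators p^j. *)
Definition AHdlog K : {poly rat} := \sum_(j < K.+1) 'X^(p ^ j).

Lemma coef0_Xpow (j : nat) : ('X^(p ^ j) : {poly rat})`_0 = 0.
Proof. by rewrite coefXn eq_sym expn_eq0; case: p p_prime => [|[]]. Qed.

Lemma AHlog0 K : (AHlog K)`_0 = 0.
Proof. by rewrite coef_sum big1 // => j _; rewrite coefZ coef0_Xpow mulr0. Qed.

Lemma AHdlog0 K : (AHdlog K)`_0 = 0.
Proof. by rewrite coef_sum big1 // => j _; rewrite coef0_Xpow. Qed.

Lemma euler_AHlog K : euler (AHlog K) = AHdlog K.
Proof.
rewrite euler_sum; apply: eq_bigr => j _.
rewrite eulerZ euler_Xn -[_%:R]/(1 *+ _) mulr_natl -scaler_nat scalerA mulVf ?scale1r //.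
Qed.

Lemma AHser0 K : (AHser K)`_0 = 1.
Proof.
rewrite coef_sum big_ord_recl /= coefZ expr0 coef1 invr1 mulr1 big1 ?addr0 // => i _.
by rewrite coefZ coef_lowX ?mulr0 // AHlog0.
Qed.

Lemma euler_AHser K : eqm K (euler (AHser K)) (AHser K * AHdlog K).
Proof.
(* Truncating the exponential leaves one boundary term, which vanishes to order greater than K. *)
have -> : euler (AHser K) =
    AHser K * AHdlog K - K`!%:R^-1 *: (AHlog K ^+ K * AHdlog K).
  rewrite euler_sum [X in _ = X * _ - _]/AHser big_ord_recl eulerZ eulerX mul0r scaler0 add0r.
  rewrite big_ord_recr /= mulrDl scalerAl addrK mulr_suml; apply: eq_bigr => m _.
  rewrite eulerZ eulerX euler_AHlog /= /bump /= add1n factS -scalerAl.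
  rewrite mulr_natl -scaler_nat scalerA natrM invfM mulrAC mulVf ?mul1r //.
  by rewrite pnatr_eq0.
move=> k kK; rewrite coefB coefZ [X in _ - _ * X]coefM [X in _ - _ * X]big1 ?mulr0 ?subr0 // => i _.
rewrite -euler_AHlog coef_euler; case: (ltnP i K) => iK.
  by rewrite coef_lowX ?mul0r ?AHlog0.
have -> : (k - i = 0)%N by move: (ltn_ord i); lia.
by rewrite mul0r mulr0.
Qed.

Lemma AHdlog_stable K K' : (K <= K')%N -> eqm K (AHdlog K) (AHdlog K').
Proof.
move=> KK' k kK; rewrite !coef_sum -(big_mkord xpredT (fun j => ('X^(p ^ j))`_k)).
rewrite -(big_mkord xpredT (fun j => ('X^(p ^ j))`_k)).
rewrite [RHS](@big_cat_nat _ _ _ K.+1) //= [X in _ = _ + X]big_nat_cond [X in _ = _ + X]big1 ?addr0 //.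
move=> j /andP[/andP[Kj _] _]; rewrite coefXn.
have := ltn_expl j p1; case: (k =P (p ^ j)%N) => // <-; lia.
Qed.

(** Truncations at different levels solve the same differential equation modulo X^(k+1), so they
    agree there. *)
Lemma AH_coefE k K : (k <= K)%N -> AH_coef p k = (AHser K)`_k.
Proof.
move=> kK; apply: (@ode_uniq k (AHser k) (AHser K) (AHdlog k)) => //.
- exact: AHdlog0.
- by rewrite !AHser0.
- exact: euler_AHser.
- move=> i ik; rewrite euler_AHser ?(leq_trans ik) //.
  rewrite !coefM; apply: eq_bigr => j _; rewrite -(AHdlog_stable kK) //.
  by rewrite (leq_trans (leq_subr _ _) ik).
Qed.

(** Below degree p the logarithmic derivative is just X, so the series coincides with exp. *)
Lemma AH_coef_small k : (k < p)%N -> AH_coef p k = (k`!%:R)^-1.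
Proof.
elim: k => [|k IH] kp; first by rewrite (AH_coefE (leq0n 0)) AHser0 fact0 invr1.
have k0 : k.+1%:R != 0 :> rat by rewrite pnatr_eq0.
apply: (mulfI k0); rewrite (AH_coefE (leqnn _)) -coef_euler euler_AHser //.
rewrite factS natrM invfM mulrA divff // mul1r -IH 1?ltnW //.
rewrite (AH_coefE (leqnSn _)) coefM big_ord_recr /= subnn AHdlog0 mulr0 addr0.
have dl1 : (AHdlog k.+1)`_1 = 1.
  rewrite coef_sum big_ord_recl expn0 coefX /= big1 ?addr0 // => i _; rewrite coefXn.
  have : (1 < p ^ lift ord0 i)%N by rewrite -(exp1n (lift ord0 i)) ltn_exp2r.
  by case: eqP => // <-.
rewrite big_ord_recr /= subSnn dl1 mulr1 big1 ?add0r // => i _.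
rewrite [X in _ * X]coef_sum [X in _ * X]big1 ?mulr0 // => j _; rewrite coefXn.
case: eqP => // e; exfalso; have := ltn_ord i.
case: (nat_of_ord j) e => [|j'] e; first by rewrite expn0 in e; lia.
have : (p <= p ^ j'.+1)%N by rewrite -{1}(expn1 p) leq_exp2l.
lia.
Qed.

(** The localization of the integers at p; [pdiv_int] is the ideal generated by p in it. *)
Definition pint (r : rat) := exists2 m : nat, coprime p m & exists z : int, r * m%:R = z%:~R.
Definition pdiv_int (r : rat) := exists2 s, pint s & r = p%:R * s.

Lemma pint_nz (m : nat) : coprime p m -> m%:R != 0 :> rat.
Proof.
rewrite pnatr_eq0; case: m => //; rewrite /coprime gcdn0 => /eqP pE; lia.
Qed.

Lemma pint_int z : pint z%:~R.
Proof. by exists 1%N; [exact: coprimen1|exists z; rewrite mulr1]. Qed.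

Lemma pint_nat k : pint k%:R. Proof. exact: (pint_int k%:Z). Qed.

Lemma pintD r s : pint r -> pint s -> pint (r + s).
Proof.
move=> [m cm [z hz]] [l cl [y hy]]; exists (m * l)%N; first by rewrite coprimeMr cm.
exists (z * l%:Z + y * m%:Z); rewrite natrM mulrzDr !intrM -hz -hy /=.
by rewrite -!pmulrn; ring.
Qed.

Lemma pintM r s : pint r -> pint s -> pint (r * s).
Proof.
move=> [m cm [z hz]] [l cl [y hy]]; exists (m * l)%N; first by rewrite coprimeMr cm.
by exists (z * y); rewrite natrM intrM -hz -hy; ring.
Qed.

Lemma pintN r : pint r -> pint (- r).
Proof. by move=> h; rewrite -mulN1r; apply: pintM => //; apply: (pint_int (-1)). Qed.

Lemma pintX r k : pint r -> pint (r ^+ k).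
Proof.
by move=> h; elim: k => [|k IH]; [exact: (pint_nat 1)|rewrite exprS; apply: pintM].
Qed.

Lemma pintV m : coprime p m -> pint m%:R^-1.
Proof. by move=> cm; exists m => //; exists 1; rewrite mulVf // pint_nz. Qed.

Lemma pint_sum (I : Type) (r : seq I) (F : I -> rat) :
  (forall i, pint (F i)) -> pint (\sum_(i <- r) F i).
Proof. by move=> h; elim/big_ind: _ => //; [exact: (pint_nat 0)|exact: pintD]. Qed.

Lemma pdiv_int0 : pdiv_int 0.
Proof. by exists 0; [exact: (pint_nat 0)|rewrite mulr0]. Qed.

Lemma pdiv_intD r s : pdiv_int r -> pdiv_int s -> pdiv_int (r + s).
Proof.
by move=> [x hx ->] [y hy ->]; exists (x + y); [exact: pintD|rewrite mulrDr].
Qed.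

Lemma pdiv_intN r : pdiv_int r -> pdiv_int (- r).
Proof. by move=> [x hx ->]; exists (- x); [exact: pintN|rewrite mulrN]. Qed.

Lemma pdiv_intM r s : pint r -> pdiv_int s -> pdiv_int (r * s).
Proof. by move=> h [y hy ->]; exists (r * y); [exact: pintM|rewrite mulrCA]. Qed.

Lemma pdiv_int_sum (I : Type) (r : seq I) (P : pred I) (F : I -> rat) :
  (forall i, P i -> pdiv_int (F i)) -> pdiv_int (\sum_(i <- r | P i) F i).
Proof. by move=> h; elim/big_ind: _ => //; [exact: pdiv_int0|exact: pdiv_intD]. Qed.

Lemma pdiv_int_pint r : pdiv_int (p%:R * r) -> pint r.
Proof.
move=> [s hs /mulfI -> //]; by rewrite pnatr_eq0 -lt0n prime_gt0.
Qed.

Lemma frobD (R : comNzRingType) (x y : R) : (x + y) ^+ p =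
  x ^+ p + y ^+ p + p%:R * \sum_(1 <= i < p) x ^+ (p - i) * y ^+ i *+ ('C(p, i) %/ p).
Proof.
rewrite exprDn big_ord_recr /= binn mulr1n subnn expr0 mul1r.
rewrite -(big_mkord xpredT (fun i => x ^+ (p - i) * y ^+ i *+ 'C(p, i))).
rewrite big_ltn ?prime_gt0 // bin0 mulr1n subn0 expr0 mulr1 -addrA [X in _ + X = _]addrC.
rewrite addrA; congr (_ + _); rewrite mulr_sumr !big_nat; apply: eq_bigr => i /andP[i0 ip].
by rewrite mulr_natl -mulrnA divnK // prime_dvd_bin // i0.
Qed.

Lemma fermat_nat k : pdiv_int (k%:R ^+ p - k%:R).
Proof.
elim: k => [|k IH]; first by rewrite expr0n gtn_eqF ?prime_gt0 //= subrr; exact: pdiv_int0.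
rewrite -natr1 frobD expr1n; set t := \sum_(1 <= i < p) _.
rewrite (_ : _ - _ = (k%:R ^+ p - k%:R) + p%:R * t); last by ring.
apply: pdiv_intD => //; eexists; last by [].
apply: pint_sum => i; rewrite expr1n mulr1 -mulr_natr -natrX -natrM; exact: pint_nat.
Qed.

Lemma fermat_int (z : int) : pdiv_int (z%:~R ^+ p - z%:~R).
Proof.
case: z => k; first exact: fermat_nat.
have := fermat_nat k.+1; rewrite NegzE mulrNz -pmulrn; set x := k.+1%:R => h.
(* The sign survives the p-th power only for odd p. For p = 2 the discrepancy 2 x is itself
   divisible by p. *)
have [p2|podd] := even_prime p_prime.
  rewrite p2 sqrrN opprK; rewrite p2 in h.
  rewrite (_ : _ + _ = (x ^+ 2 - x) + p%:R * x); last by rewrite p2; ring.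
  apply: pdiv_intD => //.
  by exists x => //; apply: pint_nat.
rewrite exprNn -signr_odd podd expr1 (_ : _ - _ = - (x ^+ p - x)); last by ring.
exact: pdiv_intN.
Qed.

Lemma pint_fermat r : pint r -> pdiv_int (r ^+ p - r).
Proof.
move=> hr; have [m cm [z hz]] := hr.
have m0 := pint_nz cm.
rewrite (_ : _ - _ = (z%:~R ^+ p - z%:~R - r * (m%:R ^+ p - m%:R)) / m%:R ^+ p); last first.
  apply: (@mulIf _ (m%:R ^+ p)); first by rewrite expf_neq0.
  by rewrite divfK ?expf_neq0 // mulrBl -exprMn hz; ring: hz.
rewrite mulrC; apply: pdiv_intM; first by rewrite -natrX; apply: pintV; rewrite coprimeXr.
apply: pdiv_intD; first exact: fermat_int.
by apply: pdiv_intN; apply: pdiv_intM => //; apply: fermat_nat.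
Qed.

Definition polyint (f : {poly rat}) := forall k, pint f`_k.
Definition polydiv_int (f : {poly rat}) := forall k, pdiv_int f`_k.

Lemma polyintM f g : polyint f -> polyint g -> polyint (f * g).
Proof. by move=> hf hg k; rewrite coefM; apply: pint_sum => i; apply: pintM. Qed.

Lemma polyintX f m : polyint f -> polyint (f ^+ m).
Proof.
move=> h; elim: m => [|m IH]; last by rewrite exprS; apply: polyintM.
by move=> k; rewrite expr0 coef1; apply: pint_nat.
Qed.

Lemma polydiv_intD f g : polydiv_int f -> polydiv_int g -> polydiv_int (f + g).
Proof. by move=> hf hg k; rewrite coefD; apply: pdiv_intD. Qed.

Lemma polyfrob (I : Type) (r : seq I) (F : I -> {poly rat}) :
  (forall i, polyint (F i)) ->
  polydiv_int ((\sum_(i <- r) F i) ^+ p - \sum_(i <- r) F i ^+ p).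
Proof.
move=> hF; elim: r => [|i r IH].
  by rewrite !big_nil expr0n gtn_eqF ?prime_gt0 //= subrr => k; rewrite coef0; exact: pdiv_int0.
rewrite !big_cons frobD; set g := \sum_(j <- r) F j; set h := \sum_(1 <= j < p) _.
rewrite (_ : _ - _ = (g ^+ p - \sum_(j <- r) F j ^+ p) + p%:R * h); last by ring.
apply: polydiv_intD => // k; rewrite mulr_natl coefMn -mulr_natl; eexists; last by [].
rewrite coef_sum; apply: pint_sum => j; rewrite coefMn -mulr_natr.
apply: pintM; last exact: pint_nat.
have hg : polyint g.
  by move=> l; rewrite coef_sum; apply: pint_sum => j'; apply: hF.
by apply: polyintM; apply: polyintX.
Qed.

(** Legendre's formula. The sum is bounded by an invariant: its first m terms plus max(1, floor(k /
    p^m)) never exceed k, because y = floor(k / p^m) satisfies 2 floor(y / p) <= y. *)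
Lemma logn_fact_lt k : (0 < k)%N -> (logn p k`! < k)%N.
Proof.
move=> k0; rewrite logn_fact //.
suff h m : (\sum_(1 <= i < m.+1) k %/ p ^ i + maxn 1 (k %/ p ^ m) <= k)%N.
  by have := h k; lia.
elim: m => [|m IH]; first by rewrite big_geq // expn0 divn1; lia.
rewrite big_nat_recr //= expnSr divnMA; set y := (k %/ p ^ m)%N in IH *.
have : (y %/ p * p <= y)%N by apply: leq_trunc_div.
have : (y %/ p * 2 <= y %/ p * p)%N by rewrite leq_mul2l p1 orbT.
by lia.
Qed.

Definition expp K : {poly rat} := \poly_(k < K.+1) (p%:R ^+ k / k`!%:R).

(** The order of k! at p is at most k - 1, so p^k / k! keeps a factor p. *)
Lemma coef_expp K k : (0 < k)%N -> pdiv_int (expp K)`_k.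
Proof.
move=> k0; rewrite coef_poly; case: ifP => _; last exact: pdiv_int0.
have lt := logn_fact_lt k0; have f0 := fact_gt0 k.
have E := partnC p f0; rewrite p_part in E.
have c : coprime p (k`!)`_p^' by rewrite prime_coprime // -p'natE // part_pnat.
exists (p%:R ^+ (k.-1 - logn p k`!) * (k`!`_p^')%N%:R^-1).
  by apply: pintM; [apply/pintX/pint_nat|apply: pintV].
have pn0 : p%:R != 0 :> rat by rewrite pnatr_eq0 -lt0n prime_gt0.
have -> : k`!%:R = p%:R ^+ logn p k`! * (k`!`_p^')%N%:R :> rat by rewrite -natrX -natrM E.
have -> : p%:R ^+ k = p%:R ^+ logn p k`! * (p%:R * p%:R ^+ (k.-1 - logn p k`!)) :> rat.
  by rewrite -exprS -exprD; congr (_ ^+ _); lia.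
by rewrite invfM mulrACA divff ?mul1r ?mulrA // expf_neq0.
Qed.

Lemma euler_expp K : eqm K (euler (expp K)) (p%:R *: 'X * expp K).
Proof.
move=> k kK; rewrite coef_euler -scalerAl coefZ coefXM !coef_poly ltnS kK.
case: k kK => [|k] kK /=; first by rewrite mul0r mulr0.
rewrite ltnS (ltnW kK) factS natrM exprS invfM.
have k0 : k.+1%:R != 0 :> rat by rewrite pnatr_eq0.
rewrite [LHS](_ : _ = k.+1%:R / k.+1%:R * (p%:R * (p%:R ^+ k / k`!%:R))); last by ring.
by rewrite divff // mul1r.
Qed.

(* AH(X)^p = AH(X^p) exp(p X): both sides solve X y' = p (X + X^p + ...) y, y(0) = 1. *)
Lemma AHser_frob K : eqm K (AHser K ^+ p) ((AHser K \Po 'X^p) * expp K).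
Proof.
have p0 := prime_gt0 p_prime.
apply: (@ode_uniq K _ _ (p%:R *: AHdlog K)).
- by rewrite coefZ AHdlog0 mulr0.
- rewrite coef0M coef_comp_poly_Xn // dvdn0 div0n AHser0 coef_poly /= expr0 fact0 divr1 ?mulr1.
  by rewrite -horner_coef0 horner_exp horner_coef0 AHser0 expr1n.
- move=> k kK; rewrite eulerX -scalerAr mulr_natl -scaler_nat !coefZ; congr (_ * _).
  rewrite (eqmM (fun _ _ => erefl) (@euler_AHser K)) // mulrA -exprSr prednK //.
- have hc : eqm K (euler (AHser K \Po 'X^p)) (p%:R *: ((AHser K * AHdlog K) \Po 'X^p)).
    move=> k kK; rewrite euler_comp_Xn mulr_natl -scaler_nat !coefZ.
    by rewrite (eqm_comp_Xn p0 (@euler_AHser K)).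
  move=> k kK; rewrite eulerM.
  rewrite (eqmD (eqmM hc (fun _ _ => erefl)) (eqmM (fun _ _ => erefl) (@euler_expp K))) //.
  have hS : eqm K (AHdlog K) ('X + (AHdlog K \Po 'X^p)).
    move=> i iK; rewrite (AHdlog_stable (leqnSn K)) // /AHdlog big_ord_recl expn0 expr1.
    suff <- : \sum_(i0 < K.+1) 'X^(p ^ lift ord0 i0) = AHdlog K \Po 'X^p by [].
    rewrite raddf_sum /=; apply: eq_bigr => j _.
    by rewrite comp_Xn_poly -exprM expnS.
  have hS' : eqm K (p%:R *: AHdlog K) (p%:R *: ('X + (AHdlog K \Po 'X^p))).
    by move=> i iK; rewrite !coefZ hS.
  rewrite (eqmM (fun _ _ => erefl) hS') // comp_polyM; congr (nth _ (polyseq _) k).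
  by rewrite -!mul_polyC; ring.
Qed.

(** Modulo X^(k+1) the perturbation c X^k squares to 0 and is multiplied only by the constant term 1
    of f, so the m-th power changes to first order. *)
Lemma coefX_top (f : {poly rat}) c k m : (0 < k)%N -> f`_0 = 1 ->
  eqm k ((f + c *: 'X^k) ^+ m) (f ^+ m + (m%:R * c) *: 'X^k).
Proof.
move=> k0 f0; elim: m => [|m IH].
  by move=> i ik; rewrite !expr0 mul0r scale0r addr0.
move=> i ik; rewrite !exprS (eqmM (fun _ _ => erefl) IH) //.
have fX d : eqm k (f * (d *: 'X^k)) (d *: 'X^k).
  move=> j jk; rewrite -scalerAr !coefZ coefMXn coefXn; case: ltnP => kj.
    by rewrite ltn_eqF.
  by rewrite (_ : j = k) ?subnn ?eqxx ?f0 //; lia.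
have fX' d : eqm k (f ^+ m * (d *: 'X^k)) (d *: 'X^k).
  elim: m {IH} => [|m IH] j jk; first by rewrite expr0 mul1r.
  by rewrite exprS -mulrA (eqmM (fun _ _ => erefl) IH) // fX.
rewrite mulrDl !mulrDr -natr1.
rewrite !coefD fX // [(_ *: 'X^k) * f ^+ m]mulrC fX' //.
have -> : (c *: 'X^k * ((m%:R * c) *: 'X^k))`_i = 0.
  rewrite -scalerAr -scalerAl !coefZ -exprD coefXn.
  have -> : (i == k + k)%N = false by apply/eqP; lia.
  by rewrite !mulr0.
by rewrite addr0 -!addrA; congr (_ + _); rewrite !coefZ; ring.
Qed.

(** Dwork's argument, by induction on k. In degree k of AH(X)^p = AH(X^p) exp(p X), the left side is
    p a_k plus a coefficient of the p-th power of an integral polynomial, which is a_(k/p)^p or 0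
    modulo p; the right side is a_(k/p) or 0 modulo p. Fermat's congruence identifies the two, so p
    a_k is divisible by p. *)
Lemma AH_coef_pint k : pint (AH_coef p k).
Proof.
elim/ltn_ind: k => k IH; have [->|k0] := posnP k.
  by rewrite AH_coef_small ?prime_gt0 // fact0 invr1; apply: (pint_nat 1).
have p0 := prime_gt0 p_prime.
apply: pdiv_int_pint.
pose f := \poly_(i < k) AH_coef p i.
have hE : eqm k (AHser k) (f + AH_coef p k *: 'X^k).
  move=> i ik; rewrite -(AH_coefE ik) coefD coefZ coef_poly coefXn.
  case: ltngtP ik => // [ik|->] _; last by rewrite mulr1 add0r.
  by rewrite mulr0 addr0.
have hf : polyint f.
  by move=> i; rewrite coef_poly; case: ifP => ik; [exact: IH|exact: (pint_nat 0)].
have f0 : f`_0 = 1 by rewrite coef_poly k0 AH_coef_small ?fact0 ?invr1.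
have h1 := AHser_frob (leqnn k).
rewrite (eqmX _ hE) // coefX_top // coefD coefZ coefXn eqxx mulr1 in h1.
have h2 : pdiv_int ((f ^+ p)`_k - if (p %| k)%N then AH_coef p (k %/ p) ^+ p else 0).
  have h : pdiv_int ((f ^+ p)`_k - (\sum_(i < k) (AH_coef p i *: 'X^i) ^+ p)`_k).
    rewrite -coefB /f poly_def; apply: polyfrob => i j.
    by rewrite coefZ; apply: pintM; [apply: IH|rewrite coefXn; apply: pint_nat].
  congr (pdiv_int (_ - _)): h.
  rewrite coef_sum; case: ifP => [/dvdnP[q kE]|pk].
    have qk : (q < k)%N by rewrite kE in k0 *; nia.
    rewrite kE mulnK // -kE (bigD1 (Ordinal qk)) //= exprZn -exprM coefZ -kE coefXn eqxx mulr1.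
    rewrite big1 ?addr0 // => i iq; rewrite exprZn -exprM coefZ coefXn.
    case: (k =P (i * p)%N) => [e|_]; last by rewrite mulr0.
    have iq' : (i : nat) = q by apply/eqP; rewrite -(eqn_pmul2r p0) -e kE.
    by case/eqP: iq; apply: val_inj.
  rewrite big1 // => i _; rewrite exprZn -exprM coefZ coefXn.
  by case: eqP => [e|]; [rewrite e dvdn_mull in pk|rewrite mulr0].
have h3 : pdiv_int (((AHser k \Po 'X^p) * expp k)`_k - if (p %| k)%N then AH_coef p (k %/ p) else 0).
  rewrite coefM big_ord_recr /= subnn coef_comp_poly_Xn //.
  have e0 : (expp k)`_0 = 1 by rewrite coef_poly ltn0Sn expr0 fact0 divr1.
  rewrite -(AH_coefE (leq_div k p)) e0 mulr1 addrK.
  apply: pdiv_int_sum => i _; apply: pdiv_intM; last by apply: coef_expp; rewrite subn_gt0.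
  rewrite coef_comp_poly_Xn //; case: ifP => _; last exact: (pint_nat 0).
  have ik : (i %/ p < k)%N by apply: leq_ltn_trans (leq_div _ _) _.
  by rewrite -AH_coefE ?(ltnW ik) //; apply: IH.
have h4 : pdiv_int ((if (p %| k)%N then AH_coef p (k %/ p) ^+ p else 0) -
                    (if (p %| k)%N then AH_coef p (k %/ p) else 0)).
  case: ifP => _; last by rewrite subrr; exact: pdiv_int0.
  by apply: pint_fermat; apply: IH; apply: ltn_Pdiv.
rewrite -h1 in h3.
have := pdiv_intD h3 (pdiv_intN (pdiv_intD h2 h4)).
congr pdiv_int; by ring.
Qed.

End ArtinHasse.

(** * The ring of integers and the Frobenius *)

Section PadicInteger.
Variables (p : nat) (Qp : fieldType) (L : splittingFieldType Qp).
Variable v : valuation p L.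
Hypothesis p_prime : prime p.
Implicit Types (c d : rat) (x y : L).

Lemma ord_nat k : (0 < k)%N -> v k%:R = (logn p k)%:R%:E.
Proof.
move=> k0; rewrite -{1}(partnC p k0) p_part natrM.
have c : coprime p (k`_p^')%N by rewrite prime_coprime // -p'natE // part_pnat.
by rewrite (ord_Mfin (ord_natp v _) (ord_nat_coprime v c)) addr0.
Qed.

Lemma natr_eq0L k : (k%:R == 0 :> L) = (k == 0%N).
Proof.
have [->|k0] := posnP k; first by rewrite eqxx.
by rewrite (negbTE (ord_neq0 (ord_nat k0))).
Qed.

Lemma intr_eq0L (z : int) : (z%:~R == 0 :> L) = (z == 0).
Proof.
case: z => k; first by rewrite -pmulrn natr_eq0L.
by rewrite NegzE mulrNz oppr_eq0 -pmulrn natr_eq0L oppr_eq0.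
Qed.

Lemma ord_int (z : int) : z != 0 -> exists k : nat, v z%:~R = k%:R%:E.
Proof.
case: z => k z0; first by exists (logn p k); rewrite ord_nat // lt0n.
by exists (logn p k.+1); rewrite NegzE mulrNz ordN ord_nat.
Qed.

Lemma ord_ratr r : r != 0 -> exists z : int, v (ratr r) = z%:~R%:E.
Proof.
move=> r0; have [a aE] := @ord_int (numq r) ltac:(by rewrite numq_eq0).
have [b bE] := @ord_int (denq r) ltac:(by rewrite denq_neq0).
exists (a%:Z - b%:Z); rewrite /ratr (ord_Mfin aE (ord_Vfin bE)).
by rewrite intrB.
Qed.

Lemma ratr_mulE r (m : nat) (z : int) : r * m%:R = z%:~R ->
  ratr r * m%:R = z%:~R :> L.
Proof.
move=> h; have d0 : (denq r)%:~R != 0 :> L by rewrite intr_eq0L denq_neq0.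
apply: (mulIf d0); rewrite /ratr mulrAC divfK // -!intrM pmulrn -intrM.
congr (_%:~R); apply: (@intr_inj rat); rewrite !intrM numqE -h -pmulrn; ring.
Qed.

Lemma ordge_ratr r : pint p r -> ordge v 0 (ratr r).
Proof.
move=> [m cm [z /ratr_mulE h]].
have mE := ord_nat_coprime v cm.
by rewrite -(ordge_mulfin _ _ mE) addr0 h ordge_int.
Qed.

Lemma ratr_alg r : (ratr r : Qp)%:A = ratr r :> L.
Proof. by rewrite /ratr -in_algE fmorph_div !rmorph_int. Qed.

Hypothesis QpP : is_Qp v.

(** A rational closer to x than the size of x has the same order as x, and rationals have integral
    order. *)
Lemma ord_Qp (x : Qp) : x != 0 -> exists z : int, v (x%:A : L) = z%:~R%:E.
Proof.
move=> x0; have xA0 : (x%:A : L) != 0 by rewrite -in_algE fmorph_eq0.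
have [c cE] := ord_fin v xA0.
have [r hr] := Qp_dense QpP x (Num.bound `|c|).+1.
have lt : c < (Num.bound `|c|).+1%:R.
  rewrite -natr1; have := archi_boundP (normr_ge0 c); have := ler_norm c; lra.
have rE : v (ratr r : L) = c%:E.
  apply: (ord_eqP cE lt); rewrite ordgeBC -ratr_alg -scalerBl; exact: hr.
have r0 : r != 0.
  by apply/eqP => r0; move: rE; rewrite r0 /ratr mul0r vord0.
by have [z zE] := ord_ratr r0; exists z; rewrite cE -rE zE.
Qed.

Variables (Qq : {subfield L}) (Qq_unr : unramified v Qq).

Lemma ord_Qq x : x \in Qq -> x != 0 -> exists z : int, v x = z%:~R%:E.
Proof.
move=> xQ x0; have [y yE] := Qq_unr xQ x0.
have y0 : y != 0.
  by apply: contraNneq x0 => y0; apply/eqP/(ord_eqy (val_ordP v)); rewrite yE y0 scale0r vord0.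
by have [z zE] := ord_Qp y0; exists z; rewrite yE.
Qed.

(** A term of least order is strictly dominant, so the sum has its order and nothing can cancel. *)
Lemma ordge_sum_distinct m (F : 'I_m -> L) c :
  (forall i j, i != j -> F i != 0 -> v (F i) != v (F j)) ->
  ordge v c (\sum_i F i) -> forall i, ordge v c (F i).
Proof.
move=> hd hs i0; apply/negPn/negP => hn.
pose j := [arg min_(i < i0) v (F i)]%O.
have jmin i : (v (F j) <= v (F i))%E by rewrite /j; case: arg_minP => // k _; apply.
have jc : (v (F j) < c%:E)%E by apply: le_lt_trans (jmin i0) _; rewrite ltNge.
have Fj0 : F j != 0.
  by apply: contraTneq jc => ->; rewrite vord0 -leNgt leey.
have hS : (v (F j) < v (\sum_(i | i != j) F i)%R)%E.
  elim/big_ind: _ => [|x y hx hy|i ij].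
  - by have [d ->] := ord_fin v Fj0; rewrite vord0 ltry.
  - by apply: lt_le_trans (ordD (val_ordP v) x y); rewrite lt_min hx hy.
  - by rewrite lt_neqAle jmin andbT; apply: hd => //; rewrite eq_sym.
have : (v (F j) < v (\sum_i F i - \sum_(i | i != j) F i)%R)%E.
  apply: lt_le_trans (ordD (val_ordP v) _ _).
  by rewrite lt_min ordN hS andbT; apply: lt_le_trans hs.
by rewrite (bigD1 j) //= addrK ltxx.
Qed.

Local Notation e := ((p.-1)%:R^-1 : rat).

Let p1 : (1 < p)%N. Proof. exact: prime_gt1. Qed.

Lemma pm1_gt0 : 0 < (p.-1)%:R :> rat.
Proof. by rewrite ltr0n; move: p1; case: (p) => [|[]]. Qed.

Lemma e_gt0 : 0 < e. Proof. by rewrite invr_gt0 pm1_gt0. Qed.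

Lemma e_le1 : e <= 1.
Proof.
by rewrite invf_le1 ?pm1_gt0 // ler1n; move: p1; case: (p) => [|[]].
Qed.

(** * The uniformizer 1 - zeta and cyclotomic units *)

Variables (zeta : L) (zetaP : p.-primitive_root zeta).

(* A uniformizer fixed by sigma; it compares gamma with its conjugate. *)
Definition prime_elt := 1 - zeta.

Lemma ord_zeta : v zeta = 0%E.
Proof.
have z0 : zeta != 0.
  apply/eqP => z0; have := prim_expr_order zetaP.
  by rewrite z0 expr0n gtn_eqF ?prime_gt0 //= => /eqP; rewrite eq_sym oner_eq0.
have [c cE] := ord_fin v z0.
have := ord_Xfin p cE; rewrite (prim_expr_order zetaP) vord1 => -[] /esym/eqP.
rewrite mulf_eq0 pnatr_eq0 gtn_eqF ?prime_gt0 //= cE => /eqP -> //.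
Qed.

(** The cyclotomic unit (1 - zeta^i) / (1 - zeta). *)
Let s i := \sum_(j < i) zeta ^+ j.

Let s_int i : ordge v 0 (s i).
Proof. by apply: ordge_sum => j _; apply: ordgeX0; rewrite (ordge_fin _ ord_zeta). Qed.

(** The cyclotomic polynomial 1 + X + ... + X^(p-1) at X = 1, with one factor 1 - zeta taken out of
    each 1 - zeta^i. *)
Lemma zeta_prod : p%:R = prime_elt ^+ p.-1 * \prod_(1 <= i < p) s i.
Proof.
have E : \prod_(1 <= i < p) ('X - (zeta ^+ i)%:P) = \sum_(i < p) 'X^i :> {poly L}.
  have X1 : 'X - 1 != 0 :> {poly L} by rewrite -polyC1 polyXsubC_eq0.
  apply: (mulfI X1); rewrite -subrX1 -(factor_Xn_sub_1 zetaP) [RHS]big_ltn ?prime_gt0 ?expr0 //.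
have := congr1 (fun q => q.[1]) E; rewrite horner_prod horner_sum.
under [in RHS]eq_bigr do rewrite hornerXn expr1n.
rewrite sumr_const card_ord => <-.
under eq_bigr do rewrite hornerXsubC.
have -> : prime_elt ^+ p.-1 = \prod_(1 <= i < p) prime_elt.
  by rewrite big_const_nat subn1 -Monoid.iteropE /=; elim: (p.-1) => // k IH; rewrite exprS iterS IH.
rewrite -big_split /=; apply: eq_bigr => i _.
by rewrite -opprB subrX1 /prime_elt -mulNr opprB.
Qed.

(** If k i = 1 modulo p, then 1 - zeta = 1 - (zeta^i)^k is a multiple of 1 - zeta^i; the quotient is
    an integral inverse of [s i]. *)
Let s_unit i : (0 < i < p)%N -> v (s i) = 0%E.
Proof.
move=> /andP[i0 ip].
have [k [l E]] : exists k l, (k * i = l * p + 1)%N.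
  case: (egcdnP p i0) => a b Eab _; exists a, b; rewrite Eab.
  by congr (_ + _)%N; apply/eqP; rewrite -/(coprime _ _) coprime_sym prime_coprime // gtnNdvd.
have pi0 : prime_elt != 0.
  rewrite subr_eq0 eq_sym; apply: contraTneq p1 => z1.
  have : (p %| 1)%N by rewrite (prim_order_dvd zetaP) z1 expr1n.
  by rewrite dvdn1 -leqNgt => /eqP ->.
have : s i * \sum_(j < k) (zeta ^+ i) ^+ j = 1.
  apply: (mulfI pi0); rewrite mulrA /prime_elt -[1 - zeta]opprB mulNr -subrX1 mulNr -subrX1.
  by rewrite -exprM mulnC E exprD mulnC exprM (prim_expr_order zetaP) expr1n mul1r expr1 mulr1.
set t := \sum_(j < k) _ => st.
have ht : ordge v 0 t.
  by apply: ordge_sum => j _; apply/ordgeX0/ordgeX0; rewrite (ordge_fin _ ord_zeta).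
have s0 : s i != 0 by apply: contra_eq_neq st => ->; rewrite mul0r eq_sym oner_eq0.
have t0 : t != 0 by apply: contra_eq_neq st => ->; rewrite mulr0 eq_sym oner_eq0.
have [c cE] := ord_fin v s0; have [d dE] := ord_fin v t0.
move: ht (s_int i); rewrite (ordge_fin _ cE) (ordge_fin _ dE) => d0 c0.
have := ord_Mfin cE dE; rewrite st vord1 => -[] h.
by rewrite cE; congr (_%:E); lra.
Qed.

Lemma ord_prime_elt : v prime_elt = e%:E.
Proof.
have pE := ord_p (val_ordP v).
have pi0 : prime_elt != 0.
  apply: contra_eq_neq zeta_prod => ->.
  rewrite expr0n -subn1 subn_eq0 leqNgt p1 mul0r natr_eq0L; move: p1; case: (p) => //.
have [c cE] := ord_fin v pi0.
have hs : v (\prod_(1 <= i < p) s i) = 0%E.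
  rewrite big_nat; elim/big_ind: _ => [|x y hx hy|i]; [exact: vord1| |exact: s_unit].
  by rewrite (ordM (val_ordP v)) hx hy adde0.
have := ord_Mfin (ord_Xfin p.-1 cE) hs; rewrite -zeta_prod pE addr0 => -[] h.
rewrite cE; congr (_%:E); apply: (mulfI (lt0r_neq0 pm1_gt0)).
by rewrite -h divff ?lt0r_neq0 ?pm1_gt0.
Qed.

Lemma ordge_zetaX j : ordge v e (zeta ^+ j - 1).
Proof.
rewrite -[X in _ - X](expr1n _ j); apply: ordge_congX; first by rewrite (ordge_fin _ ord_zeta).
  exact: ordge1.
by rewrite ordgeBC (ordge_fin _ ord_prime_elt).
Qed.

(** As zeta is 1 modulo 1 - zeta, each [s i] is i modulo 1 - zeta, so their product is (p-1)!, that
    is -1 by Wilson. *)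
Lemma prime_elt_pow : ordge v e (prime_elt ^+ p.-1 / p%:R + 1).
Proof.
set U := \prod_(1 <= i < p) s i.
have U0 : U != 0.
  by apply: contra_eq_neq zeta_prod; rewrite -/U => ->; rewrite mulr0 natr_eq0L; move: p1; case: (p).
have pi0 : prime_elt ^+ p.-1 != 0.
  by apply: contra_eq_neq zeta_prod; rewrite -/U => ->; rewrite mul0r natr_eq0L; move: p1; case: (p).
have UE : v U = 0%:E.
  have := zeta_prod; rewrite -/U => h.
  have [c cE] := ord_fin v U0.
  have := ord_Mfin (ord_Xfin p.-1 ord_prime_elt) cE.
  rewrite -h (ord_p (val_ordP v)) divff ?lt0r_neq0 ?pm1_gt0 // => -[] h'.
  by rewrite cE; congr (_%:E); lra.
rewrite zeta_prod -/U invfM mulrA divff // mul1r.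
rewrite -(ordge_mulfin _ _ UE) addr0 mulrDl mul1r mulVf // addrC.
have UN : ordge v e (U - (p.-1)`!%:R).
  have -> : (p.-1)`!%:R = \prod_(1 <= i < p) i%:R :> L.
    by rewrite fact_prod natr_prod prednK // prime_gt0.
  have : [/\ ordge v 0 U, ordge v 0 (\prod_(1 <= i < p) i%:R) & ordge v e (U - \prod_(1 <= i < p) i%:R)].
    rewrite /U; elim/big_rec2: _ => [|i x y hi [hx hy hxy]].
      by rewrite subrr ordge0 ordge1.
    split; [exact: ordgeM0|by apply: ordgeM0 => //; apply: ordge_nat|].
    apply: ordge_congM => //.
    have -> : i%:R = \sum_(j < i) 1 :> L by rewrite sumr_const card_ord.
    rewrite /s -sumrB; apply: ordge_sum => j _.
    exact: ordge_zetaX.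
  by case.
rewrite (_ : U + 1 = (U - (p.-1)`!%:R) + ((p.-1)`!%:R + 1)); last by ring.
apply: ordgeD => //; rewrite natr1; have : (p %| (p.-1)`!.+1)%N by rewrite -Wilson.
move=> /dvdnP[q ->]; rewrite natrM; apply: ordgeM0; first exact: ordge_nat.
by rewrite (ordge_fin _ (ord_p (val_ordP v))) e_le1.
Qed.

(** * The ring Zq[zeta] is the full valuation ring *)

Hypothesis zeta_gen : <<Qq; zeta>>%VS = fullv.

Lemma Zq_add x y : in_Zq v Qq x -> in_Zq v Qq y -> in_Zq v Qq (x + y).
Proof. by move=> [hx ox] [hy oy]; split; [apply: rpredD|apply: ordgeD]. Qed.

Lemma Zq_mul x y : in_Zq v Qq x -> in_Zq v Qq y -> in_Zq v Qq (x * y).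
Proof. by move=> [hx ox] [hy oy]; split; [apply: rpredM|apply: ordgeM0]. Qed.

Lemma Zq_int (z : int) : in_Zq v Qq z%:~R.
Proof. by split; [apply: rpred_int|apply: ordge_int]. Qed.

Lemma Zq_horner1 (P : {poly L}) : (forall k, in_Zq v Qq P`_k) -> in_Zq v Qq P.[1].
Proof.
move=> hP; rewrite horner_coef; elim/big_ind: _ => [|x y|i _]; [exact: (Zq_int 0)|exact: Zq_add|].
by rewrite expr1n mulr1; apply: hP.
Qed.

Lemma in_O0_ordge x : in_O0 v Qq zeta x -> ordge v 0 x.
Proof.
move=> [P [hP ->]]; rewrite horner_coef; apply: ordge_sum => i _; apply: ordgeM0.
  by have [] := hP i.
by apply: ordgeX0; rewrite (ordge_fin _ ord_zeta).
Qed.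

(** Expand x in powers of 1 - zeta of exponent below p - 1, with coefficients in [Qq]. The
    coefficients have integral orders and the powers have distinct orders in [0, 1), so the terms
    have distinct orders and each is integral. A coefficient then has order greater than -1, hence
    at least 0. Substituting 1 - X returns to powers of zeta. *)
Lemma in_O0P x : in_O0 v Qq zeta x <-> ordge v 0 x.
Proof.
split; first exact: in_O0_ordge.
move=> hx; have xin : x \in <<Qq; zeta>>%VS by rewrite zeta_gen memvf.
pose P := Fadjoin_poly Qq zeta x.
have PE : P.[zeta] = x by apply: Fadjoin_poly_eq.
have PQ : P \is a polyOver Qq by apply: Fadjoin_polyOver.
have sP : (size P <= p.-1)%N.
  apply: leq_trans (size_Fadjoin_poly _ _ _) _.
  (* zeta is a root of 1 + X + ... + X^(p-1), so its degree over [Qq] is at most p - 1. *)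
  have c0 : \poly_(i < p) (1 : L) != 0.
    by rewrite -size_poly_eq0 size_poly_eq ?oner_eq0 // gtn_eqF ?prime_gt0.
  have := @minPoly_dvdp _ _ Qq zeta (\poly_(i < p) (1 : L)).
  move=> /(_ _ _)/(dvdp_leq c0).
  rewrite size_minPoly size_poly_eq ?oner_eq0 // => h.
  have : (adjoin_degree Qq zeta < p)%N.
    apply: h; first by apply/polyOver_poly => i _; apply: rpred1.
    have z1 : zeta - 1 != 0.
      by rewrite -oppr_eq0 opprB; apply: ord_neq0 ord_prime_elt.
    rewrite rootE horner_poly; apply/eqP/(mulfI z1).
    under eq_bigr do rewrite mul1r.
    by rewrite -subrX1 (prim_expr_order zetaP) subrr mulr0.
  by move: p1; case: (p).
pose Q := P \Po (1 - 'X).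
have sQ : size Q = size P.
  by apply: size_comp_poly2; rewrite -opprB size_polyN -polyC1 size_XsubC.
have QQ : Q \is a polyOver Qq.
  apply: polyOver_comp => //; apply: rpredB; [apply: rpred1|exact: polyOverX].
have QE : Q.[prime_elt] = x.
  by rewrite horner_comp hornerD hornerN hornerX hornerC /prime_elt subKr PE.
have hQ k : in_Zq v Qq Q`_k.
  split; first by move/polyOverP: QQ; apply.
  have [kQ|kQ] := ltnP k (size Q); last by rewrite nth_default // -/(ordge v 0 _) ordge0.
  have F i : v (Q`_i * prime_elt ^+ i) = (v (Q`_i)%R + (i%:R * e)%:E)%E.
    by rewrite (ordM (val_ordP v)) (ord_Xfin i ord_prime_elt).
  have := @ordge_sum_distinct (size Q) (fun i => Q`_i * prime_elt ^+ i) 0 _ _ (Ordinal kQ).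
  rewrite -horner_coef QE /= => /(_ _ hx).
  have [Qk0|Qk0] := eqVneq Q`_k 0; first by rewrite Qk0 -/(ordge v 0 _) ordge0.
  have Qz i : Q`_i != 0 -> exists z : int, v Q`_i = z%:~R%:E.
    by apply: ord_Qq; move/polyOverP: QQ; apply.
  have ip (i : nat) : (i < size Q)%N -> (i%:R * e : rat) < 1.
    move=> iQ; rewrite ltr_pdivrMr ?pm1_gt0 // mul1r ltr_nat.
    by rewrite (leq_trans iQ) // sQ.
  have [z zE] := Qz _ Qk0.
  move=> h; have {h} : ordge v 0 (Q`_k * prime_elt ^+ k).
    apply: h => i j ij; rewrite mulf_eq0 negb_or => /andP[Qi0 _].
    have [Qj0|Qj0] := eqVneq Q`_j 0.
      rewrite Qj0 mul0r vord0 F; have [y ->] := Qz _ Qi0; by rewrite -EFinD.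
    have [y yE] := Qz _ Qi0; have [w wE] := Qz _ Qj0.
    apply: contraNneq ij; rewrite !F yE wE -!EFinD => -[] E.
    have ii := ip _ (ltn_ord i); have jj := ip _ (ltn_ord j).
    have i0 : 0 <= (i%:R * e : rat) by rewrite mulr_ge0 // ltW // e_gt0.
    have j0 : 0 <= (j%:R * e : rat) by rewrite mulr_ge0 // ltW // e_gt0.
    have yw : y = w.
      have h1 : (y - w)%:~R < 1 :> rat by rewrite intrB; lra.
      have h2 : (w - y)%:~R < 1 :> rat by rewrite intrB; lra.
      move: h1 h2; rewrite -[1]/(1%:~R) !ltr_int; clear; lia.
    move: E; rewrite yw => /addrI /(mulIf (lt0r_neq0 e_gt0)) /eqP.
    by rewrite eqr_nat => /eqP ij; apply/eqP/val_inj.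
  rewrite /ordge F zE -EFinD lee_fin => h.
  have : (-1)%:~R < z%:~R :> rat by have := ip _ kQ; rewrite mulrNz; lra.
  by rewrite ltr_int lee_fin ler0z; clear; lia.
exists (Q \Po (1 - 'X)); split; last first.
  by rewrite horner_comp hornerD hornerN hornerX hornerC -/prime_elt QE.
move=> k; rewrite comp_polyE coef_sum; elim/big_ind: _ => [|y z|i _].
- exact: (Zq_int 0).
- exact: Zq_add.
rewrite coefZ; apply: Zq_mul => //.
have : forall j, in_Zq v Qq (1 - 'X : {poly L})`_j.
  case=> [|[|j]]; rewrite coefB coef1 coefX /=.
  - by rewrite subr0; exact: (Zq_int 1).
  - by rewrite sub0r; exact: (Zq_int (-1)).
  - by rewrite subr0; exact: (Zq_int 0).
elim: (i : nat) k => [|m IH] k h; first by rewrite expr0 coef1; exact: (Zq_int (k == 0)%N).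
rewrite exprS coefM; elim/big_ind: _ => [|y z|j _]; [exact: (Zq_int 0)|exact: Zq_add|].
by apply: Zq_mul; [apply: h|apply: IH].
Qed.

(** Total ramification: zeta is 1 modulo 1 - zeta, so evaluating a polynomial expression of x at 1
    gives a representative in Zq. *)
Lemma O0_residue x : ordge v 0 x -> exists2 c, in_Zq v Qq c & ordge v e (x - c).
Proof.
move=> /in_O0P[P [hP ->]]; exists P.[1]; first exact: Zq_horner1.
rewrite !horner_coef -sumrB; apply: ordge_sum => i _.
rewrite expr1n -mulrBr; apply: ordgeM0; last exact: ordge_zetaX.
by have [] := hP i.
Qed.

(** No order lies strictly between 0 and 1/(p-1): a representative in Zq of positive order has order
    at least 1. *)
Lemma ord_pos x : (0 < v x)%E -> ordge v e x.
Proof.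
move=> h; have [c [cQ c0] hc] := O0_residue (ltW h).
have hc' : (0 < v c)%E.
  rewrite -(subKr x c); apply: lt_le_trans (ordD (val_ordP v) _ _).
  rewrite lt_min h ordN; apply: lt_le_trans hc; rewrite lte_fin; exact: e_gt0.
rewrite -(subrK c x); apply: ordgeD => //.
have [->|cn0] := eqVneq c 0; first exact: ordge0.
have [z zE] := ord_Qq cQ cn0.
move: hc'; rewrite zE lte_fin ltr0z (ordge_fin _ zE) => z0.
by apply: le_trans e_le1 _; rewrite -[1]/(1%:~R) ler_int; lia.
Qed.

(** * The action of sigma on the valuation ring and on gamma *)

Variable sigma : gal_of {:L}.
Hypothesis sigma_zeta : sigma zeta = zeta.
Hypothesis sigma_frob : forall x, in_Zq v Qq x -> (0 < v (sigma x - x ^+ p)%R)%E.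

Lemma sigma_Zq x : in_Zq v Qq x -> ordge v 0 (sigma x).
Proof.
move=> hx; rewrite -(subrK (x ^+ p) (sigma x)); apply: ordgeD; last by apply: ordgeX0; case: hx.
by apply: ltW; apply: sigma_frob.
Qed.

Lemma sigma_int x : ordge v 0 x -> ordge v 0 (sigma x).
Proof.
move=> /in_O0P[P [hP ->]]; rewrite horner_coef rmorph_sum; apply: ordge_sum => i _.
rewrite rmorphM rmorphXn /= sigma_zeta; apply: ordgeM0; first exact: sigma_Zq.
by apply: ordgeX0; rewrite (ordge_fin _ ord_zeta).
Qed.

(** The Galois group is finite, so the inverse of sigma is a power of sigma. *)
Lemma sigmaV_int x : ordge v 0 x -> ordge v 0 ((sigma^-1)%g x).
Proof.
move=> hx; rewrite invg_expg; elim: (_.-1) => [|k IH].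
  by rewrite expg0 gal_id.
by rewrite expgSr galM ?memvf //; apply: sigma_int.
Qed.

Lemma sigmaK x : sigma ((sigma^-1)%g x) = x.
Proof. by rewrite -galM ?memvf // mulVg gal_id. Qed.

Lemma sigmaV_zeta : (sigma^-1)%g zeta = zeta.
Proof. by rewrite -{1}sigma_zeta -galM ?memvf // mulgV gal_id. Qed.

(** The uniformizer 1 - zeta is fixed, so dividing by it reduces the claim to integrality. *)
Lemma sigmaV_e x : ordge v e x -> ordge v e ((sigma^-1)%g x).
Proof.
move=> h; have pi0 := ord_neq0 ord_prime_elt.
rewrite -(divfK pi0 x) rmorphM rmorphB rmorph1 /= sigmaV_zeta.
rewrite -[e in ordge v e]add0r; apply: ordgeM; last by rewrite (ordge_fin _ ord_prime_elt).
by apply: sigmaV_int; apply: (ordge_divfin ord_prime_elt); rewrite add0r.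
Qed.

Lemma sigma_e x : ordge v e x -> ordge v e (sigma x).
Proof.
move=> h; have pi0 := ord_neq0 ord_prime_elt.
rewrite -(divfK pi0 x) rmorphM rmorphB rmorph1 /= sigma_zeta.
rewrite -[e in ordge v e]add0r; apply: ordgeM; last by rewrite (ordge_fin _ ord_prime_elt).
by apply: sigma_int; apply: (ordge_divfin ord_prime_elt); rewrite add0r.
Qed.

(** The Frobenius congruence, given on Zq, extends to Zq[zeta] because both rings have the same
    residues. *)
Lemma sigma_frobO x : ordge v 0 x -> ordge v e (sigma x - x ^+ p).
Proof.
move=> hx; have [c hc hxc] := O0_residue hx.
have h1 : ordge v e (sigma x - sigma c) by rewrite -rmorphB; apply: sigma_e.
have h2 : ordge v e (sigma c - c ^+ p) by apply/ord_pos/sigma_frob.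
apply: ordge_trans h1 (ordge_trans h2 _).
by rewrite ordgeBC; apply: ordge_congX => //; case: hc.
Qed.

Variable gamma : L.
Hypothesis gamma_ord : v gamma = e%:E.
Hypothesis gamma_pow : ordge v e (gamma ^+ p.-1 / p%:R + 1).

(** Let u = gamma / (1 - zeta) and w its image under the inverse of sigma. Both gamma^(p-1)/p and (1
    - zeta)^(p-1)/p are -1 modulo gamma, so u^(p-1), and with it w^(p-1), is 1 modulo gamma. Then u
    = sigma(w) is congruent to w^p, hence to w, and the ratio in question is w / u. *)
Lemma sigmaV_gamma : ordge v e ((sigma^-1)%g gamma / gamma - 1).
Proof.
have pi0 := ord_neq0 ord_prime_elt; have g0 := ord_neq0 gamma_ord.
pose u := gamma / prime_elt; pose w := (sigma^-1)%g u.
have uE : v u = 0%:E by rewrite (ord_Mfin gamma_ord (ord_Vfin ord_prime_elt)) subrr.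
have hu : ordge v 0 u by rewrite (ordge_fin _ uE).
have hw : ordge v 0 w by apply: sigmaV_int.
have up : ordge v e (u ^+ p.-1 - 1).
  have qE : v (prime_elt ^+ p.-1 / p%:R) = 0%:E.
    rewrite (ord_Mfin (ord_Xfin _ ord_prime_elt) (ord_Vfin (ord_p (val_ordP v)))).
    by rewrite divff ?lt0r_neq0 ?pm1_gt0 // subrr.
  have pn0 : p%:R != 0 :> L by apply: ord_neq0 (ord_p (val_ordP v)).
  rewrite -(ordge_mulfin _ _ qE) addr0 mulrBl mul1r mulrA expr_div_n divfK ?expf_neq0 //.
  rewrite -(subrKC (-1) (gamma ^+ p.-1 / p%:R)) -addrA opprK.
  by have := ordgeB gamma_pow prime_elt_pow; congr ordge; ring.
have wp : ordge v e (w ^+ p.-1 - 1).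
  by have := sigmaV_e up; rewrite rmorphB rmorph1 rmorphXn.
have uw : ordge v e (u - w).
  have := sigma_frobO hw; rewrite /w sigmaK -/w => h.
  apply: ordge_trans h _.
  have -> : w ^+ p = w * w ^+ p.-1 by rewrite -exprS prednK // prime_gt0.
  rewrite -[X in _ - X]mulr1 -mulrBr.
  exact: ordgeM0.
have u0 := ord_neq0 uE.
have -> : (sigma^-1)%g gamma / gamma = w / u.
  rewrite /w /u rmorphM fmorphV rmorphB rmorph1 /= sigmaV_zeta -/prime_elt invf_div.
  by rewrite mulrA divfK.
rewrite -(ordge_mulfin _ _ uE) addr0 mulrBl mul1r divfK // ordgeBC //.
Qed.

(** The image of gamma differs from gamma by a unit, so dividing by gamma^k reduces to
    integrality. *)
Lemma sigmaV_ord x k : ordge v (k%:R * e) x -> ordge v (k%:R * e) ((sigma^-1)%g x).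
Proof.
move=> h; have gE := ord_Xfin k gamma_ord; have g0 := ord_neq0 gE.
have tg : v ((sigma^-1)%g gamma) = e%:E.
  have E : v ((sigma^-1)%g gamma / gamma) = 0%:E.
    apply: (ord_eqP (vord1 v) e_gt0); exact: sigmaV_gamma.
  by rewrite -(divfK (ord_neq0 gamma_ord) ((sigma^-1)%g gamma)) (ord_Mfin E gamma_ord) add0r.
rewrite -(divfK g0 x) rmorphM rmorphXn /=.
rewrite -[X in ordge v X]add0r; apply: ordgeM; last by rewrite (ordge_fin _ (ord_Xfin k tg)).
by apply: sigmaV_int; apply: (ordge_divfin gE); rewrite add0r.
Qed.

End PadicInteger.

(** * Completeness and convergent sums *)

Section Completeness.
Variables (p : nat) (Qp : fieldType) (L : splittingFieldType Qp).
Variable v : valuation p L.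
Hypothesis QpP : is_Qp v.
Implicit Types (c d : rat) (x y : L).

Lemma vlim_uniq (s : nat -> L) x y : has_vlim v s x -> has_vlim v s y -> x = y.
Proof.
move=> hx hy; apply/eqP; rewrite -subr_eq0; apply/eqP/(ordge_eq0 (v := v)).
apply: ordge_natP => N; have [M1 h1] := hx N; have [M2 h2] := hy N.
pose i := maxn M1 M2.
have a1 := h1 i (leq_maxl _ _); have a2 := h2 i (leq_maxr _ _).
by apply: ordge_trans a2; rewrite ordgeBC.
Qed.

(* If the coordinate along x is not Cauchy, dividing by its increments makes x a limit of
   elements of the span of X. *)
Lemma complete_span (X : seq L) : free X -> forall s : nat -> L,
  (forall i, s i \in <<X>>%VS) -> vcauchy v s ->
  exists2 l, l \in <<X>>%VS & has_vlim v s l.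
Proof.
elim: X => [|x X IH] fX s sX sC.
  exists 0; rewrite ?mem0v // => N; exists 0%N => i _.
  by move: (sX i); rewrite span_nil memv0 => /eqP ->; rewrite subr0 -/(ordge v _ _) ordge0.
move: fX; rewrite free_cons => /andP[xX fX].
have dec i : exists at_ : Qp * L, at_.2 \in <<X>>%VS /\ s i = at_.1 *: x + at_.2.
  move: (sX i); rewrite span_cons => /memv_addP[y /vlineP[a ->] [t tX ->]].
  by exists (a, t).
have [f hf] := choice dec.
pose a i : L := (f i).1%:A; pose t i := (f i).2.
have tX i : t i \in <<X>>%VS by have [] := hf i.
have sE i : s i = a i * x + t i by have [_ ->] := hf i; rewrite /a mulr_algl.
have x0 : x != 0 by apply: contraNneq xX => ->; rewrite mem0v.
have [d dE] := ord_fin v x0.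
have [aC|aC] := pselect (vcauchy v a).
  have [l hl] := Qp_complete QpP aC.
  have tC : vcauchy v t.
    move=> N; have [M1 h1] := sC N; have [M2 h2] := aC (Num.bound (`|d| + N%:R)).
    exists (maxn M1 M2) => i j; rewrite !geq_max => /andP[i1 i2] /andP[j1 j2].
    have -> : t i - t j = (s i - s j) - (a i - a j) * x by rewrite !sE; ring.
    apply: (@ordgeB _ _ _ v); first exact: h1.
    rewrite -(subrK d N%:R) (ordge_mulfin _ _ dE); apply: ordgeW (h2 _ _ i2 j2).
    have : `|d| + N%:R < (Num.bound (`|d| + N%:R))%:R by apply: archi_boundP; rewrite addr_ge0.
    have := ler_norm (- d); rewrite normrN; lra.
  have [t0 t0X ht] := IH fX t tX tC.
  exists (l%:A * x + t0).
    by rewrite mulr_algl span_cons; apply: memv_add => //; apply: memvZ; apply: memv_line.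
  move=> N; have [M1 h1] := ht N; have [M2 h2] := hl (Num.bound (`|d| + N%:R)).
  exists (maxn M1 M2) => i; rewrite geq_max => /andP[i1 i2].
  have -> : s i - (l%:A * x + t0) = (t i - t0) + (a i - l%:A) * x by rewrite sE; ring.
  apply: (@ordgeD _ _ _ v); first exact: h1.
  rewrite -(subrK d N%:R) (ordge_mulfin _ _ dE); apply: ordgeW (h2 _ i2).
  have : `|d| + N%:R < (Num.bound (`|d| + N%:R))%:R by apply: archi_boundP; rewrite addr_ge0.
  have := ler_norm (- d); rewrite normrN; lra.
case: aC => N; apply: contrapT => /forallNP aN.
have ex K : exists y, y \in <<X>>%VS /\ ordge v K%:R (x - y).
  have [M hM] := sC (K + N)%N.
  have /existsNP[i /existsNP[j]] := aN M.
  move=> /not_implyP[iM] /not_implyP[jM] /negP; rewrite -ltNge => lt.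
  have b0 : (f i).1 - (f j).1 != 0.
    apply: contraTneq lt => E; rewrite -leNgt.
    by rewrite /a -scalerBl E scale0r -/(ordge v _ _) ordge0.
  have aE : a i - a j = ((f i).1 - (f j).1)%:A by rewrite /a -scalerBl.
  have ab0 : a i - a j != 0 by rewrite aE -in_algE fmorph_eq0.
  have [b bE] := ord_fin v ab0.
  exists (- (((f i).1 - (f j).1)^-1 *: (t i - t j))); split.
    by rewrite memvN memvZ // rpredB.
  have -> : x - - (((f i).1 - (f j).1)^-1 *: (t i - t j)) = (s i - s j) / (a i - a j).
    apply: (mulIf ab0); rewrite divfK // mulrDl opprK !sE.
    have -> : ((f i).1 - (f j).1)^-1 *: (t i - t j) * (a i - a j) = t i - t j.
      by rewrite aE -scalerAl mulr_algr scalerA mulVf // scale1r.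
    by ring.
  apply: (ordge_divfin bE); apply: ordgeW (hM i j iM jM).
  by move: lt; rewrite bE lte_fin natrD; lra.
have [y hy] := choice ex.
have yx : has_vlim v y x.
  by move=> K; exists K => i Ki; rewrite -/(ordge v _ _) ordgeBC; apply: ordgeW (hy i).2; rewrite ler_nat.
have yC : vcauchy v y.
  move=> K; have [M h] := yx K; exists M => i j iM jM.
  by apply: (@ordge_trans _ _ _ v _ _ x); [exact: h|rewrite ordgeBC; exact: h].
have [l lX hl] := IH fX y (fun i => (hy i).1) yC.
by case/negP: xX; rewrite (vlim_uniq yx hl).
Qed.

Lemma complete (s : nat -> L) : vcauchy v s -> exists l, has_vlim v s l.
Proof.
move=> sC; have bP := vbasisP {:L}.
have := @complete_span (vbasis {:L}) (basis_free bP) s.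
rewrite (span_basis bP) => /(_ (fun=> memvf _) sC)[l _ hl]; by exists l.
Qed.

Section Sums.
Variable I : choiceType.
Implicit Types f : I -> L.

Lemma sum_fsetDK (R : zmodType) (f : I -> R) (A B : {fset I}) : (A `<=` B)%fset ->
  \sum_(i <- B) f i = \sum_(i <- A) f i + \sum_(i <- (B `\` A)%fset) f i.
Proof.
move=> /fsubsetP AB; rewrite (big_fsetID _ (mem A)) /=; congr (_ + _); apply: eq_fbigl => i.
  rewrite !inE /=; case: (boolP (i \in A)) => iA; last by rewrite andbF.
  by rewrite AB.
by rewrite !inE /= andbC.
Qed.

Definition vsummable f := forall N : nat, finite_set [set i | (v (f i) < N%:R%:E)%E]%classic.

Lemma has_vsum_approx f s (A : {fset I}) c : has_vsum v f s ->
  (forall i, i \notin A -> ordge v c (f i)) -> ordge v c (s - \sum_(i <- A) f i).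
Proof.
move=> hs hA; have [B hB] := hs (Num.bound `|c|).
have h1 : ordge v c (s - \sum_(i <- (A `|` B)%fset) f i).
  apply: ordgeW (hB _ (fsubsetUr A B)).
  apply: le_trans (ler_norm c) (ltW (archi_boundP (normr_ge0 c))).
rewrite (sum_fsetDK f (fsubsetUl A B)) opprD addrA in h1.
rewrite -[X in ordge _ _ X](subrK (\sum_(i <- ((A `|` B) `\` A)%fset) f i)).
apply: ordgeD => //; rewrite big_seq; apply: ordge_sum => i.
by rewrite in_fsetD => /andP[iA _]; apply: hA.
Qed.

Lemma has_vsum_uniq f s t : has_vsum v f s -> has_vsum v f t -> s = t.
Proof.
move=> hs ht; apply/eqP; rewrite -subr_eq0; apply/eqP/(ordge_eq0 (v := v)).
apply: ordge_natP => N; have [A hA] := hs N; have [B hB] := ht N.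
have h1 := hA _ (fsubsetUl A B); have h2 := hB _ (fsubsetUr A B).
by apply: ordge_trans h1 _; rewrite ordgeBC.
Qed.

Lemma vsumE f s : has_vsum v f s -> vsum v f = s.
Proof.
by move=> hs; rewrite /vsum; case: xgetP => [t _ ht|/(_ s)//]; apply: has_vsum_uniq hs.
Qed.

(** Sums over finite sets outside which all terms have order at least N form a Cauchy sequence in
    N. *)
Lemma has_vsum_ex f : vsummable f -> exists s, has_vsum v f s.
Proof.
move=> hf.
have ex N : exists A : {fset I}, forall i, i \notin A -> ordge v N%:R (f i).
  have /finite_fsetP[A hA] := hf N; exists A => i iA.
  rewrite /ordge leNgt; apply/negP => lt; case/negP: iA.
  by have : [set` A]%classic i by rewrite -hA.
have [A hA] := choice ex.
pose s N := \sum_(i <- A N) f i.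
have diff N B : (A N `<=` B)%fset -> ordge v N%:R (\sum_(i <- B) f i - s N).
  move=> /(sum_fsetDK f) ->; rewrite addrC addKr big_seq; apply: ordge_sum => i.
  by rewrite in_fsetD => /andP[iA _]; apply: hA.
have sC : vcauchy v s.
  move=> N; exists N => i j iN jN; rewrite -/(ordge v _ _).
  have h1 := diff i _ (fsubsetUl (A i) (A j)); have h2 := diff j _ (fsubsetUr (A i) (A j)).
  rewrite ordgeBC in h1; apply: ordge_trans (ordgeW _ h1) (ordgeW _ h2); by rewrite ler_nat.
have [l hl] := complete sC; exists l => N; have [M hM] := hl N.
exists (A (maxn M N)) => B hB.
have h1 := hM _ (leq_maxl M N); have h2 := diff _ _ hB.
rewrite -/(ordge v _ _) ordgeBC in h1.
apply: ordge_trans h1 _; rewrite ordgeBC; apply: ordgeW h2.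
by rewrite ler_nat leq_maxr.
Qed.

Lemma vsum_approx f (A : {fset I}) c : vsummable f ->
  (forall i, i \notin A -> ordge v c (f i)) -> ordge v c (vsum v f - \sum_(i <- A) f i).
Proof.
by move=> /has_vsum_ex[s hs] hA; rewrite (vsumE hs); apply: has_vsum_approx.
Qed.

Lemma vsummable_fin f (A : {fset I}) : (forall i, i \notin A -> f i = 0) -> vsummable f.
Proof.
move=> hA N; apply: (@sub_finite_set _ _ [set` A]%classic); last exact: finite_fset.
move=> i /=; apply: contraPT => iA; by rewrite (hA _ iA) vord0.
Qed.

Lemma vsum_fin f (A : {fset I}) : (forall i, i \notin A -> f i = 0) ->
  vsum v f = \sum_(i <- A) f i.
Proof.
move=> hA; apply/eqP; rewrite -subr_eq0; apply/eqP/(ordge_eq0 (v := v)) => c.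
by apply: vsum_approx; [exact: vsummable_fin hA|move=> i /hA ->; exact: ordge0].
Qed.

Lemma vsum1 f i0 : (forall i, i != i0 -> f i = 0) -> vsum v f = f i0.
Proof.
move=> h; rewrite (@vsum_fin _ [fset i0]%fset) ?big_seq_fset1 // => i.
by rewrite in_fset1 => /h.
Qed.

Lemma vsum0 f : (forall i, f i = 0) -> vsum v f = 0.
Proof. by move=> h; rewrite (@vsum_fin _ fset0) ?big_nil. Qed.

End Sums.
End Completeness.

(** * Exponents and the coefficients of the Frobenius *)

Lemma Posz_sum (I : Type) (r : seq I) (P : pred I) (F : I -> nat) :
  (\sum_(i <- r | P i) F i)%N%:Z = \sum_(i <- r | P i) (F i)%:Z.
Proof. exact: (big_morph Posz PoszD (erefl _)). Qed.

Section Exponents.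
Variable n : nat.
Implicit Types (u z : 'rV[int]_n).

Definition mnat u := `|mpart u|%N.
(* The exponent u is that of X_1^(kexp u 1) ... X_n^(kexp u n) Y^(mnat u). *)
Definition kexp u l := absz (u ord0 l + mpart u).
Definition wnat u := `|weight u|%N.

Lemma mpart_ge0 u : 0 <= mpart u. Proof. exact: bigmax_ge_id. Qed.

Lemma mpart_ge u l : - u ord0 l <= mpart u. Proof. exact: le_bigmax. Qed.

Lemma mpart_le u c : 0 <= c -> (forall l, - u ord0 l <= c) -> mpart u <= c.
Proof. by move=> c0 h; apply: bigmax_le. Qed.

Lemma mpart_attained u : mpart u = 0 \/ exists l, mpart u = - u ord0 l.
Proof.
rewrite /mpart; elim/big_ind: _ => [|x y hx hy|l _]; [by left| |by right; exists l].
by rewrite maxEle; case: ifP.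
Qed.

Lemma mnatE u : (mnat u)%:Z = mpart u.
Proof. by rewrite gez0_abs // mpart_ge0. Qed.

Lemma kexpE u l : (kexp u l)%:Z = u ord0 l + mpart u.
Proof. by rewrite gez0_abs //; have := mpart_ge u l; lia. Qed.

(** The weight is the total degree of the monomial in X_1, ..., X_n, Y with the least power of Y. *)
Lemma weight_sum u : weight u = (\sum_l kexp u l + mnat u)%N.
Proof.
rewrite PoszD Posz_sum mnatE.
under eq_bigr do rewrite kexpE.
rewrite big_split /= sumr_const card_ord /weight -mulr_natl natz.
have -> : n.+1%:Z = n%:Z + 1 by lia.
by ring.
Qed.

Lemma wnatE u : wnat u = (\sum_l kexp u l + mnat u)%N.
Proof. by rewrite /wnat weight_sum. Qed.

Lemma weightE u : weight u = wnat u. Proof. by rewrite weight_sum wnatE. Qed.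

(** Any other monomial over the exponent u is the reduced one times (X_1 ... X_n Y)^r. *)
Lemma kexp_rep u (k : 'I_n -> nat) (k0 : nat) : (forall l, u ord0 l = (k l)%:Z - k0%:Z) ->
  exists r, k0 = (mnat u + r)%N /\ forall l, k l = (kexp u l + r)%N.
Proof.
move=> h; have mk : (mnat u <= k0)%N.
  by rewrite -lez_nat mnatE; apply: mpart_le => // l; rewrite h; lia.
exists (k0 - mnat u)%N; split=> [|l]; first by rewrite subnKC.
by have := kexpE u l; rewrite -mnatE h; lia.
Qed.

Lemma sum_ltn i : (i <= n)%N -> (\sum_(l < n) (l < i)%N)%N = i.
Proof.
move=> le; rewrite -(subnKC le) big_split_ord /=.
rewrite (eq_bigr (fun=> 1%N)); last by move=> l _; rewrite ltn_ord.
rewrite sum1_card card_ord big1 ?addn0 // => l _.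
by rewrite ltnNge leq_addr.
Qed.

Lemma mpart_nneg u : (forall l, 0 <= u ord0 l) -> mpart u = 0.
Proof.
move=> h; apply/eqP; rewrite eq_le mpart_ge0 andbT; apply: mpart_le => // l.
by rewrite oppr_le0.
Qed.

Lemma mpart_exfirst i : mpart (exfirst n i) = 0.
Proof.
apply/eqP; rewrite eq_le mpart_ge0 andbT; apply: mpart_le => // l.
by rewrite mxE; case: (_ < _)%N.
Qed.

Lemma kexp_exfirst i l : kexp (exfirst n i) l = (l < i)%N.
Proof. by rewrite /kexp mpart_exfirst mxE addr0; case: (_ < _)%N. Qed.

Lemma mnat_exfirst i : mnat (exfirst n i) = 0%N.
Proof. by rewrite /mnat mpart_exfirst. Qed.

Lemma wnat_exfirst i : (i <= n)%N -> wnat (exfirst n i) = i.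
Proof.
move=> le; rewrite wnatE mnat_exfirst addn0 -[RHS](sum_ltn le).
by apply: eq_bigr => l _; rewrite kexp_exfirst.
Qed.

Variable p : nat.
Hypothesis p_gt0 : (0 < p)%N.

Lemma frob_expE z i l : (z *+ p - exfirst n i) ord0 l = p%:Z * z ord0 l - (l < i)%N%:Z.
Proof. by rewrite !mxE mulmxnE -[z ord0 l *+ p]mulr_natl !natz. Qed.

Lemma weight_frob z i : (i <= n)%N ->
  (wnat (z *+ p - exfirst n i) + i)%N%:Z =
  p%:Z * (\sum_l z ord0 l) + n.+1%:Z * mpart (z *+ p - exfirst n i).
Proof.
move=> le; set u := _ - _; rewrite PoszD -weightE /weight.
have -> : \sum_l u ord0 l = p%:Z * (\sum_l z ord0 l) - i%:Z.
  rewrite -[in RHS](sum_ltn le) Posz_sum mulr_sumr -sumrB; apply: eq_bigr => l _.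
  by rewrite /u frob_expE.
by ring.
Qed.

Lemma mpart_frob z i : p%:Z * mpart z <= mpart (z *+ p - exfirst n i).
Proof.
set u := _ - _; have [->|[l ->]] := mpart_attained z; first by rewrite mulr0 mpart_ge0.
apply: le_trans (mpart_ge u l); rewrite /u frob_expE opprB; lia.
Qed.

(** In w(p z - u_i) + i the linear part is p times that of w(z), so only p m(z) <= m(p z - u_i)
    matters. *)
Lemma wnat_frob z i : (i <= n)%N -> (p * wnat z <= wnat (z *+ p - exfirst n i) + i)%N.
Proof.
move=> le; rewrite -lez_nat PoszM -weightE /weight weight_frob // mulrDr lerD2l mulrCA.
by apply: ler_wpM2l => //; apply: mpart_frob.
Qed.

(** Equality means m(p z - u_i) = p m(z). For l < i this gives p (z_l + m(z)) >= 1, so each of the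
    first i variables occurs in the monomial of z. Its degree being at most i, it is X_1 ... X_i. *)
Lemma wnat_frob_eq z i : (i <= n)%N -> (wnat z <= i)%N ->
  (p * wnat z)%N = (wnat (z *+ p - exfirst n i) + i)%N -> z = exfirst n i.
Proof.
move=> le wz /(congr1 Posz); rewrite PoszM -weightE {1}/weight weight_frob // mulrDr.
move=> /addrI; rewrite mulrCA => /(mulfI (_ : n.+1%:Z != 0)) => /(_ isT) mE.
have kz (l : 'I_n) : ((l < i)%N <= kexp z l)%N.
  have := mpart_ge (z *+ p - exfirst n i) l; rewrite -mE frob_expE.
  have := kexpE z l; case: (l < i)%N => //= E h.
  move: E h; set K := (kexp z l)%:Z; rewrite lt0n => E h; apply/eqP => K0.
  by move: E h; rewrite /K K0; nia.
have sk : (i <= \sum_l kexp z l)%N.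
  by rewrite -{1}(sum_ltn le); apply: leq_sum => l _.
have m0 : mnat z = 0%N by move: wz; rewrite wnatE; lia.
have kz' (l : 'I_n) : kexp z l = (l < i)%N.
  apply/eqP; rewrite eqn_leq kz andbT leqNgt; apply/negP => lt.
  have : (\sum_(l < n) (l < i)%N < \sum_l kexp z l)%N.
    rewrite (bigD1 l) //= [X in (_ < X)%N](bigD1 l) //= -addSn; apply: leq_add => //.
    by apply: leq_sum => j _.
  by rewrite sum_ltn //; move: wz; rewrite wnatE m0; lia.
apply/rowP => l; rewrite mxE natz -kz'; have := kexpE z l; rewrite -mnatE m0 addr0.
by move=> ->.
Qed.

End Exponents.

(** * Coefficients of F_lambda and of the Frobenius on the basis *)

Section Theta.
Variables (p n : nat) (Qp : fieldType) (L : splittingFieldType Qp).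
Variable v : valuation p L.
Hypotheses (p_prime : prime p) (n_gt0 : (0 < n)%N) (QpP : is_Qp v).
Local Notation e := ((p.-1)%:R^-1 : rat).
Variables (gamma lambda : L).
Hypotheses (gamma_ord : v gamma = e%:E) (lambda_ord : v lambda = 0%E).
Implicit Types (u z : 'rV[int]_n).

Local Notation th := (theta_coef p gamma).

Lemma ordge_AH k : ordge v 0 (ratr (AH_coef p k)).
Proof. by apply: ordge_ratr => //; apply: AH_coef_pint. Qed.

Lemma ordge_th k : ordge v (k%:R * e) (th k).
Proof.
apply: ordgeM0; first exact: ordge_AH.
by rewrite (ordge_fin _ (ord_Xfin k gamma_ord)).
Qed.

Lemma theta_at_mul c u k : u != 0 -> theta_at p v gamma c u (u *+ k) = th k * c ^+ k.
Proof.
move=> u0; have [l ul] : exists l, u ord0 l != 0.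
  apply/existsP; apply: contraNT u0; rewrite negb_exists => /forallP h.
  by apply/eqP/rowP => l; rewrite mxE; apply/eqP; have := h l; rewrite negbK.
have inj j : u *+ k = u *+ j -> j = k.
  move/rowP/(_ l); rewrite !mulmxnE -[_ *+ k]mulr_natr -[_ *+ j]mulr_natr => /(mulfI ul) /eqP.
  by rewrite eqr_nat => /eqP.
rewrite /theta_at (vsum1 QpP (i0 := k)) ?eqxx // => j jk.
by case: eqP => // /inj E; rewrite E eqxx in jk.
Qed.

Lemma theta_at_neq0 c u z : theta_at p v gamma c u z != 0 -> exists k, z = u *+ k.
Proof.
apply: contraPP => /forallNP h; rewrite /theta_at (vsum0 QpP) ?eqxx // => k.
by case: eqP => // /h.
Qed.

Lemma ex_mulE (l j : 'I_n) k : (ex l *+ k) ord0 j = if j == l then k%:Z else 0.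
Proof.
by rewrite mulmxnE mxE eqxx /=; case: eqP => _ /=; rewrite ?mul0rn // -natz.
Qed.

Lemma exall_mulE (j : 'I_n) k : (exall n *+ k) ord0 j = k%:Z.
Proof. by rewrite mulmxnE mxE natz. Qed.

Lemma ex_neq0 l : ex l != 0 :> 'rV[int]_n.
Proof.
by apply/eqP => /rowP/(_ l); rewrite !mxE !eqxx.
Qed.

Definition theta_prod (r : seq 'I_n) : series n L :=
  \big[lmul v/mono 1 0]_(l <- r) theta_at p v gamma 1 (ex l).

(** Value and support are proved together: the support of the remaining product leaves a single term
    in each convolution, the one where the factor in x_l takes the whole exponent z_l. *)
Lemma theta_prod_spec r : uniq r ->
  (forall z, (forall l, l \in r -> 0 <= z ord0 l) -> (forall l, l \notin r -> z ord0 l = 0) ->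
     theta_prod r z = \prod_(l <- r) th (absz (z ord0 l))) /\
  (forall z, theta_prod r z != 0 ->
     (forall l, l \in r -> 0 <= z ord0 l) /\ (forall l, l \notin r -> z ord0 l = 0)).
Proof.
elim: r => [_|l r IH /andP[lr ur]].
  split=> z; rewrite /theta_prod big_nil /mono.
    move=> _ h; rewrite big_nil; case: eqP => // -[]; apply/rowP => l; by rewrite mxE h.
  by case: (z =P 0) => [->|]; rewrite ?eqxx // => _; split=> l // _; rewrite mxE.
have [IH1 IH2] := IH ur.
pose u0 z := z - ex l *+ (absz (z ord0 l)).
have u0l z j : j != l -> u0 z ord0 j = z ord0 j.
  by move=> jl; rewrite mxE [X in _ + X]mxE ex_mulE (negbTE jl) subr0.
have u0l' z : 0 <= z ord0 l -> u0 z ord0 l = 0.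
  by move=> zl; rewrite mxE [X in _ + X]mxE ex_mulE eqxx gez0_abs // subrr.
have step z : theta_prod (l :: r) z = th (absz (z ord0 l)) * theta_prod r (u0 z).
  rewrite /theta_prod big_cons -/(theta_prod r) /lmul (vsum1 QpP (i0 := u0 z)).
    by rewrite /u0 subKr theta_at_mul ?ex_neq0 // expr1n mulr1.
  move=> u uu; apply/eqP; rewrite mulf_eq0; apply/norP => -[/theta_at_neq0[k kE] /IH2[h1 h2]].
  case/eqP: uu; rewrite /u0 -[LHS](subKr z) kE.
  suff -> : z ord0 l = k%:Z by [].
  by move/rowP: kE => /(_ l); rewrite ex_mulE eqxx mxE [X in _ + X]mxE h2 // subr0.
split=> z.
  move=> h1 h2; rewrite step IH1 ?big_cons.
  - congr (_ * _); rewrite !big_seq; apply: eq_bigr => j jr.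
    by rewrite u0l //; apply: contraNneq lr => <-.
  - move=> j jr; rewrite u0l ?h1 ?inE ?jr ?orbT //; apply: contraNneq lr => <- //.
  - move=> j jr; have [->|jl] := eqVneq j l; first by rewrite u0l' // h1 ?inE ?eqxx.
    by rewrite u0l // h2 // inE negb_or jl.
rewrite step mulf_eq0 negb_or => /andP[_ /IH2[h1 h2]].
have zl : 0 <= z ord0 l.
  move: (h2 _ lr); rewrite /u0 mxE [X in _ + X]mxE ex_mulE eqxx => /eqP.
  by rewrite subr_eq0 => /eqP ->.
split=> j; rewrite inE => jr.
  have [->//|jl] := eqVneq j l; move: jr; rewrite (negbTE jl) => jr.
  by rewrite -(u0l _ _ jl) h1.
by move: jr; rewrite negb_or => /andP[jl jr]; rewrite -(u0l _ _ jl) h2.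
Qed.

(** The contribution to the coefficient of x^z of the k-th power of lambda / (x_1 ... x_n). *)
Definition Fterm z (k : nat) : L :=
  th k * lambda ^+ k * \prod_l th (absz (z ord0 l + k%:Z)).

Definition zshift z (k : nat) : 'rV[int]_n := z + exall n *+ k.

Lemma zshiftE z k l : zshift z k ord0 l = z ord0 l + k%:Z.
Proof. by rewrite mxE exall_mulE. Qed.

Let enumP := theta_prod_spec (index_enum_uniq 'I_n).

Let term z u := theta_at p v gamma lambda (- exall n) (z - u) * theta_prod (index_enum 'I_n) u.

Lemma nexall_neq0 : - exall n != 0.
Proof.
rewrite oppr_eq0; apply/eqP => /rowP/(_ (Ordinal n_gt0)); by rewrite !mxE.
Qed.

(** The factors in x_1, ..., x_n need nonnegative exponents z_l + k, which forces k >= m(z). *)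
Let term_neq0 z u : term z u != 0 -> exists k, u = zshift z (mnat z + k)%N.
Proof.
rewrite mulf_eq0 negb_or => /andP[/theta_at_neq0[k kE] /enumP.2[h _]].
have uE : u = zshift z k.
  by rewrite /zshift -[LHS](subKr z) kE mulNrn opprK.
suff mk : (mnat z <= k)%N by exists (k - mnat z)%N; rewrite subnKC.
rewrite -lez_nat mnatE; apply: mpart_le => // l.
by have := h l (mem_index_enum _); rewrite uE zshiftE; lia.
Qed.

Let term_shift z k : term z (zshift z (mnat z + k)) = Fterm z (mnat z + k)%N.
Proof.
rewrite /term /Fterm {1}/zshift opprD addrA subrr add0r -mulNrn theta_at_mul ?nexall_neq0 //.
congr (_ * _); rewrite enumP.1.
- by apply: eq_bigr => l _; rewrite zshiftE.
- by move=> l _; rewrite zshiftE PoszD mnatE; have := mpart_ge z l; lia.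
- by move=> l; rewrite mem_index_enum.
Qed.

(** For k = 0 the powers of gamma add up to the degree w(z), and each unit of k adds one to all n +
    1 theta factors. *)
Lemma ordge_Fterm z k : ordge v ((wnat z + n.+1 * k)%:R * e) (Fterm z (mnat z + k)%N).
Proof.
have := ordgeM (ordgeM (ordge_th (mnat z + k)) (_ : ordge v 0 (lambda ^+ (mnat z + k))))
  (@ordge_prod _ _ _ v _ (index_enum 'I_n) xpredT (fun l => th (absz (z ord0 l + (mnat z + k)%N%:Z)))
     (fun l => (kexp z l + k)%:R * e) _).
move=> h; apply: ordgeW (h _ _) => {h}.
- rewrite addr0 -mulr_suml -mulrDl -natr_sum -natrD big_split /= sum_nat_const card_ord wnatE.
  suff -> : (\sum_l kexp z l + mnat z + n.+1 * k)%N = (mnat z + k + (\sum_l kexp z l + n * k))%N by [].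
  by rewrite mulSn; lia.
- by apply: ordgeX0; rewrite (ordge_fin _ lambda_ord).
- move=> l _; rewrite (_ : absz _ = (kexp z l + k)%N); first exact: ordge_th.
  by have := kexpE z l; rewrite -mnatE; lia.
Qed.

Lemma term_summable z : vsummable v (term z).
Proof.
move=> N; apply: sub_finite_set (finite_image (fun k => zshift z (mnat z + k)) (finite_II (N * p.-1))).
move=> u /= hu; have t0 : term z u != 0.
  by apply: contraTneq hu => ->; rewrite vord0.
have [k kE] := term_neq0 t0; exists k => //=.
move: hu; rewrite kE term_shift; apply: contraTT; rewrite -leqNgt -leNgt => h.
apply: ordgeW (ordge_Fterm z k).
rewrite ler_pdivlMr ?pm1_gt0 // -natrM ler_nat; nia.
Qed.

(** The term with k = m(z) is the only one not divisible by gamma^(w(z)+1). *)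
Lemma F_lambda_lead z :
  ordge v ((wnat z).+1%:R * e) (F_lambda p v gamma lambda z -
    ratr (AH_coef p (mnat z)) * lambda ^+ mnat z * \prod_l ratr (AH_coef p (kexp z l)) *
      gamma ^+ wnat z).
Proof.
have -> : ratr (AH_coef p (mnat z)) * lambda ^+ mnat z * \prod_l ratr (AH_coef p (kexp z l)) *
      gamma ^+ wnat z = \sum_(u <- [fset zshift z (mnat z)]%fset) term z u.
  rewrite big_seq_fset1 -{3}[mnat z]addn0 term_shift addn0 /Fterm wnatE addnC exprD {1}/theta_coef.
  under [X in _ = _ * X]eq_bigr => l _ do
    rewrite mnatE -[absz _]/(kexp z l) /theta_coef.
  by rewrite [X in _ = _ * X]big_split /= expr_sum mulrACA [X in X * _ = _]mulrAC.
apply: (vsum_approx QpP); first exact: term_summable.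
move=> u; rewrite in_fset1 => uz; rewrite -/(term z u).
have [->|t0] := eqVneq (term z u) 0; first exact: ordge0.
have [k kE] := term_neq0 t0; rewrite kE term_shift; apply: ordgeW (ordge_Fterm z k).
rewrite ler_pM2r ?e_gt0 // ler_nat.
case: k kE => [|k] kE; last lia.
by rewrite kE addn0 eqxx in uz.
Qed.

Lemma ordge_F_lambda z : ordge v ((wnat z)%:R * e) (F_lambda p v gamma lambda z).
Proof.
rewrite -[X in ordge _ _ X](subrK (ratr (AH_coef p (mnat z)) * lambda ^+ mnat z *
  \prod_l ratr (AH_coef p (kexp z l)) * gamma ^+ wnat z)).
apply: ordgeD.
  apply: ordgeW (F_lambda_lead z); by rewrite ler_pM2r ?e_gt0 // ler_nat.
apply: ordgeM0; last by rewrite (ordge_fin _ (ord_Xfin _ gamma_ord)).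
apply: ordgeM0; last first.
  by elim/big_ind: _ => [|x y|l _]; [exact: ordge1|exact: ordgeM0|exact: ordge_AH].
by apply: ordgeM0; [exact: ordge_AH|apply: ordgeX0; rewrite (ordge_fin _ lambda_ord)].
Qed.

Variable sigma : gal_of {:L}.
Hypothesis gamma_pow : ordge v e (gamma ^+ p.-1 / p%:R + 1).
Local Notation tau := (sigma^-1)%g.
Hypothesis tau_ord : forall x k, ordge v (k%:R * e) x -> ordge v (k%:R * e) (tau x).
Hypothesis tau_gamma : ordge v e (tau gamma / gamma - 1).

Lemma alpha1_eps i z : alpha1 p v gamma lambda sigma (eps gamma i) z =
  tau (F_lambda p v gamma lambda (z *+ p - exfirst n i) * gamma ^+ i).
Proof.
rewrite /alpha1 /psi /lmul; congr (tau _).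
rewrite (vsum1 QpP (i0 := exfirst n i)) ?/eps ?/mono ?eqxx // => u ui.
by rewrite (negbTE ui) mulr0.
Qed.

(* The coefficient of p^(w(z)) times the normalized monomial of x^z in alpha1 (eps i). *)
Definition frob_coef i z : L :=
  alpha1 p v gamma lambda sigma (eps gamma i) z / gamma ^+ wnat z / p%:R ^+ wnat z.

Let pE : v p%:R = 1%:E. Proof. exact: ord_p (val_ordP v). Qed.

(** As 1 + 1/(p-1) = p/(p-1), the product gamma p has the order of gamma^p. This turns the
    inequality p w(z) <= w(p z - u_i) + i into divisibility by p^(w(z)). *)
Let denE z : v (gamma ^+ wnat z * p%:R ^+ wnat z) = ((p * wnat z)%:R * e)%:E.
Proof.
rewrite (ord_Mfin (ord_Xfin _ gamma_ord) (ord_Xfin _ pE)); congr (_%:E).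
have pR : p%:R = p.-1%:R + 1 :> rat by rewrite natr1 prednK // prime_gt0.
rewrite natrM pR; field.
exact: lt0r_neq0 (pm1_gt0 p_prime).
Qed.

Let frob_coef_ge i z k : (p * wnat z + k <= wnat (z *+ p - exfirst n i) + i)%N ->
  ordge v (k%:R * e) (frob_coef i z).
Proof.
move=> h; rewrite /frob_coef -mulrA -invfM; apply: (ordge_divfin (denE z)).
rewrite -mulrDl -natrD alpha1_eps; apply: tau_ord.
have := ordgeM (ordge_F_lambda (z *+ p - exfirst n i)) (_ : ordge v (i%:R * e) (gamma ^+ i)).
rewrite -mulrDl -natrD => H; apply: ordgeW (H _).
  by rewrite ler_pM2r ?e_gt0 // ler_nat addnC.
by rewrite (ordge_fin _ (ord_Xfin _ gamma_ord)).
Qed.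

Lemma frob_coef_int i z : (i <= n)%N -> ordge v 0 (frob_coef i z).
Proof.
move=> le; rewrite -[0](mul0r e); apply: (@frob_coef_ge _ _ 0); rewrite addn0.
by apply: wnat_frob => //; apply: prime_gt0.
Qed.

Lemma frob_coef_small i z : (i <= n)%N -> (wnat z <= i)%N -> z != exfirst n i ->
  ordge v e (frob_coef i z).
Proof.
move=> le wz zi; rewrite -[e]mul1r; apply: (@frob_coef_ge _ _ 1); rewrite addn1.
rewrite ltn_neqAle wnat_frob ?prime_gt0 // andbT; apply: contraNneq zi => E.
by apply/eqP; apply: wnat_frob_eq E => //; apply: prime_gt0.
Qed.

Lemma AH_pred : ordge v e (ratr (AH_coef p p.-1) + 1).
Proof.
have p0 := prime_gt0 p_prime; have p1 := prime_gt1 p_prime.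
have c : coprime p (p.-1)`!.
  rewrite prime_coprime //; apply/negP => d; move: (Wilson p1).
  by rewrite p_prime -addn1 dvdn_addr // dvdn1 gtn_eqF.
have fE := ord_nat_coprime v c.
have f0 : (p.-1)`!%:R != 0 :> L by apply: ord_neq0 fE.
have E : ratr (AH_coef p p.-1) * (p.-1)`!%:R = 1 :> L.
  apply: (ratr_mulE v p_prime (z := 1)).
  rewrite AH_coef_small ?prednK // mulVf //.
  by rewrite pnatr_eq0 -lt0n fact_gt0.
rewrite -(ordge_mulfin _ _ fE) addr0 mulrDl E mul1r addrC natr1.
have : (p %| (p.-1)`!.+1)%N by rewrite -Wilson.
move=> /dvdnP[q ->]; rewrite natrM; apply: ordgeM0; first exact: ordge_nat.
by rewrite (ordge_fin _ pE) e_le1.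
Qed.

(** Here p u_i - u_i = (p-1) u_i is a product of powers x_l^(p-1), so the leading coefficient is a^i
    gamma^((p-1) i) with a = 1/(p-1)!. After multiplication by gamma^i, the inverse of sigma and
    normalization, it is the i-th power of a product of three factors congruent to -1, 1 and -1. *)
Lemma frob_coef_diag i : (i <= n)%N -> ordge v e (frob_coef i (exfirst n i) - 1).
Proof.
move=> le; set u := exfirst n i.
have wu : wnat u = i by apply: wnat_exfirst.
have uE : u *+ p - u = u *+ p.-1.
  by rewrite -{1}(prednK (prime_gt0 p_prime)) mulrSr addrK.
have upE l : (u *+ p.-1) ord0 l = (p.-1 * (l < i)%N)%N%:Z.
  by rewrite mulmxnE mxE natz -mulr_natl natz PoszM.
have mp : mpart (u *+ p.-1) = 0 by apply: mpart_nneg => l; rewrite upE.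
have mE : mnat (u *+ p.-1) = 0%N by rewrite /mnat mp.
have kE l : kexp (u *+ p.-1) l = (p.-1 * (l < i)%N)%N by rewrite /kexp mp addr0 upE.
have wE : wnat (u *+ p.-1) = (p.-1 * i)%N.
  rewrite wnatE mE addn0 -[in RHS](sum_ltn le) big_distrr; apply: eq_bigr => l _; exact: kE.
have a0 : ratr (AH_coef p 0) = 1 :> L.
  rewrite -[LHS]mulr1; apply: (ratr_mulE v p_prime (z := 1) (m := 1)).
  by rewrite AH_coef_small ?prime_gt0 // fact0 invr1.
set a := ratr (AH_coef p p.-1) : L.
have prodE : \prod_l ratr (AH_coef p (kexp (u *+ p.-1) l)) = a ^+ i :> L.
  rewrite -[in RHS](sum_ltn le) expr_sum; apply: eq_bigr => l _; rewrite kE.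
  by case: (_ < _)%N; rewrite ?muln1 ?expr1 // muln0 a0 expr0.
have := F_lambda_lead (u *+ p.-1); rewrite wE mE expr0 mulr1 prodE a0 mul1r.
set F := F_lambda _ _ _ _ _ => hF.
have gi : ordge v (i%:R * e) (gamma ^+ i) by rewrite (ordge_fin _ (ord_Xfin _ gamma_ord)).
have ipE : ((p.-1 * i).+1 + i)%N = (p * i + 1)%N.
  by rewrite -{2}(prednK (prime_gt0 p_prime)) mulSn; lia.
have hX : ordge v ((p * i + 1)%:R * e) (F * gamma ^+ i - a ^+ i * gamma ^+ (p * i)).
  have := ordgeM hF gi; rewrite -mulrDl -natrD ipE; congr ordge.
  by rewrite mulrBl -mulrA -exprD; congr (_ - _ * _ ^+ _); lia.
have := tau_ord hX; rewrite rmorphB !rmorphM !rmorphXn /= => hT.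
have D0 := denE u; rewrite wu in D0.
rewrite /frob_coef alpha1_eps uE -/F rmorphM rmorphXn /= wu -mulrA -invfM.
apply: (@ordge_trans _ _ _ v _ _ (tau a ^+ i * tau gamma ^+ (p * i) / (gamma ^+ i * p%:R ^+ i))).
  rewrite -mulrBl; apply: (ordge_divfin D0); apply: ordgeW hT.
  by rewrite natrD mulrDl mul1r addrC.
pose B := tau gamma / gamma; pose C := gamma ^+ p.-1 / p%:R.
have g0 := ord_neq0 gamma_ord; have p0 := ord_neq0 pE.
have -> : tau a ^+ i * tau gamma ^+ (p * i) / (gamma ^+ i * p%:R ^+ i) = (tau a * B ^+ p * C) ^+ i.
  have piE : gamma ^+ (p * i) = gamma ^+ i * gamma ^+ (p.-1 * i).
    by rewrite -exprD -{1}(prednK (prime_gt0 p_prime)) mulSn.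
  rewrite /B /C !exprMn !exprVn -!exprM piE.
  have := expf_neq0 (p.-1 * i) g0; have := expf_neq0 i g0; have := expf_neq0 i p0.
  by move=> h1 h2 h3; field; rewrite h1 h2 h3.
have hA : ordge v e (tau a - (-1)).
  have := tau_ord (k := 1) (x := a + 1); rewrite mul1r => /(_ AH_pred).
  by rewrite rmorphD rmorph1 opprK.
have hC : ordge v e (C - (-1)) by rewrite opprK.
have m1 : ordge v 0 (-1) by rewrite ordgeN ordge1.
have e0 := ltW (e_gt0 p_prime).
have A0 := ordge_cong0 e0 hA m1; have C0 := ordge_cong0 e0 hC m1.
have B0 := ordge_cong0 e0 tau_gamma (ordge1 v).
have hB : ordge v e (B ^+ p - 1).
  by rewrite -[X in _ - X](expr1n _ p); apply: ordge_congX => //; exact: ordge1.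
rewrite -[X in _ - X](expr1n _ i); apply: ordge_congX; last first.
- rewrite -[X in _ - X](_ : (-1) * 1 * (-1) = 1); last by ring.
  apply: ordge_congM => //; first by apply: ordgeM0 => //; apply: ordgeX0.
  by apply: ordge_congM => //; exact: ordge1.
- exact: ordge1.
- exact: (ordgeM0 (ordgeM0 A0 (ordgeX0 p B0)) C0).
Qed.
End Theta.

(** * The operators H *)

Section Gamma.
Variables (p n : nat) (Qp : fieldType) (L : splittingFieldType Qp).
Variable v : valuation p L.
Hypotheses (p_prime : prime p) (QpP : is_Qp v).
Local Notation e := ((p.-1)%:R^-1 : rat).
Variables (gamma lambda : L).
Hypotheses (gamma_ord : v gamma = e%:E) (lambda_ord : v lambda = 0%E).
Hypothesis gamma_zero : has_vsum v (fun j : nat => gamma ^+ (p ^ j) / (p ^ j)%N%:R) 0.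
Implicit Types (u z : 'rV[int]_n).

Lemma fset_initial (f : nat -> L) m : exists A : {fset nat},
  (forall i, (i \in A) = (i < m)%N) /\ \sum_(i <- A) f i = \sum_(i < m) f i.
Proof.
elim: m => [|m [A [hA sA]]].
  by exists fset0; split=> [i|]; rewrite ?inE // big_nil big_ord0.
exists (m |` A)%fset; split=> [i|]; first by rewrite !inE hA [RHS]ltnS [RHS]leq_eqVlt.
by rewrite big_fsetU1 ?hA ?ltnn //= sA big_ord_recr /= addrC.
Qed.

Let pR : p%:R = p.-1%:R + 1 :> rat.
Proof. by rewrite natr1 prednK // prime_gt0. Qed.

Let em : e * p.-1%:R = 1. Proof. by rewrite mulVf // lt0r_neq0 // pm1_gt0. Qed.

Lemma gamma_exp_mono m i : (m <= i)%N ->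
  (p ^ m)%N%:R * e - m%:R <= (p ^ i)%N%:R * e - i%:R.
Proof.
elim: i => [|i IH]; first by rewrite leqn0 => /eqP ->.
rewrite leq_eqVlt => /orP[/eqP -> //|/IH h]; apply: le_trans h _.
have p1 : 1 <= (p ^ i)%N%:R :> rat by rewrite ler1n expn_gt0 prime_gt0.
rewrite expnS natrM pR -natr1.
have -> : (p.-1%:R + 1) * (p ^ i)%N%:R * e = (p ^ i)%N%:R * (e * p.-1%:R) + (p ^ i)%N%:R * e by ring.
by rewrite em; lra.
Qed.

(** Since the full series vanishes at gamma, [gamma_ m] is minus its tail, and the orders of the
    terms do not decrease. *)
Lemma ordge_gamma_ m : ordge v ((p ^ m.+1)%N%:R * e - m.+1%:R) (gamma_ p gamma m).
Proof.
have [A [hA sA]] := fset_initial (fun j => gamma ^+ (p ^ j) / (p ^ j)%N%:R) m.+1.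
have := @has_vsum_approx _ _ _ _ _ _ _ A ((p ^ m.+1)%N%:R * e - m.+1%:R) gamma_zero.
rewrite sub0r ordgeN sA; apply => i.
rewrite hA -leqNgt => mi.
rewrite (ordge_fin _ (ord_Mfin (ord_Xfin _ gamma_ord) (ord_Vfin (ord_natp v i)))).
exact: gamma_exp_mono.
Qed.

(* H(X_l) is the sum of the hcoef m * X_l^(p^m), where X_l = gamma x_l. *)
Definition hcoef m : L := p%:R ^+ m * gamma_ p gamma m / gamma ^+ (p ^ m).

Lemma hcoefE m : p%:R ^+ m * gamma_ p gamma m = hcoef m * gamma ^+ (p ^ m).
Proof. by rewrite /hcoef divfK // expf_neq0 // (ord_neq0 gamma_ord). Qed.

(** The exponent is m + (p^(m+1)/(p-1) - (m+1)) - p^m/(p-1) = p^m - 1. *)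
Lemma ordge_hcoef m : ordge v ((p ^ m)%N%:R - 1) (hcoef m).
Proof.
apply: (ordge_divfin (ord_Xfin _ gamma_ord)).
have := ordgeM (_ : ordge v m%:R (p%:R ^+ m)) (ordge_gamma_ m).
rewrite -natrX (ordge_fin _ (ord_natp v m)) lexx => /(_ isT); apply: ordgeW.
rewrite expnS natrM pR -natr1.
have -> : (p.-1%:R + 1) * (p ^ m)%N%:R * e = (p ^ m)%N%:R * (e * p.-1%:R) + (p ^ m)%N%:R * e by ring.
by rewrite em; lra.
Qed.

Lemma hcoef0 : hcoef 0 = 1.
Proof.
rewrite /hcoef /gamma_ big_ord_recl big_ord0 /= expr0 expn0 expr1 divr1 addr0 mul1r divff //.
exact: (ord_neq0 gamma_ord).
Qed.

(** The left side is [gamma_ 1] divided by gamma, whose order is at least p^2/(p-1) - 2 - 1/(p-1) =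
    p - 1. *)
Lemma gamma_pow : ordge v e (gamma ^+ p.-1 / p%:R + 1).
Proof.
have g0 := ord_neq0 gamma_ord.
have -> : gamma ^+ p.-1 / p%:R + 1 = gamma_ p gamma 1 / gamma.
  rewrite /gamma_ !big_ord_recl big_ord0 /= expn0 expn1 divr1 addr0 expr1.
  rewrite -{3}(prednK (prime_gt0 p_prime)) exprS.
  by field; rewrite g0 (ord_neq0 (ord_p (val_ordP v))).
apply: (ordge_divfin gamma_ord); apply: ordgeW (ordge_gamma_ 1).
rewrite expnS expn1 natrM pR.
have -> : (p.-1%:R + 1) * (p.-1%:R + 1) * e = (p.-1%:R + 2) * (e * p.-1%:R) + e by ring.
rewrite em; have := e_le1 p_prime; have p1 : 1 <= p.-1%:R :> rat.
  by rewrite ler1n -ltnS prednK ?prime_gt1 // prime_gt0.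
lra.
Qed.

Lemma wnat_rep z (k : 'I_n -> nat) (k0 : nat) : (forall l, z ord0 l = (k l)%:Z - k0%:Z) ->
  exists r, [/\ (\sum_l k l + k0 = wnat z + n.+1 * r)%N, k0 = (mnat z + r)%N &
    forall l, k l = (kexp z l + r)%N].
Proof.
move=> h; have [r [k0E kE]] := kexp_rep h; exists r; split=> //.
rewrite k0E wnatE (eq_bigr (fun l => kexp z l + r)%N); last by move=> l _; rewrite kE.
by rewrite big_split /= sum_nat_const card_ord mulSn; lia.
Qed.

Lemma rep_ex u l k j :
  (u + ex l *+ k) ord0 j = (kexp u j + (j == l) * k)%N%:Z - (mnat u)%:Z.
Proof.
rewrite mxE ex_mulE PoszD kexpE mnatE.
by case: (j == l); rewrite ?mul1n ?mul0n; ring.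
Qed.

Lemma rep_exall u k j :
  (u - exall n *+ k) ord0 j = (kexp u j)%:Z - (mnat u + k)%N%:Z.
Proof. by rewrite mxE [X in _ + X]mxE exall_mulE PoszD kexpE mnatE; ring. Qed.

Lemma sum_ex u l k : (\sum_j (kexp u j + (j == l) * k) + mnat u = wnat u + k)%N.
Proof.
rewrite big_split /= wnatE -big_distrl /= [X in (_ + X * _ + _)%N](_ : _ = 1%N) ?mul1n.
  by rewrite addnAC.
by rewrite (bigD1 l) //= eqxx big1 // => j /negbTE ->.
Qed.

Lemma wnat_ex u l k : (wnat (u + ex l *+ k) <= wnat u + k)%N.
Proof.
have [r [E _ _]] := wnat_rep (rep_ex u l k); rewrite sum_ex in E.
by rewrite E leq_addr.
Qed.

Lemma wnat_exall u k : (wnat (u - exall n *+ k) <= wnat u + k)%N.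
Proof.
have [r [E _ _]] := wnat_rep (rep_exall u k).
by rewrite (wnatE u) -addnA E leq_addr.
Qed.

Definition hterm (l : 'I_n) m z : L := p%:R ^+ m * gamma_ p gamma m *
  (mono 1 (ex l *+ (p ^ m)) z - mono (lambda ^+ (p ^ m)) (- (exall n *+ (p ^ m))) z).

(** Multiplication by a p^m-th power of X_l or Y raises the weight by at most p^m, which the factor
    gamma^(p^m) pays for. *)
Lemma ordge_hterm l m z u :
  ordge v ((p ^ m)%N%:R - 1 + (wnat z)%:R * e - (wnat u)%:R * e) (hterm l m (z - u)).
Proof.
rewrite /hterm hcoefE -mulrA.
have -> : (p ^ m)%N%:R - 1 + (wnat z)%:R * e - (wnat u)%:R * e =
  ((p ^ m)%N%:R - 1) + ((wnat z)%:R - (wnat u)%:R) * e by ring.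
apply: ordgeM; first exact: ordge_hcoef.
rewrite mulrBr.
have main (c : L) y : ordge v 0 c -> (wnat (u + y) <= wnat u + p ^ m)%N ->
  ordge v (((wnat z)%:R - (wnat u)%:R) * e) (gamma ^+ (p ^ m) * mono c y (z - u)).
  move=> hc hw; rewrite /mono; case: eqP => [E|_]; last by rewrite mulr0 ordge0.
  have zE : z = u + y by rewrite -E addrC subrK.
  rewrite [gamma ^+ _ * c]mulrC; apply: ordgeM0 => //; rewrite (ordge_fin _ (ord_Xfin _ gamma_ord)).
  rewrite ler_pM2r ?e_gt0 // lerBlDl -natrD ler_nat zE //.
apply: ordgeB; apply: main.
- exact: ordge1.
- exact: wnat_ex.
- by apply: ordgeX0; rewrite (ordge_fin _ lambda_ord).
- exact: wnat_exall.
Qed.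

(** For m >= N one has p^m - 1 >= N, so in normalized monomials H can be cut after N terms modulo
    p^N. *)
Lemma Hser_approx N l z u :
  ordge v (N%:R + (wnat z)%:R * e)
    ((Hser p v gamma lambda l (z - u) - \sum_(m < N) hterm l m (z - u)) * gamma ^+ wnat u).
Proof.
rewrite -[X in ordge _ X](subrK ((wnat u)%:R * e)) (ordge_mulfin _ _ (ord_Xfin _ gamma_ord)).
have [A [hA sA]] := fset_initial (fun m => hterm l m (z - u)) N.
rewrite -sA; apply: (vsum_approx QpP).
  have [B [hB _]] := fset_initial (fun m => hterm l m (z - u)) (absz ((z - u)%R ord0 l)).
  apply: (@vsummable_fin _ _ _ v _ _ B) => m; rewrite hB -leqNgt => hm.
  have pm : (m < p ^ m)%N by apply: ltn_expl; apply: prime_gt1.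
  rewrite /hterm /mono; case: eqP => [E|_].
    by move: hm; rewrite E ex_mulE eqxx /=; lia.
  case: eqP => [E|_]; last by rewrite subrr mulr0.
  by move: hm; rewrite E mxE exall_mulE /=; lia.
move=> m; rewrite hA -leqNgt => Nm; apply: ordgeW (ordge_hterm l m z u).
rewrite lerD2r lerD2r.
have pm : (m < p ^ m)%N by apply: ltn_expl; apply: prime_gt1.
have : (N.+1 <= p ^ m)%N by apply: leq_ltn_trans pm.
by rewrite -(ler_nat rat) -natr1; lra.
Qed.

End Gamma.

(** * Polynomials with growth conditions *)

Section PolyBounds.
Variables (p : nat) (Qp : fieldType) (L : splittingFieldType Qp).
Variable v : valuation p L.
Implicit Types (c d s : rat) (f g x y : {poly L}) (a b : L).

(* For s = 0 and c = 0 the coefficients are integral in X, for s = 1 and c = 0 they are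
   integral in p X. *)
Definition pbd c s f := forall k : nat, ordge v (c + s * k%:R) f`_k.

Lemma pbd_0 c s : pbd c s 0.
Proof. by move=> k; rewrite coef0 ordge0. Qed.

Lemma pbdD c s f g : pbd c s f -> pbd c s g -> pbd c s (f + g).
Proof. by move=> hf hg k; rewrite coefD ordgeD. Qed.

Lemma pbdN c s f : pbd c s f -> pbd c s (- f).
Proof. by move=> hf k; rewrite coefN ordgeN. Qed.

Lemma pbdB c s f g : pbd c s f -> pbd c s g -> pbd c s (f - g).
Proof. by move=> hf hg; apply: pbdD => //; apply: pbdN. Qed.

Lemma pbdBC c s f g : pbd c s (f - g) -> pbd c s (g - f).
Proof. by move=> /pbdN; rewrite opprB. Qed.

Lemma pbd_sum (I : Type) (r : seq I) (P : pred I) (F : I -> {poly L}) c s :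
  (forall i, P i -> pbd c s (F i)) -> pbd c s (\sum_(i <- r | P i) F i).
Proof. by move=> h; elim/big_ind: _ => //; [exact: pbd_0|exact: pbdD]. Qed.

Lemma pbd_sumS (I : eqType) (r : seq I) (F : I -> {poly L}) c s :
  (forall i, i \in r -> pbd c s (F i)) -> pbd c s (\sum_(i <- r) F i).
Proof. by move=> h; rewrite big_seq; apply: pbd_sum. Qed.

Lemma pbdM c d s f g : pbd c s f -> pbd d s g -> pbd (c + d) s (f * g).
Proof.
move=> hf hg k; rewrite coefM; apply: ordge_sum => i _.
have := ordgeM (hf i) (hg (k - i)%N); apply: ordgeW.
have ik : (i <= k)%N by rewrite -ltnS.
by rewrite natrB //; lra.
Qed.

Lemma pbdW c d s f : d <= c -> pbd c s f -> pbd d s f.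
Proof. by move=> dc h k; apply: ordgeW (h k); lra. Qed.

Lemma pbdWs c s f : 0 <= s -> pbd c s f -> pbd c 0 f.
Proof.
move=> s0 h k; apply: ordgeW (h k); rewrite mul0r addr0.
by rewrite lerDl mulr_ge0.
Qed.

Lemma pbdM0 c s f g : pbd 0 s f -> pbd c s g -> pbd c s (f * g).
Proof. by move=> hf hg; have := pbdM hf hg; rewrite add0r. Qed.

Lemma pbd_polyC c s a : ordge v c a -> pbd c s a%:P.
Proof.
move=> h k; rewrite coefC; case: eqP => [->|_]; last exact: ordge0.
by rewrite mulr0 addr0.
Qed.

Lemma pbd1 s : pbd 0 s 1.
Proof. by rewrite -polyC1; apply: pbd_polyC; exact: ordge1. Qed.

Lemma pbdZ c d s a f : ordge v c a -> pbd d s f -> pbd (c + d) s (a *: f).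
Proof. by move=> ha hf; rewrite -mul_polyC; apply: pbdM => //; apply: pbd_polyC. Qed.

Lemma pbdZ0 c s a f : ordge v 0 a -> pbd c s f -> pbd c s (a *: f).
Proof. by move=> ha hf; have := pbdZ ha hf; rewrite add0r. Qed.

Lemma pbdZ0r c s a f : ordge v c a -> pbd 0 s f -> pbd c s (a *: f).
Proof. by move=> ha hf; have := pbdZ ha hf; rewrite addr0. Qed.

Lemma pbdX s : pbd (- s) s 'X.
Proof.
move=> k; rewrite coefX; case: eqP => [->|_]; last exact: ordge0.
by rewrite mulr1 addNr ordge1.
Qed.

Lemma pbd_prod (I : Type) (r : seq I) (P : pred I) (F : I -> {poly L}) (c : I -> rat) s :
  (forall i, P i -> pbd (c i) s (F i)) ->
  pbd (\sum_(i <- r | P i) c i) s (\prod_(i <- r | P i) F i).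
Proof.
move=> h; elim/big_rec2: _ => [|i y1 y2 Pi IH]; first exact: pbd1.
by apply: pbdM => //; apply: h.
Qed.

Lemma pbd_prod0 (I : Type) (r : seq I) (P : pred I) (F : I -> {poly L}) s :
  (forall i, P i -> pbd 0 s (F i)) -> pbd 0 s (\prod_(i <- r | P i) F i).
Proof.
move=> h; elim/big_ind: _ => [|f g|//]; [exact: pbd1|exact: pbdM0].
Qed.

Lemma pbd_exp c s f k : pbd c s f -> pbd (k%:R * c) s (f ^+ k).
Proof.
move=> h; elim: k => [|k IH]; first by rewrite expr0 mul0r; exact: pbd1.
by rewrite exprS -natr1 mulrDl mul1r addrC; apply: pbdM.
Qed.

Lemma pbd_exp0 s f k : pbd 0 s f -> pbd 0 s (f ^+ k).
Proof. by move/(@pbd_exp _ _ _ k); rewrite mulr0. Qed.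

Lemma pbd_congM c s f f' g g' : pbd 0 s f -> pbd 0 s g' ->
  pbd c s (f - f') -> pbd c s (g - g') -> pbd c s (f * g - f' * g').
Proof.
move=> hf hg' h1 h2.
rewrite (_ : _ - _ = f * (g - g') + g' * (f - f')); last by ring.
by apply: pbdD; apply: pbdM0.
Qed.

Lemma pbd_congX c s f g k : pbd 0 s f -> pbd 0 s g -> pbd c s (f - g) ->
  pbd c s (f ^+ k - g ^+ k).
Proof.
move=> hf hg h; elim: k => [|k IH]; first by rewrite subrr; exact: pbd_0.
by rewrite !exprS; apply: pbd_congM => //; apply: pbd_exp0.
Qed.

Lemma pbd_cong_prod (I : Type) (r : seq I) (F G : I -> {poly L}) c s :
  (forall i, pbd 0 s (F i)) -> (forall i, pbd 0 s (G i)) ->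
  (forall i, pbd c s (F i - G i)) ->
  pbd c s (\prod_(i <- r) F i - \prod_(i <- r) G i).
Proof.
move=> hF hG h; elim: r => [|i r IH]; first by rewrite !big_nil subrr; exact: pbd_0.
by rewrite !big_cons; apply: pbd_congM => //; apply: pbd_prod0.
Qed.

Definition shift a f := f \Po ('X + a%:P).

Lemma shiftD a f g : shift a (f + g) = shift a f + shift a g.
Proof. exact: comp_polyD. Qed.

Lemma shiftB a f g : shift a (f - g) = shift a f - shift a g.
Proof. exact: comp_polyB. Qed.

Lemma shiftM a f g : shift a (f * g) = shift a f * shift a g.
Proof. exact: comp_polyM. Qed.

Lemma shiftZ a b f : shift a (b *: f) = b *: shift a f.
Proof. exact: comp_polyZ. Qed.

Lemma shiftX a : shift a 'X = 'X + a%:P.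
Proof. exact: comp_polyX. Qed.

Lemma shift_sum a (I : Type) (r : seq I) (P : pred I) (F : I -> {poly L}) :
  shift a (\sum_(i <- r | P i) F i) = \sum_(i <- r | P i) shift a (F i).
Proof. exact: raddf_sum. Qed.

Lemma shift_prod a (I : Type) (r : seq I) (P : pred I) (F : I -> {poly L}) :
  shift a (\prod_(i <- r | P i) F i) = \prod_(i <- r | P i) shift a (F i).
Proof. exact: rmorph_prod. Qed.

Lemma shift0 f : shift 0 f = f.
Proof. by rewrite /shift addr0 comp_polyXr. Qed.

Lemma shift_shift a b f : shift a (shift b f) = shift (a + b) f.
Proof.
rewrite /shift -comp_polyA comp_polyD comp_polyX comp_polyC polyCD addrA //.
Qed.

Lemma shiftE a f : shift a f = \sum_(i < size f) f`_i *: ('X + a%:P) ^+ i.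
Proof. by rewrite /shift comp_polyE. Qed.

Let pbdXa s a : 0 <= s -> ordge v 0 a -> pbd (- s) s ('X + a%:P).
Proof.
move=> s0 ha; apply: pbdD; first exact: pbdX.
by apply: pbd_polyC; apply: ordgeW ha; rewrite oppr_le0.
Qed.

Lemma pbd_shift c s a f : 0 <= s -> ordge v 0 a -> pbd c s f -> pbd c s (shift a f).
Proof.
move=> s0 ha hf; rewrite shiftE; apply: pbd_sum => i _.
have := pbdZ (hf i) (pbd_exp i (pbdXa s0 ha)); congr pbd; ring.
Qed.

(** In the variable p T the shift is a translation by p a, which is trivial modulo p. *)
Lemma pbd_shift_diff c a f : ordge v 0 a -> pbd c 1 f -> pbd (c + 1) 1 (shift a f - f).
Proof.
move=> ha hf; have fE : f = \sum_(i < size f) f`_i *: 'X^i by rewrite -poly_def coefK.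
rewrite shiftE [X in _ - X]fE -sumrB; apply: pbd_sum => i _.
rewrite -scalerBr.
have hX : pbd (- 1) 1 ('X + a%:P) by apply: pbdXa.
have h : pbd (1 - i%:R) 1 (('X + a%:P) ^+ i - 'X^i).
  rewrite subrXX [X in X * _](_ : _ = a%:P); last by rewrite addrC addKr.
  apply: pbdW (pbdM (pbd_polyC 1 ha) (_ : pbd (1 - i%:R) 1 _)); first by rewrite add0r.
  apply: pbd_sum => j _.
  apply: pbdW (pbdM (pbd_exp _ hX) (pbd_exp _ (pbdX 1))).
  have ji := ltn_ord j.
  have -> : (i.-1 - j)%N%:R = i%:R - 1 - j%:R :> rat.
    have E : (i : nat) = ((i.-1 - j) + 1 + j)%N by lia.
    by have := congr1 (GRing.natmul (1 : rat)) E; rewrite !natrD; lra.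
  lra.
have := pbdZ (hf i) h; apply: pbdW; lra.
Qed.

(* X^k 1 in the coordinate T, if multiplication by X is f(T) |-> x(T) f(T - 1). *)
Definition brk x k : {poly L} := \prod_(i < k) shift (- i%:R) x.

Lemma brk0 x : brk x 0 = 1. Proof. exact: big_ord0. Qed.

Lemma brk1 x : brk x 1 = x.
Proof. by rewrite /brk big_ord_recl big_ord0 mulr1 oppr0 shift0. Qed.

(** This is X^(k+j) 1 = X^k (X^j 1). *)
Lemma brkD x k j : brk x (k + j) = brk x k * shift (- k%:R) (brk x j).
Proof.
rewrite /brk big_split_ord /= shift_prod; congr (_ * _); apply: eq_bigr => i _.
by rewrite shift_shift natrD opprD.
Qed.

Lemma brkS x k : brk x k.+1 = x * shift (-1) (brk x k).
Proof. by rewrite -add1n brkD brk1. Qed.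

Lemma ordgeNn k : ordge v 0 (- k%:R).
Proof. by rewrite ordgeN ordge_nat. Qed.

Lemma pbd_brk c s x k : 0 <= s -> pbd c s x -> pbd (k%:R * c) s (brk x k).
Proof.
move=> s0 hx; rewrite -{1}[k]card_ord mulr_natl -sumr_const.
by apply: pbd_prod => i _; apply: pbd_shift => //; apply: ordgeNn.
Qed.

Lemma pbd_brk0 s x k : 0 <= s -> pbd 0 s x -> pbd 0 s (brk x k).
Proof. by move=> s0 /(pbd_brk k s0); rewrite mulr0. Qed.

Lemma pbd_brk_cong c x y k : pbd 0 0 x -> pbd 0 0 y -> pbd c 0 (x - y) ->
  pbd c 0 (brk x k - brk y k).
Proof.
move=> hx hy h; apply: pbd_cong_prod => i; rewrite -?shiftB; apply: pbd_shift => //; exact: ordgeNn.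
Qed.

End PolyBounds.

(** * Division modulo J *)

Section Solution.
Variables (p : nat) (Qp : fieldType) (L : splittingFieldType Qp).
Variable v : valuation p L.
Hypothesis p_prime : prime p.
Local Notation e := ((p.-1)%:R^-1 : rat).
Implicit Types (f g x y a m : {poly L}).

Variables (h : nat -> L) (N : nat).
Hypotheses (h_ord : forall k, ordge v ((p ^ k)%N%:R - 1) (h k)) (h0 : h 0 = 1).
Hypothesis N_gt0 : (0 < N)%N.

Let e0 : 0 <= e. Proof. exact: ltW (e_gt0 p_prime). Qed.

Let pE : v p%:R = 1%:E. Proof. exact: ord_p (val_ordP v). Qed.

Let p_int : ordge v 1 p%:R. Proof. by rewrite (ordge_fin _ pE). Qed.

Let pexp_gt k : (0 < k)%N -> 2 <= (p ^ k)%N%:R :> rat.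
Proof.
move=> k0; rewrite (ler_nat _ 2); apply: leq_trans (prime_gt1 p_prime) _.
by rewrite -{1}(expn1 p) leq_exp2l // prime_gt1.
Qed.

Let h_int k : ordge v 0 (h k).
Proof. by apply: ordgeW (h_ord k); rewrite subr_ge0 ler1n expn_gt0 prime_gt0. Qed.

Let h_e k : (0 < k)%N -> ordge v e (h k).
Proof.
move=> /pexp_gt k0; apply: ordgeW (h_ord k); have := e_le1 p_prime; lra.
Qed.

Definition xstep x : {poly L} := 'X - \sum_(1 <= k < N) h k *: brk x (p ^ k).
Definition xiter r : {poly L} := iter r xstep 'X.

Let range_gt0 k : k \in index_iota 1 N -> (0 < k)%N.
Proof. by rewrite mem_index_iota => /andP[]. Qed.

Lemma pbd_xiter0 r : pbd v 0 0 (xiter r).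
Proof.
elim: r => [|r IH]; first by have := pbdX v 0; rewrite oppr0.
apply: pbdB; first by have := pbdX v 0; rewrite oppr0.
by apply: pbd_sum => k _; apply: pbdZ0 => //; apply: pbd_brk0.
Qed.

(** The bound is stable under iteration because the orders balance: p^k - 1 from h_k and -1 from
    each of p^k factors leave -1. *)
Lemma pbd_xiter1 r : pbd v (-1) 1 (xiter r).
Proof.
elim: r => [|r IH]; first exact: pbdX.
apply: pbdB; first exact: pbdX.
apply: pbd_sum => k _; have := pbdZ (h_ord k) (pbd_brk (p ^ k) ler01 IH).
apply: pbdW; lra.
Qed.

Lemma xiter_cong r : pbd v e 0 (xiter r - 'X).
Proof.
case: r => [|r]; first by rewrite subrr; exact: pbd_0.
rewrite /xiter iterS /xstep addrC addKr; apply: pbdN; apply: pbd_sumS => k /range_gt0 k0.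
by apply: pbdZ0r; [exact: h_e|apply: pbd_brk0 => //; apply: pbd_xiter0].
Qed.

Lemma xiter_contract r : pbd v (r%:R * e) 0 (xiter r.+1 - xiter r).
Proof.
elim: r => [|r IH]; first by rewrite mul0r; apply: pbdB; apply: pbd_xiter0.
rewrite [xiter r.+2]/(xstep (xiter r.+1)) [X in _ - X]/(xstep (xiter r)) /xstep.
rewrite opprB addrC addrA subrK -sumrB; apply: pbd_sumS => k /range_gt0 k0.
rewrite -scalerBr -natr1 mulrDl mul1r addrC; apply: pbdZ; first exact: h_e.
by apply: pbd_brk_cong; [exact: pbd_xiter0|exact: pbd_xiter0|apply: pbdBC].
Qed.

Lemma xiter_coef0 r : (xiter r)`_0 = 0.
Proof.
elim: r => [|r IH]; first by rewrite coefX.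
rewrite coefB coefX coef_sum big1_seq ?subr0 // => k /andP[_ /range_gt0 k0].
have [j ->] : exists j, (p ^ k)%N = j.+1.
  by exists (p ^ k).-1; rewrite prednK // expn_gt0 prime_gt0.
by rewrite coefZ brkS coef0M IH mul0r mulr0.
Qed.

(* The fixed-point iteration solves T = \sum_k h_k x(T) ... x(T - p^k + 1) modulo p^N
   because h_k is divisible by gamma for k > 0. *)
Definition xsol := xiter (N * p.-1).

Lemma Ne : (N * p.-1)%:R * e = N%:R.
Proof. by rewrite natrM mulfK // lt0r_neq0 // pm1_gt0. Qed.

Lemma xsol_eq : pbd v N%:R 0 ('X - \sum_(k < N) h k *: brk xsol (p ^ k)).
Proof.
have := xiter_contract (N * p.-1); rewrite Ne.
rewrite [xiter _.+1]/(xstep xsol) /xstep -addrA -opprD -(big_mkord xpredT (fun k => h k *: brk xsol (p ^ k))).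
by rewrite big_ltn // h0 scale1r expn0 brk1 [X in _ -> pbd _ _ _ (_ - X)]addrC.
Qed.

(** Membership in the ideal generated by (p T)^2 and gamma among series integral in p T. *)
Let hi f := exists a b, [/\ pbd v 0 1 a, pbd v e 1 b & f = (p%:R *: 'X) ^+ 2 * a + b].

Let hiD f g : hi f -> hi g -> hi (f + g).
Proof.
move=> [a [b [ha hb ->]]] [a' [b' [ha' hb' ->]]]; exists (a + a'), (b + b').
by split; [exact: pbdD|exact: pbdD|ring].
Qed.

Let hiM f g : pbd v 0 1 f -> hi g -> hi (f * g).
Proof.
move=> hf [a [b [ha hb ->]]]; exists (f * a), (f * b).
by split; [exact: pbdM0|exact: pbdM0|ring].
Qed.

Let hi0 : hi 0.
Proof. by exists 0, 0; split; rewrite ?mulr0 ?addr0 //; exact: pbd_0. Qed.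

Let pX_pbd : pbd v 0 1 (p%:R *: 'X : {poly L}).
Proof. by have := pbdZ p_int (pbdX v 1); rewrite subrr. Qed.

Lemma pbd_pxiter r : pbd v 0 1 (p%:R *: xiter r).
Proof. by have := pbdZ p_int (pbd_xiter1 r); rewrite subrr. Qed.

Let pxiter_div r : exists2 a, pbd v 0 1 a & p%:R *: xiter r = p%:R *: 'X * a.
Proof.
have xE : xiter r = 'X * \poly_(i < size (xiter r)) (xiter r)`_i.+1.
  apply/polyP => -[|i]; rewrite coefXM /= ?xiter_coef0 // coef_poly.
  by case: ltnP => // si; rewrite nth_default // ltnW.
exists (\poly_(i < size (xiter r)) (xiter r)`_i.+1); last by rewrite {1}xE scalerAl.
move=> i; rewrite coef_poly; case: ifP => _; last exact: ordge0.
by have := pbd_xiter1 r i.+1; rewrite -natr1 => H; apply: ordgeW H; lra.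
Qed.

(** Two of the factors are p x(T) and p x(T - 1), which agree modulo p, and p x is a multiple of p T
    because x(0) = 0. *)
Let hi_brk r k : (2 <= k)%N -> hi (p%:R ^+ k *: brk (xiter r) k).
Proof.
case: k => [|[|k]] // _; rewrite /brk !big_ord_recl !exprS /=.
set P := \prod_(i < k) _.
have hP : pbd v 0 1 (p%:R ^+ k *: P).
  have := pbdZ (ordgeX k p_int) (@pbd_prod _ _ _ v _ (index_enum 'I_k) xpredT
    (fun i => shift (- (lift ord0 (lift ord0 i))%:R) (xiter r)) (fun=> -1) 1 _).
  rewrite sumr_const card_ord mulr1 mulNrn subrr; apply => i _.
  by apply: pbd_shift => //; [exact: ordgeNn|exact: pbd_xiter1].
rewrite oppr0 shift0; set y := xiter r; set y' := shift _ y.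
rewrite (_ : _ *: _ = (p%:R ^+ k *: P) * ((p%:R *: y) * (p%:R *: y'))); last first.
  by rewrite -!mul_polyC !polyCM; ring.
apply: hiM => //; have [a ha aE] := pxiter_div r; rewrite -/y in aE.
have hg : pbd v 1 1 (p%:R *: y' - p%:R *: y).
  rewrite -scalerBr -[X in pbd v X](addr0 1); apply: pbdZ => //.
  rewrite -[X in pbd v X](addNr 1); apply: pbd_shift_diff; last exact: pbd_xiter1.
  exact: ordgeNn.
exists (a * a), ((p%:R *: y) * (p%:R *: y' - p%:R *: y)); split.
- exact: pbdM0.
- by apply: pbdW (e_le1 p_prime) _; apply: pbdM0 => //; apply: pbd_pxiter.
- have -> : (p%:R *: 'X) ^+ 2 * (a * a) = (p%:R *: y) * (p%:R *: y) by rewrite aE; ring.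
  by ring.
Qed.

(** Each correction is p h_k / p^(p^k), of order at least 0, times p^(p^k) x(T) ... x(T - p^k + 1),
    with p^k >= 2 factors. *)
Lemma pxsol_lead : exists a b, [/\ pbd v 0 1 a, pbd v e 1 b &
  p%:R *: xsol = p%:R *: 'X + (p%:R *: 'X) ^+ 2 * a + b].
Proof.
suff [a [b [ha hb E]]] : hi (p%:R *: xsol - p%:R *: 'X).
  by exists a, b; split=> //; rewrite -addrA -E addrC subrK.
rewrite -scalerBr /xsol; case: (N * p.-1)%N => [|r]; first by rewrite subrr scaler0.
rewrite /xiter iterS -/(xiter r) /xstep addrC addKr -sumrN scaler_sumr.
rewrite big_seq; elim/big_ind: _ => // k /range_gt0 k0.
have p0 := ord_neq0 pE; have pk0 : p%:R ^+ (p ^ k) != 0 :> L by rewrite expf_neq0.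
have -> : p%:R *: - (h k *: brk (xiter r) (p ^ k)) =
    (- (p%:R * h k / p%:R ^+ (p ^ k)))%:P * (p%:R ^+ (p ^ k) *: brk (xiter r) (p ^ k)).
  by rewrite mul_polyC scalerN !scalerA mulNr scaleNr divfK.
apply: hiM; last by apply: hi_brk; rewrite -(ler_nat rat) pexp_gt.
apply: pbd_polyC; rewrite ordgeN; apply: (ordge_divfin (ord_Xfin _ pE)).
by rewrite add0r mulr1; apply: ordgeW (ordgeM p_int (h_ord k)); lra.
Qed.

Let px := p%:R *: xsol.
Let Z : {poly L} := p%:R *: 'X.

Let px_int : pbd v 0 1 px. Proof. exact: pbd_pxiter. Qed.

Lemma px_exp D : exists a b, [/\ pbd v 0 1 a, pbd v e 1 b & px ^+ D = Z ^+ D + Z ^+ D.+1 * a + b].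
Proof.
have [a [b [ha hb E]]] := pxsol_lead; rewrite -/Z -/px in E.
elim: D => [|D [a' [b' [ha' hb' E']]]].
  by exists 0, 0; split; rewrite ?mulr0 ?addr0 //; exact: pbd_0.
exists (a + a' + Z * a' * a), (b' * px + (Z ^+ D + Z ^+ D.+1 * a') * b); split.
- by do !apply: pbdD => //; do !apply: pbdM0 => //.
- apply: pbdD; first by rewrite mulrC; apply: pbdM0.
  by apply: pbdM0 => //; apply: pbdD; [exact: pbd_exp0|apply: pbdM0 => //; exact: pbd_exp0].
- by rewrite exprSr E' {1}E mulrDl [b' * _]mulrC E !exprS; ring.
Qed.

(** Modulo gamma, (p x)^D starts with (p T)^D, so the powers of p x are peeled off one by one, the
    multiples of gamma being collected in m2. *)
Lemma px_expand m D : pbd v 0 1 m -> exists (beta : nat -> L) m1 m2,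
  [/\ forall d, ordge v 0 (beta d), pbd v 0 1 m1, pbd v e 1 m2 &
      m = \sum_(d < D) beta d *: px ^+ d + Z ^+ D * m1 + m2].
Proof.
move=> hm; elim: D => [|D [beta [m1 [m2 [hb h1 h2 E]]]]].
  exists (fun=> 0), m, 0; split=> //; [by move=> _; exact: ordge0|exact: pbd_0|].
  by rewrite big_ord0 expr0 add0r mul1r addr0.
have [a [b [ha hb' E']]] := px_exp D.
(* The quotient of m1 - m1(0) by p T. *)
pose m1' := \poly_(i < size m1) (m1`_i.+1 / p%:R).
have hm1' : pbd v 0 1 m1'.
  move=> i; rewrite coef_poly; case: ifP => _; last exact: ordge0.
  by apply: (ordge_divfin pE); have := h1 i.+1; rewrite -natr1; apply: ordgeW; lra.
have b0 : ordge v 0 m1`_0 by have := h1 0%N; rewrite mulr0 addr0.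
have m1E : m1 = m1`_0 *: 1 + Z * m1'.
  apply/polyP => i; rewrite coefD coefZ coef1 -scalerAl coefZ coefXM.
  case: i => [|i] /=; first by rewrite mulr1 mulr0 addr0.
  rewrite mulr0 add0r coef_poly; case: ltnP => si; last by rewrite mulr0 nth_default // ltnW.
  by rewrite mulrC divfK // (ord_neq0 pE).
exists (fun d => if d == D then m1`_0 else beta d), (m1' - m1`_0 *: a), (m2 - m1`_0 *: b).
split.
- by move=> d; case: ifP.
- by apply: pbdB => //; apply: pbdZ0.
- by apply: pbdB => //; apply: pbdZ0.
rewrite big_ord_recr /= eqxx (eq_bigr (fun d : 'I_D => beta d *: px ^+ d)); last first.
  by move=> d _; rewrite ltn_eqF.
rewrite {1}E {1}m1E E' exprS -!mul_polyC; ring.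
Qed.

Variables (n : nat) (gamma lambda : L).
Hypotheses (gamma_ord : v gamma = e%:E) (lambda_ord : v lambda = 0%E).

Definition Jop f := xsol ^+ n.+1 * shift (-1) f - (lambda * gamma ^+ n.+1) *: f.

Lemma JopD f g : Jop (f + g) = Jop f + Jop g.
Proof. by rewrite /Jop shiftD scalerDr; ring. Qed.

Lemma JopZ (k : L) f : Jop (k *: f) = k *: Jop f.
Proof. by rewrite /Jop shiftZ scalerBr !scalerA scalerAr [_ * k]mulrC. Qed.

Lemma Jop0 : Jop 0 = 0.
Proof. by have := JopZ 0 0; rewrite !scale0r. Qed.

Lemma JopN f : Jop (- f) = - Jop f.
Proof. by rewrite -scaleN1r JopZ scaleN1r. Qed.

Lemma Jop_sum (I : Type) (r : seq I) (F : I -> {poly L}) :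
  Jop (\sum_(i <- r) F i) = \sum_(i <- r) Jop (F i).
Proof. exact: (big_morph Jop JopD Jop0). Qed.

Let g_int : ordge v e gamma. Proof. by rewrite (ordge_fin _ gamma_ord). Qed.
Let g_int0 : ordge v 0 gamma. Proof. exact: ordgeW e0 g_int. Qed.
Let l_int : ordge v 0 lambda. Proof. by rewrite (ordge_fin _ lambda_ord). Qed.
Let p_int0 : ordge v 0 p%:R. Proof. exact: ordgeW p_int. Qed.

(** If (p x)^(n+1) g is the part of degree above n, then J(p^(n+1) g) equals it up to (p x)^(n+1)
    (g(T) - g(T - 1)) and lambda (gamma p)^(n+1) g. Both are divisible by gamma among series
    integral in p T, so the error stays in that lattice. *)
Lemma division_step (beta : nat -> L) D m2 : (forall d, ordge v 0 (beta d)) -> pbd v e 1 m2 ->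
  exists f m3, [/\ pbd v 0 0 f, pbd v e 1 m3 &
    \sum_(d < n.+1 + D) beta d *: px ^+ d + m2 = \sum_(d < n.+1) beta d *: px ^+ d + Jop f + m3].
Proof.
move=> hb hm2; pose g0 := \sum_(d < D) beta (n.+1 + d)%N *: px ^+ d.
have hg0 : pbd v 0 1 g0 by apply: pbd_sum => d _; apply: pbdZ0 => //; apply: pbd_exp0.
exists (p%:R ^+ n.+1 *: g0).
exists (m2 + px ^+ n.+1 * (g0 - shift (-1) g0) + (lambda * (gamma ^+ n.+1 * p%:R ^+ n.+1)) *: g0).
split.
- apply: pbdZ0; first exact: ordgeX0.
  exact: pbdWs hg0.
- apply: pbdD; first apply: pbdD => //.
    apply: pbdM0; first exact: pbd_exp0.
    apply: pbdW (e_le1 p_prime) _; apply: pbdBC; rewrite -[X in pbd v X](add0r 1).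
    by apply: pbd_shift_diff => //; rewrite ordgeN ordge1.
  apply: pbdZ0r => //; apply: ordgeM0 => //; rewrite mulrC; apply: ordgeM0; first exact: ordgeX0.
  by rewrite exprS mulrC; apply: ordgeM0 => //; apply: ordgeX0.
rewrite big_split_ord /= JopZ /Jop.
have -> : \sum_(i < D) beta (n.+1 + i)%N *: px ^+ (n.+1 + i) = px ^+ n.+1 * g0.
  by rewrite mulr_sumr; apply: eq_bigr => d _; rewrite exprD scalerAr.
have -> : px ^+ n.+1 = (p%:R ^+ n.+1)%:P * xsol ^+ n.+1.
  by rewrite /px exprZn mul_polyC.
by rewrite -!mul_polyC !polyCM; ring.
Qed.

(** Each round leaves gamma times a series integral in p T, to which the next round applies. *)
Lemma division_iter r m : pbd v 0 1 m -> exists (b : nat -> L) f t,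
  [/\ forall d, ordge v 0 (b d), pbd v 0 0 f, pbd v (Num.min (r%:R * e) N%:R) 0 t &
      m = \sum_(d < n.+1) b d *: px ^+ d + Jop f + t].
Proof.
elim: r m => [|r IH] m hm.
  exists (fun=> 0), 0, m; split; [by move=> d; exact: ordge0|exact: pbd_0| |].
    apply: (@pbdW _ _ _ v 0); last exact: pbdWs hm.
    by rewrite mul0r ge_min lexx.
  by rewrite Jop0 addr0 big1 ?add0r // => d _; rewrite scale0r.
(* The degree n + 1 + N makes the unexpanded tail (p T)^(n+1+N) m1 divisible by p^N as a polynomial
   in T. *)
have [beta [m1 [m2 [hb h1 h2 E]]]] := px_expand (n.+1 + N) hm.
have [f [m3 [hf h3 E3]]] := division_step N hb h2.
have gn0 := ord_neq0 gamma_ord.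
have h3' : pbd v 0 1 (gamma^-1 *: m3).
  rewrite -[X in pbd v X](addNr e); apply: pbdZ => //.
  by rewrite (ordge_fin _ (ord_Vfin gamma_ord)).
have [b' [f' [t' [hb' hf' ht' E']]]] := IH _ h3'.
exists (fun d => beta d + gamma * b' d), (f + gamma *: f'), (gamma *: t' + Z ^+ (n.+1 + N) * m1).
split.
- by move=> d; apply: ordgeD => //; apply: ordgeM0.
- by apply: pbdD => //; apply: pbdZ0.
- apply: pbdD.
    apply: pbdW (pbdZ g_int ht').
    rewrite -natr1 mulrDl mul1r addr_minr le_min !ge_min.
    by apply/andP; split; apply/orP; [left|right]; [rewrite addrC|rewrite lerDr].
  apply: (@pbdW _ _ _ _ N%:R); first by rewrite ge_min lexx orbT.
  rewrite -[X in pbd v X](addr0); apply: pbdM; last exact: pbdWs h1.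
  rewrite /Z exprZn -[X in pbd v X](addr0); apply: pbdZ; last first.
    by have := pbd_exp (n.+1 + N) (pbdX v 0); rewrite oppr0 mulr0.
  by rewrite (ordge_fin _ (ord_Xfin _ pE)) mulr1 ler_nat leq_addl.
have m3E : m3 = \sum_(d < n.+1) (gamma * b' d) *: px ^+ d + Jop (gamma *: f') + gamma *: t'.
  rewrite -[LHS](scalerKV gn0) E' JopZ; move: (Jop f') => w; rewrite !scalerDr scaler_sumr.
  by congr (_ + _ + _); apply: eq_bigr => d _; rewrite scalerA.
rewrite {1}E addrAC E3 m3E JopD.
under [X in _ = X + _ + _]eq_bigr => d _ do rewrite scalerDl.
rewrite big_split /=; ring.
Qed.

(** The initial round is kept explicit: all later ones carry a factor gamma, so b_d is known modulo
    gamma from the given expansion. *)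
Lemma division_exists (beta : nat -> L) D m2 :
  (forall d, ordge v 0 (beta d)) -> pbd v e 1 m2 ->
  exists (b : nat -> L) f t,
  [/\ forall d, ordge v 0 (b d), forall d, ordge v e (b d - beta d), pbd v 0 0 f, pbd v N%:R 0 t &
      \sum_(d < n.+1 + D) beta d *: px ^+ d + m2 = \sum_(d < n.+1) b d *: px ^+ d + Jop f + t].
Proof.
move=> hb h2; have [f [m3 [hf h3 E3]]] := division_step D hb h2.
have gn0 := ord_neq0 gamma_ord.
have h3' : pbd v 0 1 (gamma^-1 *: m3).
  rewrite -[X in pbd v X](addNr e); apply: pbdZ => //.
  by rewrite (ordge_fin _ (ord_Vfin gamma_ord)).
have [b' [f' [t' [hb' hf' ht' E']]]] := division_iter (N * p.-1) h3'.
rewrite Ne minxx in ht'.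
exists (fun d => beta d + gamma * b' d), (f + gamma *: f'), (gamma *: t'); split.
- by move=> d; apply: ordgeD => //; apply: ordgeM0.
- by move=> d; rewrite addrC addKr mulrC; apply: ordgeM0.
- by apply: pbdD => //; apply: pbdZ0.
- exact: pbdZ0.
have m3E : m3 = \sum_(d < n.+1) (gamma * b' d) *: px ^+ d + Jop (gamma *: f') + gamma *: t'.
  rewrite -[LHS](scalerKV gn0) E' JopZ; move: (Jop f') => w; rewrite !scalerDr scaler_sumr.
  by congr (_ + _ + _); apply: eq_bigr => d _; rewrite scalerA.
rewrite E3 m3E JopD.
under [X in _ = X + _ + _]eq_bigr => d _ do rewrite scalerDl.
rewrite big_split /=; ring.
Qed.

(** Suppose b and f are divisible by gamma^s. One power of gamma further, x may be replaced by T and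
    the term lambda gamma^(n+1) f dropped, leaving the b_d T^d with d <= n on one side and T^(n+1)
    f(T - 1) on the other. No degree is shared, so b and f are divisible by gamma^(s+1), until p^N
    is reached. *)
Lemma division_uniq (b : nat -> L) f t :
  (forall d, ordge v 0 (b d)) -> pbd v 0 0 f -> pbd v N%:R 0 t ->
  \sum_(d < n.+1) b d *: xsol ^+ d = Jop f + t ->
  forall d, (d <= n)%N -> ordge v N%:R (b d).
Proof.
move=> hb hf ht E.
suff H s : (s <= N * p.-1)%N -> (forall d, (d <= n)%N -> ordge v (s%:R * e) (b d)) /\ pbd v (s%:R * e) 0 f.
  by move=> d dn; have [/(_ d dn)] := H _ (leqnn _); rewrite Ne.
elim: s => [_|s IH sN].
  by rewrite mul0r; split=> // d _.
have [hbs hfs] := IH (ltnW sN).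
have hx : pbd v 0 0 xsol by apply: pbd_xiter0.
have hX : pbd v 0 0 ('X : {poly L}) by have := pbdX v 0; rewrite oppr0.
have s1 : s.+1%:R * e = s%:R * e + e by rewrite -natr1 mulrDl mul1r.
have sN' : s.+1%:R * e <= N%:R by rewrite -Ne ler_pM2r ?e_gt0 // ler_nat.
have xX k : pbd v e 0 (xsol ^+ k - 'X^k).
  by apply: pbd_congX => //; apply: xiter_cong.
have m1 : ordge v 0 (-1) by rewrite ordgeN ordge1.
have hsf : pbd v (s%:R * e) 0 (shift (-1) f) by apply: pbd_shift.
have W : pbd v (s.+1%:R * e) 0 (\sum_(d < n.+1) b d *: ('X^d : {poly L}) - 'X^(n.+1) * shift (-1) f).
  have -> : \sum_(d < n.+1) b d *: ('X^d : {poly L}) - 'X^(n.+1) * shift (-1) f =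
    (xsol ^+ n.+1 - 'X^(n.+1)) * shift (-1) f - (lambda * gamma ^+ n.+1) *: f + t
    - \sum_(d < n.+1) b d *: (xsol ^+ d - 'X^d).
    under [X in _ = _ - X]eq_bigr => d _ do rewrite scalerBr.
    by rewrite sumrB E /Jop; ring.
  rewrite s1; apply: pbdB; first apply: pbdD; first apply: pbdB.
  - by rewrite addrC; apply: pbdM.
  - rewrite addrC; apply: pbdZ => //; apply: ordgeM0 => //.
    by rewrite exprS mulrC; apply: ordgeM0 => //; apply: ordgeX0.
  - by rewrite -s1; apply: pbdW ht.
  - by apply: pbd_sum => d _; apply: pbdZ => //; apply: hbs; rewrite -ltnS.
have coefS k : (\sum_(d < n.+1) b d *: ('X^d : {poly L}))`_k = if (k < n.+1)%N then b k else 0.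
  by rewrite -poly_def coef_poly.
split=> [d dn|].
  have := W d; rewrite mul0r addr0 coefB coefS ltnS dn coefXnM ltnS dn subr0 //.
have : pbd v (s.+1%:R * e) 0 (shift (-1) f).
  move=> k; have := W (n.+1 + k)%N; rewrite !mul0r !addr0 coefB coefS coefXnM.
  by rewrite ltnNge leq_addr /= addKn sub0r ordgeN.
move=> /(pbd_shift (lexx 0) (ordge1 v)); rewrite shift_shift subrr shift0 //.
Qed.

End Solution.

(** * Reduction of the cohomology to one variable *)

Section Reduction.
Variables (p n : nat) (Qp : fieldType) (L : splittingFieldType Qp).
Variable v : valuation p L.
Hypotheses (p_prime : prime p) (n_gt0 : (0 < n)%N) (QpP : is_Qp v).
Local Notation e := ((p.-1)%:R^-1 : rat).
Variables (gamma lambda : L).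
Hypotheses (gamma_ord : v gamma = e%:E) (lambda_ord : v lambda = 0%E).
Hypothesis gamma_zero : has_vsum v (fun j : nat => gamma ^+ (p ^ j) / (p ^ j)%N%:R) 0.
Variable N : nat.
Hypothesis N_gt0 : (0 < N)%N.
Implicit Types (u z : 'rV[int]_n) (f g t : {poly L}).

Local Notation h := (hcoef p gamma).
Local Notation x := (xsol p h N).
Local Notation J := (Jop p h N n gamma lambda).

Let h_ord k : ordge v ((p ^ k)%N%:R - 1) (h k). Proof. exact: ordge_hcoef. Qed.
Let h0 : h 0 = 1. Proof. exact: hcoef0 gamma_ord. Qed.
Let h_int k : ordge v 0 (h k).
Proof. by apply: ordgeW (h_ord k); rewrite subr_ge0 ler1n expn_gt0 prime_gt0. Qed.
Let x_int : pbd v 0 0 x. Proof. exact: pbd_xiter0. Qed.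
Let g0 : gamma != 0. Proof. exact: ord_neq0 gamma_ord. Qed.
Let l0 : lambda != 0. Proof. exact: ord_neq0 lambda_ord. Qed.
Let g_int : ordge v 0 gamma.
Proof. by rewrite (ordge_fin _ gamma_ord) ltW // e_gt0. Qed.
Let l_int : ordge v 0 lambda. Proof. by rewrite (ordge_fin _ lambda_ord). Qed.
Let lV_int : ordge v 0 lambda^-1.
Proof. by rewrite (ordge_fin _ (ord_Vfin lambda_ord)) oppr0. Qed.
Let lVX_int k : ordge v 0 (lambda ^- k).
Proof. by rewrite -exprVn; apply: ordgeX0. Qed.

(* The image of gamma^(k_1 + ... + k_n + k_0) x_1^(k_1 - k_0) ... x_n^(k_n - k_0). *)
Definition Psi (k : 'I_n -> nat) k0 : {poly L} :=
  lambda ^- k0 *: (\prod_l brk x (k l) * brk x k0).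

Definition psimon u : {poly L} := Psi (kexp u) (mnat u).

Lemma eq_Psi k k' k0 : k =1 k' -> Psi k k0 = Psi k' k0.
Proof. by move=> kk; rewrite /Psi; congr (_ *: (_ * _)); apply: eq_bigr => l _; rewrite kk. Qed.

Lemma pbd_Psi k k0 : pbd v 0 0 (Psi k k0).
Proof.
apply: pbdZ0 => //; apply: pbdM0; last exact: pbd_brk0.
by apply: pbd_prod0 => l _; apply: pbd_brk0.
Qed.

(** One more factor X_1 ... X_n Y multiplies by x(T)^(n+1) / lambda and shifts T by -1; thus X_1 ...
    X_n Y acts as gamma^(n+1) modulo J. *)
Lemma Psi_succ k k0 :
  Psi (fun l => (k l).+1) k0.+1 = J (lambda^-1 *: Psi k k0) + gamma ^+ n.+1 *: Psi k k0.
Proof.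
rewrite JopZ /Jop scalerBr !scalerA.
have -> : lambda^-1 * (lambda * gamma ^+ n.+1) = gamma ^+ n.+1.
  by rewrite mulrA mulVf // mul1r.
rewrite subrK /Psi; under eq_bigr => l _ do rewrite brkS.
rewrite big_split /= prodr_const card_ord brkS shiftZ shiftM [shift _ (\prod_(l < n) brk _ _)]shift_prod.
rewrite exprS invfM -!mul_polyC !polyCM exprS; ring.
Qed.

(** Modulo the image of J the choice of a monomial over a given exponent does not matter. *)
Lemma Psi_rep z k k0 : (forall l, z ord0 l = (k l)%:Z - k0%:Z) ->
  exists r f, [/\ (\sum_l k l + k0 = wnat z + n.+1 * r)%N, pbd v 0 0 f &
    Psi k k0 = gamma ^+ (n.+1 * r) *: psimon z + J f].
Proof.
move=> /(wnat_rep p_prime)[r [sE k0E kE]].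
suff [f [hf fE]] : exists f, pbd v 0 0 f /\
    Psi (fun l => kexp z l + r)%N (mnat z + r) = gamma ^+ (n.+1 * r) *: psimon z + J f.
  by exists r, f; split=> //; rewrite -fE k0E; apply: eq_Psi.
elim: r {sE k0E kE} => [|r [f [hf fE]]].
  exists 0; split; first exact: pbd_0.
  rewrite muln0 expr0 scale1r Jop0 addr0 /psimon addn0; apply: eq_Psi => l; by rewrite addn0.
exists (lambda^-1 *: Psi (fun l => kexp z l + r)%N (mnat z + r) + gamma ^+ n.+1 *: f).
split; first by apply: pbdD; apply: pbdZ0 => //; [exact: pbd_Psi|exact: ordgeX0].
rewrite addnS (eq_Psi (k' := fun l => (kexp z l + r).+1)); last by move=> l; rewrite addnS.
rewrite Psi_succ [in X in _ + X]fE JopD [J (_ *: f)]JopZ scalerDr scalerA -exprD mulnSr.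
by rewrite [(n.+1 + _)%N]addnC addrCA.
Qed.

(** The identity H(X) X^k = (T - k) X^k, applied to 1: it is the equation for x(T), shifted by k and
    multiplied by X^k 1. *)
Lemma brk_mulT k : exists2 t, pbd v N%:R 0 t &
  \sum_(m < N) h m *: brk x (k + p ^ m) = brk x k * ('X - k%:R%:P) + t.
Proof.
have := xsol_eq p_prime h_ord h0 N_gt0; set s := _ - _ => hs.
exists (- (brk x k * shift (- k%:R) s)).
  apply: pbdN; apply: pbdM0; first exact: pbd_brk0.
  by apply: pbd_shift => //; apply: ordgeNn.
under eq_bigr => m _ do rewrite brkD scalerAr -shiftZ.
rewrite -mulr_sumr -shift_sum -mulrBr; congr (_ * _).
by rewrite /s shiftB shiftX polyCN opprB addrC subrK.
Qed.

(** The powers of X_l contribute (T - k_l) Psi and those of lambda Y contribute (T - k_0) Psi. In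
    the difference T cancels, and k_l - k_0 is compensated by the Euler term. *)
Lemma dwork_relation l k k0 : pbd v N%:R 0
  (((k l)%:R - k0%:R) *: Psi k k0 +
   \sum_(m < N) h m *: (Psi (fun j => k j + (j == l) * p ^ m)%N k0 -
     lambda ^+ (p ^ m) *: Psi k (k0 + p ^ m))).
Proof.
have [t1 ht1 E1] := brk_mulT (k l); have [t0 ht0 E0] := brk_mulT k0.
pose R := \prod_(j | j != l) brk x (k j).
have hR : pbd v 0 0 R by apply: pbd_prod0 => j _; apply: pbd_brk0.
have PE : Psi k k0 = lambda ^- k0 *: (R * brk x (k l) * brk x k0).
  by rewrite /Psi (bigD1 l) //= [brk x (k l) * _]mulrC.
have PE1 m : Psi (fun j => k j + (j == l) * p ^ m)%N k0 =
    (lambda ^- k0 *: (R * brk x k0)) * brk x (k l + p ^ m).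
  rewrite /Psi (bigD1 l) //= eqxx mul1n (eq_bigr (fun j => brk x (k j))); last first.
    by move=> j /negbTE ->; rewrite mul0n addn0.
  by rewrite -/R -!mul_polyC; ring.
have PE0 m : lambda ^+ (p ^ m) *: Psi k (k0 + p ^ m) =
    (lambda ^- k0 *: (R * brk x (k l))) * brk x (k0 + p ^ m).
  rewrite /Psi (bigD1 l) //= -/R scalerA exprD invfM mulrCA mulfV ?mulr1 ?expf_neq0 //.
  by rewrite -!mul_polyC; ring.
under eq_bigr => m _ do rewrite PE1 PE0 scalerBr !scalerAr.
rewrite sumrB -!mulr_sumr E1 E0 PE.
rewrite (_ : _ + _ = (lambda ^- k0 *: (R * brk x k0)) * t1 - (lambda ^- k0 *: (R * brk x (k l))) * t0).
  by apply: pbdB; apply: pbdM0 => //; apply: pbdZ0 => //; apply: pbdM0 => //; apply: pbd_brk0.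
rewrite -!mul_polyC polyCB; ring.
Qed.

(** The image of D_l applied to the normalized monomial of exponent u, with H cut after N terms: it
    vanishes modulo J and p^N. The quotients of powers of gamma renormalize the monomials. *)
Lemma dwork_kernel l u : exists f t, [/\ pbd v 0 0 f, pbd v N%:R 0 t &
  (u ord0 l)%:~R *: psimon u +
  \sum_(m < N) p%:R ^+ m * gamma_ p gamma m *:
    ((gamma ^+ wnat u / gamma ^+ wnat (u + ex l *+ p ^ m)) *: psimon (u + ex l *+ p ^ m) -
     (lambda ^+ (p ^ m) * (gamma ^+ wnat u / gamma ^+ wnat (u - exall n *+ p ^ m))) *:
       psimon (u - exall n *+ p ^ m)) = J f + t].
Proof.
have ex1 m : exists f, pbd v 0 0 f /\
    (gamma ^+ (p ^ m) * (gamma ^+ wnat u / gamma ^+ wnat (u + ex l *+ p ^ m))) *: psimon (u + ex l *+ p ^ m) =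
    Psi (fun j => kexp u j + (j == l) * p ^ m)%N (mnat u) - J f.
  have [r [f [sE hf fE]]] := Psi_rep (rep_ex u l (p ^ m)).
  exists f; split=> //; rewrite fE addrK; congr (_ *: _).
  by rewrite mulrA -exprD [(p ^ m + _)%N]addnC -(sum_ex u l) sE exprD mulrAC divff ?mul1r // expf_neq0.
have ex2 m : exists f, pbd v 0 0 f /\
    (gamma ^+ (p ^ m) * (gamma ^+ wnat u / gamma ^+ wnat (u - exall n *+ p ^ m))) *: psimon (u - exall n *+ p ^ m) =
    Psi (kexp u) (mnat u + p ^ m) - J f.
  have [r [f [sE hf fE]]] := Psi_rep (rep_exall u (p ^ m)).
  exists f; split=> //; rewrite fE addrK; congr (_ *: _).
  by rewrite mulrA -exprD [(p ^ m + _)%N]addnC (wnatE u) -addnA sE exprD mulrAC divff ?mul1r // expf_neq0.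
have [f1 hf1] := choice ex1; have [f2 hf2] := choice ex2.
exists (- \sum_(m < N) h m *: (f1 m - lambda ^+ (p ^ m) *: f2 m)).
eexists; split; last first; [|exact: (dwork_relation l (kexp u) (mnat u))|].
  have uE : (u ord0 l)%:~R = (kexp u l)%:R - (mnat u)%:R :> L.
    by rewrite 2!pmulrn -intrB; congr (_%:~R); rewrite kexpE mnatE addrK.
  rewrite uE JopN Jop_sum [RHS]addrC -addrA; congr (_ + _).
  rewrite -sumrB; apply: eq_bigr => m _.
  have [_ q1E] := hf1 m; have [_ q2E] := hf2 m.
  rewrite JopZ JopD JopN JopZ -scalerBr (hcoefE gamma_ord) -scalerA; congr (_ *: _).
  rewrite scalerBr scalerA q1E scalerA mulrCA -scalerA q2E.
  by rewrite scalerBr; move: (J _) (J _) => *; ring.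
apply: pbdN; apply: pbd_sum => m _; apply: pbdZ0 => //.
by apply: pbdB; [case: (hf1 m)|apply: pbdZ0; [exact: ordgeX0|case: (hf2 m)]].
Qed.

Lemma psimon_exfirst i : (i <= n)%N -> psimon (exfirst n i) = x ^+ i.
Proof.
move=> le; rewrite /psimon /Psi mnat_exfirst expr0 invr1 scale1r brk0 mulr1.
rewrite -[in RHS](sum_ltn le) expr_sum; apply: eq_bigr => l _; rewrite kexp_exfirst.
by case: (l < i)%N; rewrite ?brk1 ?brk0 ?expr1.
Qed.

Let p_int : ordge v 1 p%:R. Proof. by rewrite (ordge_fin _ (ord_p (val_ordP v))). Qed.

(** Among series integral in p T, all the shifted factors coincide modulo p. *)
Lemma pbd_pbrk k : pbd v 1 1 (p%:R ^+ k *: brk x k - (p%:R *: x) ^+ k).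
Proof.
have hx : pbd v (-1) 1 x by apply: pbd_xiter1.
have -> : (p%:R *: x) ^+ k = \prod_(i < k) (p%:R *: x) by rewrite prodr_const card_ord.
have -> : p%:R ^+ k *: brk x k = \prod_(i < k) (p%:R *: shift (- i%:R) x).
  by rewrite /brk scaler_prod prodr_const card_ord.
apply: pbd_cong_prod => [i|_|i].
- have := pbdZ p_int (pbd_shift ler01 (ordgeNn v i) hx); by rewrite subrr.
- exact: pbd_pxiter.
- rewrite -scalerBr -[X in pbd v X](addr0 1); apply: pbdZ => //.
  by rewrite -[X in pbd v X](addNr 1); apply: pbd_shift_diff => //; exact: ordgeNn.
Qed.

(** Hence, modulo p, the image of p^(w(z)) times a normalized monomial depends only on w(z) and
    m(z). *)
Lemma pbd_psimon z :
  pbd v 1 1 (p%:R ^+ wnat z *: psimon z - lambda ^- mnat z *: (p%:R *: x) ^+ wnat z).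
Proof.
have hb k : pbd v 0 1 (p%:R ^+ k *: brk x k).
  have := pbdZ (ordgeX k p_int) (pbd_brk k ler01 (pbd_xiter1 N h_ord (N * p.-1))).
  by rewrite mulrN mulr1 subrr.
have hx : pbd v 0 1 (p%:R *: x) by apply: pbd_pxiter.
rewrite /psimon /Psi wnatE exprD expr_sum.
have -> : (\prod_l p%:R ^+ kexp z l * p%:R ^+ mnat z) *:
    (lambda ^- mnat z *: (\prod_l brk x (kexp z l) * brk x (mnat z))) =
    lambda ^- mnat z *: (\prod_l (p%:R ^+ kexp z l *: brk x (kexp z l)) *
      (p%:R ^+ mnat z *: brk x (mnat z))).
  by rewrite scaler_prod -!mul_polyC !polyCM; ring.
rewrite -scalerBr; apply: pbdZ0 => //; rewrite exprD expr_sum; apply: pbd_congM.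
- by apply: pbd_prod0 => l _; apply: hb.
- exact: pbd_exp0.
- apply: pbd_cong_prod => l; [exact: hb|exact: pbd_exp0|exact: pbd_pbrk].
- exact: pbd_pbrk.
Qed.

Lemma sum_mono_scale (V : {fset 'rV[int]_n}) c u y (Q : 'rV[int]_n -> {poly L}) : u + y \in V ->
  \sum_(z <- V) mono c y (z - u) *: Q z = c *: Q (u + y).
Proof.
move=> yV; rewrite (big_fsetD1 (u + y)) //= [u + y]addrC {1}/mono addrK eqxx big_seq big1 ?addr0 // => z.
rewrite in_fsetD1 => /andP[zu _]; rewrite /mono subr_eq (negbTE zu) scale0r //.
Qed.

(** * One column of the Frobenius matrix modulo p^N *)

Section Conclusion.
Variables (sigma : gal_of {:L}) (i : nat).
Hypothesis i_le : (i <= n)%N.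
Local Notation tau := (sigma^-1)%g.
Hypothesis tau_ord : forall y k, ordge v (k%:R * e) y -> ordge v (k%:R * e) (tau y).
Hypothesis tau_gamma : ordge v e (tau gamma / gamma - 1).
Local Notation al := (alpha1 p v gamma lambda sigma (eps gamma i)).

(** The terms are grouped by weight d into coefficients [beta d] of (p x)^d. Among weights at most
    i, only the exponent u_i has a coefficient that is nonzero modulo gamma, and that one is 1 in
    weight i; division by J changes [beta d] only by multiples of gamma. *)
Lemma alpha_expand (V : {fset 'rV[int]_n}) : exfirst n i \in V ->
  exists (b : nat -> L) f t, [/\ forall d, ordge v 0 (b d),
    forall d, (d < i)%N -> ordge v e (b d), ordge v e (b i - 1), pbd v 0 0 f /\ pbd v N%:R 0 t &
    \sum_(z <- V) (al z / gamma ^+ wnat z) *: psimon z =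
      \sum_(d < n.+1) (p%:R ^+ d * b d) *: x ^+ d + J f + t].
Proof.
move=> iV; pose F (z : 'rV[int]_n) := frob_coef v gamma lambda sigma i z.
have Fint z : ordge v 0 (F z) by apply: frob_coef_int.
pose beta d := \sum_(z <- V) if wnat z == d then F z * lambda ^- mnat z else 0.
(* A crude bound for the weights occurring in [V]. *)
pose D := (\sum_(z <- V) wnat z)%N.
pose m2 := \sum_(z <- V) F z *: (p%:R ^+ wnat z *: psimon z - lambda ^- mnat z *: (p%:R *: x) ^+ wnat z).
have hb d : ordge v 0 (beta d).
  by apply: ordge_sum => z _; case: ifP => _; [apply: ordgeM0|exact: ordge0].
have h2 : pbd v e 1 m2.
  by apply: pbd_sum => z _; apply: pbdZ0 => //; apply: pbdW (e_le1 p_prime) _; apply: pbd_psimon.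
have E : \sum_(z <- V) (al z / gamma ^+ wnat z) *: psimon z =
    \sum_(d < n.+1 + D) beta d *: (p%:R *: x) ^+ d + m2.
  have -> : \sum_(d < n.+1 + D) beta d *: (p%:R *: x) ^+ d =
      \sum_(z <- V) F z *: (lambda ^- mnat z *: (p%:R *: x) ^+ wnat z).
    under eq_bigr => d _ do rewrite scaler_suml.
    rewrite exchange_big /= [LHS]big_seq [RHS]big_seq; apply: eq_bigr => z zV.
    have zD : (wnat z < n.+1 + D)%N.
      by rewrite /D (big_fsetD1 z) //= addSn ltnS addnCA leq_addr.
    rewrite (bigD1 (Ordinal zD)) //= eqxx scalerA big1 ?addr0 // => d dz.
    case: eqP => [wd|]; last by rewrite scale0r.
    by case/eqP: dz; apply: val_inj.
  rewrite -big_split /=; apply: eq_bigr => z _.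
  have <- : F z * p%:R ^+ wnat z = al z / gamma ^+ wnat z.
    by rewrite /F /frob_coef divfK // expf_neq0 // (ord_neq0 (ord_p (val_ordP v))).
  by rewrite -scalerA -scalerDr addrC subrK.
have [b [f [t [hb' bb hf ht E']]]] := division_exists p_prime N h_ord n gamma_ord lambda_ord D hb h2.
have small z : (wnat z <= i)%N -> z != exfirst n i -> ordge v e (F z).
  exact: frob_coef_small.
exists b, f, t; split=> //.
- move=> d di; rewrite -(subrK (beta d) (b d)); apply: ordgeD => //.
  apply: ordge_sum => z _; case: eqP => wz; last exact: ordge0.
  rewrite mulrC; apply: ordgeM0 => //; apply: small; first by rewrite wz ltnW.
  by apply: contraTneq di => zE; rewrite -wz zE wnat_exfirst // ltnn.
- rewrite -(subrK (beta i) (b i)) -addrA; apply: ordgeD => //.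
  rewrite /beta (big_fsetD1 (exfirst n i)) //= wnat_exfirst // eqxx mnat_exfirst expr0 divr1.
  rewrite addrAC; apply: ordgeD.
    by apply: frob_coef_diag => //; apply: gamma_pow.
  rewrite big_seq; apply: ordge_sum => z; rewrite in_fsetD1 => /andP[zi _].
  case: eqP => wz; last exact: ordge0.
  by rewrite mulrC; apply: ordgeM0 => //; apply: small => //; rewrite wz.
rewrite E E'; congr (_ + _ + _); apply: eq_bigr => d _.
by rewrite exprZn scalerA mulrC.
Qed.

Variable A : nat -> L.
Hypothesis A_int : forall j, ordge v 0 (A j).
Variables (xi hh : 'I_n -> series n L).
Hypotheses (xi_int : forall l u, ordge v 0 (xi l u)) (xi_to0 : forall l, tends_to0 v (xi l)).
Hypothesis hhE : forall l u, hh l u = xi l u * gamma ^ weight u.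
Hypothesis relation : forall z, al z - \sum_(j < n.+1) A j * eps gamma j z =
  \sum_l Dop p v gamma lambda l (hh l) z.

(** The product H h is cut in two ways at once: exponents u where h is divisible by p^N are dropped,
    and H is cut after N terms. *)
Lemma lmul_approx (U : {fset 'rV[int]_n}) l z :
  (forall u, u \notin U -> ordge v N%:R (xi l u)) ->
  ordge v (N%:R + (wnat z)%:R * e)
    (lmul v (Hser p v gamma lambda l) (hh l) z -
     \sum_(u <- U) xi l u * gamma ^+ wnat u * \sum_(m < N) hterm p gamma lambda l m (z - u)).
Proof.
move=> hU.
have H1 u : ordge v ((wnat z)%:R * e) (Hser p v gamma lambda l (z - u) * gamma ^+ wnat u).
  have := Hser_approx p_prime QpP gamma_ord lambda_ord gamma_zero 0 l z u.
  by rewrite big_ord0 subr0 add0r.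
have tE u : Hser p v gamma lambda l (z - u) * hh l u =
    xi l u * (Hser p v gamma lambda l (z - u) * gamma ^+ wnat u).
  by rewrite hhE weightE -exprnP mulrCA.
apply: (@ordge_trans _ _ _ v _ _ (\sum_(u <- U) Hser p v gamma lambda l (z - u) * hh l u)).
  apply: (vsum_approx QpP) => [M|u /hU hu]; last by rewrite tE; apply: ordgeM.
  apply: sub_finite_set (xi_to0 l M) => u /=; apply: contraTT; rewrite -!leNgt => hu.
  rewrite tE; have := ordgeM (hu : ordge v M%:R _) (H1 u); apply: ordgeW.
  by rewrite lerDl mulr_ge0 // ltW // e_gt0.
rewrite -sumrB; apply: ordge_sum => u _; rewrite tE -!mulrA -mulrBr.
apply: ordgeM0 => //; rewrite [gamma ^+ _ * _]mulrC -mulrBl.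
exact: Hser_approx.
Qed.

(** The linear map sending the normalized monomial of exponent z to [psimon z] is applied to the
    relation in W, restricted to a finite set. The terms from the D_l vanish modulo J and p^N, so
    the [A d] and the p^d b_d of [alpha_expand] are remainders of the same element. *)
Lemma frobenius_column : exists b : nat -> L, [/\ forall d, ordge v 0 (b d),
    forall d, (d < i)%N -> ordge v e (b d), ordge v e (b i - 1) &
    forall d, (d <= n)%N -> ordge v N%:R (A d - p%:R ^+ d * b d)].
Proof.
have exU l : exists B : {fset 'rV[int]_n}, forall u, u \notin B -> ordge v N%:R (xi l u).
  have /finite_fsetP[B hB] := xi_to0 l N; exists B => u uB.
  rewrite /ordge leNgt; apply/negP => lt; case/negP: uB.
  by have : [set` B]%classic u by rewrite -hB.
have [B hB] := choice exU.
pose us : seq 'rV[int]_n := flatten [seq enum_fset (B l) | l <- enum 'I_n].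
pose U : {fset 'rV[int]_n} := [fset u in us]%fset.
have hU l u : u \notin U -> ordge v N%:R (xi l u).
  move=> uU; apply: hB; apply: contraNN uU => uB; rewrite in_fset /=.
  by apply/flattenP; exists (enum_fset (B l)) => //; apply/mapP; exists l; rewrite ?mem_enum.
pose lm := [seq (l, m) | l <- enum 'I_n, m <- iota 0 N].
pose addex (u : 'rV[int]_n) (a : 'I_n * nat) : 'rV[int]_n := u + ex a.1 *+ (p ^ a.2).
pose subex (u : 'rV[int]_n) (m : nat) : 'rV[int]_n := u - exall n *+ (p ^ m).
pose exs := [seq exfirst n j | j <- iota 0 n.+1].
(* Besides the exponents of the truncated h, [V] contains all their translates under the truncated
   H, so that [dwork_kernel] applies without boundary terms, and the exponents of the basis. *)
pose V : {fset 'rV[int]_n} := [fset z in us ++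
  [seq addex u a | u <- us, a <- lm] ++
  [seq subex u m | u <- us, m <- iota 0 N] ++
  exs]%fset.
have lmP l (m : 'I_N) : (l, val m) \in lm.
  by apply: allpairs_f; rewrite ?mem_enum // mem_iota add0n ltn_ord.
have V1 u : u \in us -> u \in V by rewrite in_fset /= mem_cat => ->.
have V2 u l (m : 'I_N) : u \in us -> u + ex l *+ (p ^ m) \in V.
  move=> uU; rewrite in_fset /= !mem_cat.
  by rewrite (allpairs_f addex uU (lmP l m)) !orbT.
have V3 u (m : 'I_N) : u \in us -> u - exall n *+ (p ^ m) \in V.
  move=> uU; rewrite in_fset /= !mem_cat.
  have mN : val m \in iota 0 N by rewrite mem_iota add0n ltn_ord.
  by rewrite (allpairs_f subex uU mN) !orbT.
have V4 j : (j <= n)%N -> exfirst n j \in V.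
  move=> jn; rewrite in_fset /= !mem_cat.
  by rewrite (map_f (exfirst n) (_ : j \in iota 0 n.+1)) ?orbT // mem_iota.
have gn0 k : gamma ^+ k != 0 by rewrite expf_neq0.
(* The coefficient of x^z in the truncated D_l applied to x^u. *)
pose ker l u z := (z == u)%:R * (u ord0 l)%:~R + \sum_(m < N) hterm p gamma lambda l m (z - u).
(* What the truncations lose, in normalized monomials. *)
pose err z := (al z - \sum_(j < n.+1) A j * eps gamma j z -
  \sum_l \sum_(u <- U) xi l u * gamma ^+ wnat u * ker l u z) / gamma ^+ wnat z.
have herr z : ordge v N%:R (err z).
  rewrite /err; apply: (ordge_divfin (ord_Xfin _ gamma_ord)).
  rewrite relation -sumrB; apply: ordge_sum => l _; rewrite /Dop.
  under eq_bigr => u _ do rewrite /ker mulrDr.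
  rewrite big_split /= opprD addrACA; apply: ordgeD; last exact: lmul_approx (hU l).
  have [zU|zU] := boolP (z \in U).
    rewrite (big_fsetD1 z) //= eqxx mul1r big_seq big1 ?addr0.
      by rewrite hhE weightE -exprnP [_%:~R * _]mulrC subrr ordge0.
    move=> u; rewrite in_fsetD1 eq_sym => /andP[/negbTE -> _].
    by rewrite mul0r mulr0.
  rewrite big_seq big1 ?subr0.
    apply: ordgeM0; first exact: ordge_int.
    rewrite hhE weightE -exprnP; apply: ordgeM; first exact: hU.
    by rewrite (ordge_fin _ (ord_Xfin _ gamma_ord)).
  by move=> u uU; case: eqP => [zu|]; [rewrite zu uU in zU|rewrite mul0r mulr0].
have kerE l u : u \in us -> exists f t, [/\ pbd v 0 0 f, pbd v N%:R 0 t &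
    \sum_(z <- V) (gamma ^+ wnat u * ker l u z / gamma ^+ wnat z) *: psimon z = J f + t].
  move=> uU; have [f [t [hf ht E]]] := dwork_kernel l u; exists f, t; split=> //; rewrite -E.
  pose Q z := (gamma ^+ wnat u / gamma ^+ wnat z) *: psimon z.
  have -> : \sum_(z <- V) (gamma ^+ wnat u * ker l u z / gamma ^+ wnat z) *: psimon z =
    \sum_(z <- V) ((z == u)%:R * (u ord0 l)%:~R) *: Q z +
    \sum_(m < N) \sum_(z <- V) hterm p gamma lambda l m (z - u) *: Q z.
    rewrite exchange_big /= -big_split /=; apply: eq_bigr => z _.
    transitivity (ker l u z *: Q z); last by rewrite /ker scalerDl scaler_suml.
    by rewrite /Q [RHS]scalerA; congr (_ *: _); rewrite mulrA [ker l u z * _]mulrC.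
  congr (_ + _).
    rewrite (big_fsetD1 u) ?V1 //= eqxx mul1r /Q divff // scale1r big_seq big1 ?addr0 // => z.
    by rewrite in_fsetD1 => /andP[/negbTE -> _]; rewrite mul0r scale0r.
  apply: eq_bigr => m _; rewrite /hterm.
  under eq_bigr => z _ do rewrite -scalerA scalerBl.
  rewrite -scaler_sumr sumrB sum_mono_scale ?V2 // sum_mono_scale ?V3 //.
  by rewrite scale1r /Q !scalerA.
(* The pair (0, 0) outside [us] makes the statement total, so that witnesses can be chosen as a
   function. *)
have kerE' lu : exists ft : {poly L} * {poly L}, lu.2 \in us -> [/\ pbd v 0 0 ft.1, pbd v N%:R 0 ft.2 &
    \sum_(z <- V) (gamma ^+ wnat lu.2 * ker lu.1 lu.2 z / gamma ^+ wnat z) *: psimon z = J ft.1 + ft.2].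
  have [uU|uU] := boolP (lu.2 \in us); last by exists (0, 0).
  by have [f [t H]] := kerE lu.1 _ uU; exists (f, t).
have [ft hft] := choice kerE'.
have Uus u : u \in U -> u \in us by rewrite in_fset.
pose F := \sum_l \sum_(u <- U) xi l u *: (ft (l, u)).1.
pose T := \sum_l \sum_(u <- U) xi l u *: (ft (l, u)).2.
have hF : pbd v 0 0 F.
  apply: pbd_sum => l _; apply: pbd_sumS => u /Uus uU; apply: pbdZ0 => //.
  by have [] := hft (l, u) uU.
have hT : pbd v N%:R 0 T.
  apply: pbd_sum => l _; apply: pbd_sumS => u /Uus uU; apply: pbdZ0 => //.
  by have [] := hft (l, u) uU.
have hE : pbd v N%:R 0 (\sum_(z <- V) err z *: psimon z).
  by apply: pbd_sum => z _; apply: pbdZ0r => //; apply: pbd_Psi.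
have mainE : \sum_(z <- V) err z *: psimon z =
    \sum_(z <- V) (al z / gamma ^+ wnat z) *: psimon z - \sum_(j < n.+1) A j *: x ^+ j - (J F + T).
  have -> : J F + T = \sum_(z <- V) (\sum_l \sum_(u <- U) xi l u * gamma ^+ wnat u * ker l u z) /
      gamma ^+ wnat z *: psimon z.
    under [RHS]eq_bigr => z _ do rewrite mulr_suml scaler_suml.
    rewrite exchange_big /F /T Jop_sum -big_split /=; apply: eq_bigr => l _.
    under [RHS]eq_bigr => z _ do rewrite mulr_suml scaler_suml.
    rewrite exchange_big Jop_sum -big_split /= big_seq [RHS]big_seq; apply: eq_bigr => u /Uus uU.
    have [_ _ E] := hft (l, u) uU; rewrite JopZ -scalerDr -E scaler_sumr; apply: eq_bigr => z _.
    by rewrite scalerA; congr (_ *: _); ring.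
  have -> : \sum_(j < n.+1) A j *: x ^+ j =
      \sum_(z <- V) (\sum_(j < n.+1) A j * eps gamma j z) / gamma ^+ wnat z *: psimon z.
    under [RHS]eq_bigr => z _ do rewrite mulr_suml scaler_suml.
    rewrite exchange_big /=; apply: eq_bigr => j _.
    have jn : (j <= n)%N by rewrite -ltnS.
    rewrite (big_fsetD1 (exfirst n j)) ?V4 //= /eps /mono eqxx wnat_exfirst // mulfK //.
    rewrite psimon_exfirst // big_seq big1 ?addr0 // => z.
    by rewrite in_fsetD1 => /andP[/negbTE -> _]; rewrite mulr0 mul0r scale0r.
  by rewrite -!sumrB; apply: eq_bigr => z _; rewrite -!scalerBl -!mulrBl.
have [b [f [t [hb b1 b2 [hf ht] E]]]] := alpha_expand (V4 i i_le).
exists b; split=> // d dn.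
pose cc k := if (k < n.+1)%N then A k - p%:R ^+ k * b k else 0.
have hcc k : ordge v 0 (cc k).
  rewrite /cc; case: ifP => _; last exact: ordge0.
  by apply: ordgeB => //; apply: ordgeM0 => //; apply: ordgeX0; apply: ordge_nat.
have := @division_uniq _ _ _ _ p_prime h N h_ord n gamma lambda gamma_ord lambda_ord cc (f - F)
  (t - T - \sum_(z <- V) err z *: psimon z) hcc _ _ _ d dn.
rewrite /cc ltnS dn; apply.
- exact: pbdB.
- by apply: pbdB => //; apply: pbdB.
rewrite mainE E JopD JopN.
have -> : \sum_(k < n.+1) (if (k < n.+1)%N then A k - p%:R ^+ k * b k else 0) *: x ^+ k =
    \sum_(k < n.+1) A k *: x ^+ k - \sum_(k < n.+1) (p%:R ^+ k * b k) *: x ^+ k.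
  by rewrite -sumrB; apply: eq_bigr => k _; rewrite ltn_ord scalerBl.
ring.
Qed.

End Conclusion.
End Reduction.

Theorem theorem1p6
  (p a n : nat) (p_prime : prime p) (n_gt0 : (0 < n)%N)
  (Qp : fieldType) (Omega0 : splittingFieldType Qp)
  (ord : Omega0 -> \bar rat) (ordP : is_ord p ord) (QpP : is_Qp ord)
  (Qq : {subfield Omega0}) (Qq_deg : \dim Qq = a) (Qq_unr : unramified ord Qq)
  (zeta : Omega0) (zetaP : p.-primitive_root zeta)
  (Omega0P : <<Qq; zeta>>%VS = fullv)
  (Fq : finFieldType) (FqP : #|Fq| = (p ^ a)%N)
  (red : Omega0 -> Fq) (redP : is_reduction ord (in_O0 ord Qq zeta) red)
  (lambdabar : Fq) (lambdabar_neq0 : lambdabar != 0)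
  (lambda : Omega0) (lambda_in : in_Zq ord Qq lambda)
  (lambda_teich : lambda ^+ (p ^ a) = lambda)
  (lambda_red : red lambda = lambdabar)
  (sigma : gal_of {:Omega0}) (sigma_zeta : sigma zeta = zeta)
  (sigma_frob : forall x, in_Zq ord Qq x -> (0 < ord (sigma x - x ^+ p)%R)%E)
  (gamma : Omega0)
  (gamma_zero : has_vsum ord (fun j : nat => gamma ^+ (p ^ j) / (p ^ j)%N%:R) 0)
  (gamma_ord : ord gamma = ((p.-1)%:R^-1)%:E)
  (A : 'M[Omega0]_n.+1)
  (AP : frobenius_matrix p ord (in_O0 ord Qq zeta) gamma lambda sigma A) :
  [/\ forall i j : 'I_n.+1, (j%:R%:E <= ord (A j i))%E,
      forall j : 'I_n.+1, ord (A j j) = j%:R%:E /\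
        congr_mod (in_O0 ord Qq zeta) gamma (A j j / p%:R ^+ j) 1 &
      forall i j : 'I_n.+1, (j < i)%N -> (j%:R%:E < ord (A j i))%E].
Proof.
pose v := Valuation ordP.
have QpP' : is_Qp v := QpP.
have gz : has_vsum v (fun j : nat => gamma ^+ (p ^ j) / (p ^ j)%N%:R) 0 := gamma_zero.
have gord : v gamma = ((p.-1)%:R^-1)%:E := gamma_ord.
have O0P y : in_O0 ord Qq zeta y <-> ordge v 0 y.
  exact: (in_O0P p_prime QpP' Qq_unr zetaP Omega0P).
have lambda_int : in_O0 ord Qq zeta lambda by apply/O0P; case: lambda_in.
(* A positive order would make the residue of lambda zero. *)
have lord : v lambda = 0%E.
  apply/eqP; rewrite eq_le (_ : (0 <= v lambda)%E) ?andbT; last by case: lambda_in.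
  rewrite leNgt; apply/negP => /(red_ker redP lambda_int).2 E.
  by case/eqP: lambdabar_neq0; rewrite -lambda_red.
have gpow := gamma_pow p_prime gord gz.
have tau_ord := @sigmaV_ord _ _ _ v p_prime QpP' Qq Qq_unr zeta zetaP Omega0P sigma sigma_zeta
  sigma_frob gamma gord gpow.
have tau_gamma := @sigmaV_gamma _ _ _ v p_prime QpP' Qq Qq_unr zeta zetaP Omega0P sigma sigma_zeta
  sigma_frob gamma gord gpow.
have [A_int AE] := AP.
(* The precision p^(n+1) suffices: after division by p^j with j <= n the error still has order at
   least 1, hence is 0 modulo gamma. *)
have col (i : 'I_n.+1) : exists b : nat -> Omega0, [/\ forall d, ordge v 0 (b d),
    forall d, (d < i)%N -> ordge v (p.-1%:R^-1) (b d), ordge v (p.-1%:R^-1) (b i - 1) &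
    forall d, (d <= n)%N -> ordge v n.+1%:R (A (inord d) i - p%:R ^+ d * b d)].
  have [hh [hC hE]] := AE i.
  have [xi hxi] := choice hC.
  have i_le : (i <= n)%N by rewrite -ltnS.
  apply: (@frobenius_column p n Qp Omega0 v p_prime n_gt0 QpP' gamma lambda gord lord gz n.+1 isT
    sigma i i_le tau_ord tau_gamma (fun d => A (inord d) i) _ xi hh).
  - by move=> d; apply/O0P.
  - by move=> l u; apply/O0P; have [h _ _] := hxi l; apply: h.
  - by move=> l; have [_ h _] := hxi l; apply: h.
  - by move=> l u; have [_ _ h] := hxi l; apply: h.
  - move=> z; rewrite -hE; congr (_ - _); apply: eq_bigr => j _; by rewrite inord_val.
have pE : v p%:R = 1%:E by apply: ord_p ordP.
have p_int : ordge v 1 p%:R by rewrite (ordge_fin _ pE).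
have colP (i j : 'I_n.+1) : exists2 c, [/\ ordge v 0 c,
    (j < i)%N -> ordge v (p.-1%:R^-1) c & j = i -> ordge v (p.-1%:R^-1) (c - 1)] & A j i = p%:R ^+ j * c.
  have [b [b0 b1 b2 bA]] := col i.
  have p0 := ord_neq0 (ord_Xfin j pE).
  exists (A j i / p%:R ^+ j); last by rewrite mulrC divfK.
  have jn : (j <= n)%N by rewrite -ltnS.
  have hj : ordge v 1 (A j i / p%:R ^+ j - b j).
    rewrite -(ordge_mulfin _ _ (ord_Xfin j pE)) mulr1 mulrBl divfK // [b j * _]mulrC.
    have := bA j jn; rewrite inord_val; apply: ordgeW.
    by rewrite -natr1 addrC lerD2r ler_nat.
  have e1 := e_le1 p_prime.
  rewrite -(subrK (b j) (A j i / p%:R ^+ j)); split.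
  - by apply: ordgeD => //; apply: ordgeW hj.
  - by move=> ji; apply: ordgeD; [apply: ordgeW hj|apply: b1].
  - move=> ji; rewrite -addrA; apply: ordgeD; first exact: ordgeW hj.
    by rewrite ji.
have pj (j : nat) : ordge v j%:R (p%:R ^+ j : Omega0).
  by have := ordgeX j p_int; rewrite mulr1.
split.
- move=> i j; have [c [c0 _ _] ->] := colP i j.
  by rewrite mulrC; apply: (ordgeM0 c0 (pj j)).
- move=> j; have [c [c0 _ c1] ->] := colP j j.
  have {}c1 := c1 erefl; have e0 := e_gt0 p_prime.
  have cE : v c = 0%:E by apply: (ord_eqP (vord1 v) e0).
  split; first by rewrite -[LHS]/(v _) (ord_Mfin (ord_Xfin j pE) cE) mulr1 addr0.
  have pj0 := ord_neq0 (ord_Xfin j pE); have g0 := ord_neq0 gord.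
  exists ((c - 1) / gamma); last by rewrite mulrC mulKf // mulrC divfK.
  by apply/O0P; apply: (ordge_divfin gord); rewrite add0r.
- move=> i j ji; have [c [_ c1 _] ->] := colP i j.
  have h : ordge v (j%:R + p.-1%:R^-1) (p%:R ^+ j * c) by apply: ordgeM; [exact: pj|exact: c1].
  by apply: lt_le_trans h; rewrite lte_fin ltrDl e_gt0.
Qed.
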